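(* Let $\mathcal M=m(H,K)$ be a mean curvature function. Let $\alpha:\mathbb V^2\to\mathbb R^3$ be an immersion of class $C^r$, $r\ge6$, of a compact oriented surface, and $c$ a maximal $\mathcal M$-mean curvature cycle of $\alpha$, parametrized by arc length and of length $L$. In the chart $(s,v)$ along $c$ described in the context consider the deformation $$\beta_\epsilon(s,v)=\alpha(s,v)+\epsilon\left[\frac{A_1(s)}6v^3\right]\delta(v)N(s),$$ where $\delta=1$ in a neighborhood of $v=0$, $\delta$ has small support, and $A_1(s)=\tau_g(s)>0$. Then $c$ is an $\mathcal M$-mean curvature cycle of $\beta_\epsilon$ for all $\epsilon$ small. Moreover, if $\mathcal M$ is positive regular, then $c$ is a hyperbolic $\mathcal M$-mean curvature cycle of $\beta_\epsilon$ for all $\epsilon\ne0$ small.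
   Context: $N$ is the positive unit normal of the immersion, $I=E\,du^2+2F\,du\,dv+G\,dv^2$, $II=e\,du^2+2f\,du\,dv+g\,dv^2$ the fundamental forms, $k_n=II/I$, $k_1\le k_2$ the principal curvatures, $\mathcal H=(k_1+k_2)/2$, $\mathcal K=k_1k_2$. A mean curvature function $\mathcal M=m(H,K)$ satisfies: (1) $(m-H)^2\le H^2-K$ on $H^2\ge K\ge 0$; (2) $m$ is continuous on $H^2\ge K\ge0$ and analytic on $K>0$; (3) $m(tH,t^2K)=t\,m(H,K)$ for $t\ge 0$. On the surface $\mathcal M$ also denotes $m(\mathcal H,\mathcal K)$. It is *positive regular* if $\mathcal M_H+2\mathcal M\,\mathcal M_K>0$ (subscripts: partial derivatives of $m$). $\mathcal M$-mean curvature lines are the regular curves along which $k_n=\mathcal M$, i.e. solutions of $(g-\mathcal MG)dv^2+2(f-\mathcal MF)du\,dv+(e-\mathcal ME)du^2=0$, in the region $\mathcal K>0$ off the umbilic points. They form two transversal foliations, minimal (geodesic torsion $\tau_g=-\sqrt{(k_2-\mathcal M)(\mathcal M-k_1)}$) and maximal ($\tau_g=+\sqrt{(k_2-\mathcal M)(\mathcal M-k_1)}$). A cycle is a closed leaf; it is hyperbolic if the first derivative of its Poincaré return map at the fixed point is different from $1$. The chart $(s,v)$ near $c$ (with $T=c'$) is the one in which $\alpha(s,v)=c(s)+v(N\wedge T)(s)+\left[(2\mathcal H(s)-\mathcal M(s))\frac{v^2}2+\frac{A(s)}6v^3+v^3B(s,v)\right]N(s)$ with $B(s,0)=0$; $N(s)$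 is the normal of $\alpha$ along $c$. The deformation $\beta_\epsilon$ equals $\alpha$ outside this chart. *)

(* Defs.v *)
(* Library: MathComp and MathComp-Analysis, over an arbitrary R : realType. *)
From HB Require Import structures.
From mathcomp Require Import all_boot all_order all_algebra.
From mathcomp Require Import all_classical all_reals all_analysis.

Set Implicit Arguments.
Unset Strict Implicit.
Unset Printing Implicit Defensive.

Import Order.TTheory GRing.Theory Num.Theory.
Import numFieldNormedType.Exports.

Local Open Scope ring_scope.
Local Open Scope classical_set_scope.

Section Calculus.
Context {R : realType}.

Definition pd_u (W : normedModType R) (f : R * R -> W) : R * R -> W :=
  fun x => 'D_((1, 0) : R * R) f x.

Definition pd_v (W : normedModType R) (f : R * R -> W) : R * R -> W :=
  fun x => 'D_((0, 1) : R * R) f x.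

(* f is of class C^k on the open set U. *)
Fixpoint classC (W : normedModType R) (k : nat) (U : set (R * R))
    (f : R * R -> W) : Prop :=
  match k with
  | 0%N => forall x, U x -> {for x, continuous f}
  | k'.+1 => [/\ forall x, U x -> differentiable f x,
                 classC k' U (pd_u f) & classC k' U (pd_v f)]
  end.

Definition det2 (w z : R * R) : R := w.1 * z.2 - w.2 * z.1.

Definition dot (u v : 'rV[R]_3) : R := \sum_i u 0 i * v 0 i.

(* Indices are read modulo 3. *)
Definition cross (u v : 'rV[R]_3) : 'rV[R]_3 :=
  \row_(i < 3) (u 0 (i + 1) * v 0 (i + 2) - u 0 (i + 2) * v 0 (i + 1)).

(* delta is of class C^k, equal to 1 near 0, with compact support in
   ]- v0, v0[. *)
Definition cutoff (k : nat) (v0 : R) (delta : R -> R) : Prop :=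
  [/\ forall n v, (n < k)%N -> derivable (derive1n n delta) v 1,
      continuous (derive1n k delta),
      \forall v \near (0 : R), delta v = 1 &
      exists2 w, 0 < w < v0 & forall v, w <= `|v| -> delta v = 0].

End Calculus.

Section Patches.
Context {R : realType}.
Implicit Types (X : R * R -> 'rV[R]_3) (x w : R * R).

Definition unit_normal X x : 'rV[R]_3 :=
  let n := cross (pd_u X x) (pd_v X x) in (Num.sqrt (dot n n))^-1 *: n.

Definition form1 X x w : R :=
  dot (pd_u X x) (pd_u X x) * w.1 ^+ 2
  + 2 * dot (pd_u X x) (pd_v X x) * w.1 * w.2
  + dot (pd_v X x) (pd_v X x) * w.2 ^+ 2.

Definition form2 X x w : R :=
  dot (pd_u (pd_u X) x) (unit_normal X x) * w.1 ^+ 2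
  + 2 * dot (pd_v (pd_u X) x) (unit_normal X x) * w.1 * w.2
  + dot (pd_v (pd_v X) x) (unit_normal X x) * w.2 ^+ 2.

Definition normal_curv X x w : R := form2 X x w / form1 X x w.

Definition kappa1 X x : R :=
  inf [set normal_curv X x w | w in [set w | w != 0]].
Definition kappa2 X x : R :=
  sup [set normal_curv X x w | w in [set w | w != 0]].

Definition meanH X x : R := (kappa1 X x + kappa2 X x) / 2.
Definition gaussK X x : R := kappa1 X x * kappa2 X x.

Definition dvec X x w : 'rV[R]_3 := w.1 *: pd_u X x + w.2 *: pd_v X x.

(* Darboux frame convention: N' = - k_n T - tau_g (N /\ T), hence
   tau_g = - <N', N /\ T>; the quotient normalizes w to unit length. *)
Definition geod_torsion X x w : R :=
  - dot (dvec (unit_normal X) x w) (cross (unit_normal X x) (dvec X x w))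
    / form1 X x w.

Definition mean_of (m : R -> R -> R) X x : R := m (meanH X x) (gaussK X x).

End Patches.

Section MeanCurvatureFunctions.
Context {R : realType}.
Implicit Type m : R -> R -> R.

Definition mean_domain : set (R * R) :=
  [set z | 0 <= z.2 /\ z.2 <= z.1 ^+ 2].

(* Analyticity at (h0, k0), relative to mean_domain: m agrees there with the
   sum of a power series converging absolutely on a full square about
   (h0, k0). This also makes sense on the boundary curve H^2 = K. *)
Definition analytic_at m (h0 k0 : R) : Prop :=
  exists (a : nat -> nat -> R) (rho : R), 0 < rho /\
    forall x y : R, `|x| < rho -> `|y| < rho ->
      let term n i := a i (n - i)%N * x ^+ i * y ^+ (n - i) in
      cvgn (series (fun n => \sum_(i < n.+1) `|term n i|)) /\
      (mean_domain (h0 + x, k0 + y) ->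
       series (fun n => \sum_(i < n.+1) term n i) @ \oo
         --> m (h0 + x) (k0 + y)).

Record mean_curvature_function m : Prop := MeanCurvatureFunction {
  mcf_bound : forall h k, mean_domain (h, k) -> (m h k - h) ^+ 2 <= h ^+ 2 - k;
  mcf_cont : {within mean_domain, continuous (fun z : R * R => m z.1 z.2)};
  mcf_analytic : forall h k, mean_domain (h, k) -> 0 < k -> analytic_at m h k;
  mcf_homog : forall t h k, 0 <= t -> mean_domain (h, k) ->
    m (t * h) (t ^+ 2 * k) = t * m h k }.

(* On the boundary curve H^2 = K > 0 one has m(H, H^2) = H, so that there the
   quantity m_H + 2 m m_K is identically 1: only interior points matter. *)
Definition positive_regular m : Prop :=
  forall h k, 0 < k -> k < h ^+ 2 ->
    0 < derive1 (fun h' => m h' k) h + 2 * m h k * derive1 (fun k' => m h k') k.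

End MeanCurvatureFunctions.

(* Oriented surfaces of class C^r, given by an atlas whose changes of
   coordinates are of class C^r with positive Jacobian. *)
Record oriented_surface (R : realType) (r : nat) := OrientedSurface {
  surf :> topologicalType;
  idx : Type;
  dom : idx -> set surf;
  local_coord : idx -> surf -> R * R;
  local_param : idx -> R * R -> surf;
  surf_hausdorff : hausdorff_space surf;
  dom_cover : forall p, exists i, dom i p;
  dom_open : forall i, open (dom i);
  cod_open : forall i, open (local_coord i @` dom i);
  coordK : forall i p, dom i p -> local_param i (local_coord i p) = p;
  coord_cont : forall i p, dom i p -> {for p, continuous (local_coord i)};
  param_cont : forall i x, (local_coord i @` dom i) x ->
    {for x, continuous (local_param i)};
  change_class : forall i j,
    classC r (local_coord i @` (dom i `&` dom j))
      (local_coord j \o local_param i);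
  change_det : forall i j x, (local_coord i @` (dom i `&` dom j)) x ->
    0 < det2 (pd_u (local_coord j \o local_param i) x)
             (pd_v (local_coord j \o local_param i) x) }.

Section Surfaces.
Context {R : realType} {r : nat} {V : oriented_surface R r}.
Implicit Types (b : V -> 'rV[R]_3) (p : V) (g c : R -> V) (m : R -> R -> R).

Definition immersion (k : nat) b : Prop :=
  forall i, classC k (local_coord i @` dom i) (b \o local_param i) /\
    forall x, (local_coord i @` dom i) x ->
      cross (pd_u (b \o local_param i) x) (pd_v (b \o local_param i) x) != 0.

(* A chart of the atlas around p. The normal, the curvatures and the torsion
   below do not depend on this choice. *)
Definition chart_at p : idx V := projT1 (cid (dom_cover p)).

Definition at_point (T : Type) (Q : (R * R -> 'rV[R]_3) -> R * R -> T) b p :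
    T :=
  Q (b \o local_param (chart_at p)) (local_coord (chart_at p) p).

(* Components of the velocity of the curve g in the chart chart_at (g t). *)
Definition velocity g (t : R) : R * R :=
  derive1 (local_coord (chart_at (g t)) \o g) t.

Definition regular_curve g (J : set R) : Prop :=
  forall t, J t ->
    {for t, continuous g} /\
    forall i, dom i (g t) ->
      [/\ derivable (local_coord i \o g) t 1,
          {for t, continuous (derive1 (local_coord i \o g))} &
          derive1 (local_coord i \o g) t != 0].

Inductive mean_foliation := Minimal | Maximal.

Definition torsion_sign (F : mean_foliation) : R :=
  if F is Maximal then 1 else -1.

Definition curve_torsion b g (t : R) : R :=
  at_point (@geod_torsion R) b (g t) (velocity g t).

Definition mean_line (F : mean_foliation) m b g (J : set R) : Prop :=
  regular_curve g J /\
  forall t, J t ->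
    let K := at_point (@gaussK R) b (g t) in
    let M := at_point (mean_of m) b (g t) in
    let l1 := at_point (@kappa1 R) b (g t) in
    let l2 := at_point (@kappa2 R) b (g t) in
    [/\ 0 < K, l1 < l2,
        at_point (@normal_curv R) b (g t) (velocity g t) = M &
        curve_torsion b g t
          = torsion_sign F * Num.sqrt ((l2 - M) * (M - l1))].

(* c is a closed leaf of the foliation F of the immersion b, with (least)
   period L; class C^2 is what the second fundamental form requires. *)
Definition mean_cycle (F : mean_foliation) m b c (L : R) : Prop :=
  [/\ immersion 2 b, 0 < L, mean_line F m b c setT &
      forall s s', c s = c s' <-> exists n : int, s' = s + n%:~R * L].

Definition section_to c (sg : R -> V) (eta : R) : Prop :=
  [/\ 0 < eta,
      regular_curve sg [set x | `|x| < eta],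
      forall x y, `|x| < eta -> `|y| < eta -> sg x = sg y -> x = y,
      sg 0 = c 0 &
      forall i, dom i (c 0) ->
        det2 (derive1 (local_coord i \o sg) 0)
             (derive1 (local_coord i \o c) 0) != 0].

(* ret is, near its fixed point 0, the Poincare return map of the section sg:
   the leaf through sg x, followed in the direction of c, meets the section
   again for the first time at sg (ret x). *)
Definition return_map (F : mean_foliation) m b c (sg : R -> V) (eta : R)
    (ret : R -> R) : Prop :=
  ret 0 = 0 /\
  \forall x \near (0 : R), `|ret x| < eta /\
    exists (g : R -> V) (l d : R),
      [/\ 0 < l, 0 < d, mean_line F m b g [set t | - d < t < l + d],
          0 < dot (derive1 (b \o g) 0) (derive1 (b \o c) 0) &
          [/\ g 0 = sg x, g l = sg (ret x) &
              forall t y, 0 < t < l -> `|y| < eta -> g t <> sg y]].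

(* The derivative of the return map does not depend on the section. *)
Definition hyperbolic_mean_cycle (F : mean_foliation) m b c (L : R) : Prop :=
  mean_cycle F m b c L /\
  exists (sg : R -> V) (eta : R) (ret : R -> R),
    [/\ section_to c sg eta, return_map F m b c sg eta ret,
        derivable ret 0 1 & derive1 ret 0 != 1].

Definition strip (v0 : R) : set (R * R) := [set z | `|z.2| < v0].

Definition frame_T b c (s : R) : 'rV[R]_3 := derive1 (b \o c) s.
Definition frame_N b c (s : R) : 'rV[R]_3 := at_point (@unit_normal R) b (c s).

(* The chart (s, v) along c. It is a diffeomorphism, L-periodic in s, from the
   strip |v| < v0 modulo (s, v) ~ (s + L, v) onto an open subset of V; for an
   immersion of class C^r, it is of class C^(r-2), as T(s) is. *)
Record cycle_chart m b c (L v0 : R) (chi : R * R -> V) (A : R -> R)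
    (B : R * R -> R) : Prop := CycleChart {
  chart_width : 0 < v0;
  chart_core : forall s, chi (s, 0) = c s;
  chart_inj : forall z z', strip v0 z -> strip v0 z' ->
    (chi z = chi z' <->
     z'.2 = z.2 /\ exists n : int, z'.1 = z.1 + n%:~R * L);
  chart_cont : forall z, strip v0 z -> {for z, continuous chi};
  chart_class : forall i,
    classC (r - 2) (strip v0 `&` chi @^-1` dom i) (local_coord i \o chi);
  chart_inverse : forall i z, strip v0 z -> dom i (chi z) ->
    exists (W : set (R * R)) (h : R * R -> R * R),
      [/\ open W, W (local_coord i (chi z)) & W `<=` local_coord i @` dom i] /\
      [/\ classC (r - 2) W h, h (local_coord i (chi z)) = z &
          forall y, W y -> strip v0 (h y) /\ chi (h y) = local_param i y];
  chart_rem0 : forall s, B (s, 0) = 0;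
  chart_rem_cont : forall z, strip v0 z -> {for z, continuous B};
  chart_form : forall s v, `|v| < v0 ->
    b (chi (s, v)) =
      b (c s) + v *: cross (frame_N b c s) (frame_T b c s)
      + ((2 * at_point (@meanH R) b (c s) - at_point (mean_of m) b (c s))
           * (v ^+ 2 / 2)
         + A s / 6 * v ^+ 3 + v ^+ 3 * B (s, v)) *: frame_N b c s }.

Definition deformation b c (v0 : R) (chi : R * R -> V) (A1 delta : R -> R)
    (beta : R -> V -> 'rV[R]_3) : Prop :=
  forall eps,
    (forall s v, `|v| < v0 ->
       beta eps (chi (s, v)) = b (chi (s, v))
         + (eps * (A1 s / 6 * v ^+ 3) * delta v) *: frame_N b c s) /\
    (forall p, ~ (chi @` strip v0) p -> beta eps p = b p).

End Surfaces.

(* Main.v *)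
(* In the chart (s, v) along c the immersion is a patch X, and the deformation
   adds eps v^3 (A1 / 6) delta N to it. The 2-jet of X along v = 0 is unchanged,
   hence so are the normal, the curvatures and the torsion there, and c remains a
   cycle; beta_eps is an immersion for eps small by compactness. Near c the lines
   are graphs of solutions of dv/ds = p(s, v), where p(s, 0) = 0, so that the
   derivative of the return map is the exponential of the integral of p_v(s, 0)
   over [0, L]. Along c the deformation only changes, among the first derivatives
   of the coefficients of the fundamental forms, g_v, by eps A1, and A1 = f. This
   adds (eps / 4) (M_H + 2 M M_K) to p_v(s, 0); for a positive regular M the
   integral is therefore a nonconstant affine function of eps, which does not
   vanish for eps <> 0 small. *)
Require Import Defs.
From HB Require Import structures.
From mathcomp Require Import all_boot all_order all_algebra.
From mathcomp Require Import all_classical all_reals all_analysis.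
From mathcomp Require Import ring lra.

Set Implicit Arguments.
Unset Strict Implicit.
Unset Printing Implicit Defensive.

Import Order.TTheory GRing.Theory Num.Theory.
Import numFieldNormedType.Exports.

Local Open Scope ring_scope.
Local Open Scope classical_set_scope.

(** * Functions of class C^k on the plane *)

Section NearEq.
Context {R : realType} {V W : normedModType R}.
Implicit Types f g : V -> W.

(** Regularity is the first constraint. [chi] is of class C^(r-2), so the patch X is C^4. The slope
    p is C^1 once the deformed patch is C^3, so A1, a second order quantity, must be C^3; this holds
    because the unit normal of [alpha], taken in a chart of the atlas, is as smooth as [chi] allows.
    The principal curvatures come as an infimum and a supremum, and [m] as pointwise power series;
    both are replaced by expressions that are visibly C^1. The slope is an explicit root of the
    quadratic equation, rationalized so that it vanishes with e - M E: on c, its v-derivative sees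
    the derivative of that numerator and only the value 2 f of the denominator. The second
    constraint is that the statement speaks of charts of the atlas, while the computation uses one
    map [chi] on a strip. Every invariant is transported to it, on the open set where [chi]
    preserves the orientation; that set contains the axis v = 0. Since v = 0 solves the equation,
    the return map is differentiated at a known solution, by comparison with the linearized
    equation. *)

Lemma near_eq_differentiable f g x :
  (\near x, f x = g x) -> differentiable f x -> differentiable g x.
Proof.
move=> fg df.
have fgx : f x = g x by exact: nbhs_singleton fg.
have H : g \o shift x = cst (g x) + 'd f x +o_ 0 id.
  apply/eqaddoP => e e0.
  have /eqaddoP H0 := diff_locally df; move: (H0 _ e0) => {}H0.
  move: fg; rewrite (near_shift 0) /= subr0 => fg.
  apply: filterS2 fg H0 => y /= fgy; rewrite !fctE /= fgy fgx; exact.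
have dd : 'd g x = 'd f x :> (V -> W).
  by apply: diff_unique => //; exact: diff_continuous.
by apply/diff_locallyP; rewrite dd; split => //; exact: diff_continuous.
Qed.

End NearEq.

Section Plane.
Context {R : realType}.

(** The chain rule in coordinates, with an arbitrary source: V = R gives velocities of curves, V = R
    * R changes of chart. *)
Lemma derive_pair {V : normedModType R} {W : normedModType R} (f : R * R -> W)
    (phi : V -> R * R) (z w : V) :
  differentiable f (phi z) -> differentiable phi z ->
  'D_w (f \o phi) z =
    ('D_w phi z).1 *: pd_u f (phi z) + ('D_w phi z).2 *: pd_v f (phi z).
Proof.
move=> df dphi; rewrite deriveE; last exact: differentiable_comp.
rewrite diff_comp//= -deriveE// /pd_u /pd_v.
rewrite 3!(deriveE _ df) -!linearZ -linearD.
rewrite -(deriveE _ dphi); congr ('d f _ _); case: ('D_w phi z) => a b.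
by congr (_, _); rewrite /= /GRing.scale /= mulr0 ?addr0 ?add0r mulr1.
Qed.

Lemma derive_plane {W : normedModType R} (f : R * R -> W) (z w : R * R) :
  differentiable f z -> 'D_w f z = w.1 *: pd_u f z + w.2 *: pd_v f z.
Proof.
by move=> df; rewrite -[f]/(f \o id) derive_pair ?derive_id.
Qed.

Lemma derive_linear {U V' W' : normedModType R} (l : {linear V' -> W'})
    (phi : U -> V') z w : continuous l -> differentiable phi z ->
  'D_w (l \o phi) z = l ('D_w phi z).
Proof.
move=> cl dphi; have dl : differentiable l (phi z) by exact: linear_differentiable.
rewrite deriveE; last exact: differentiable_comp.
by rewrite diff_comp//= diff_lin// -deriveE.
Qed.

Lemma derive_fst {V : normedModType R} (phi : V -> R * R) z w :
  differentiable phi z -> 'D_w (fun x => (phi x).1) z = ('D_w phi z).1.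
Proof. by apply: (derive_linear (l := fst)) => x; exact: cvg_fst. Qed.

Lemma derive_snd {V : normedModType R} (phi : V -> R * R) z w :
  differentiable phi z -> 'D_w (fun x => (phi x).2) z = ('D_w phi z).2.
Proof. by apply: (derive_linear (l := snd)) => x; exact: cvg_snd. Qed.

Context {W : normedModType R}.
Implicit Types (f g : R * R -> W) (U : set (R * R)) (k : nat).

Lemma near_eq_pd_u f g z : (\near z, f z = g z) -> pd_u f z = pd_u g z.
Proof. exact: near_eq_derive. Qed.

Lemma near_eq_pd_v f g z : (\near z, f z = g z) -> pd_v f z = pd_v g z.
Proof. exact: near_eq_derive. Qed.

(** [classC] is a condition at each point, with derivatives taken in the plane, so restriction and
    union go through for sets that need not be open. *)
Lemma classC_sub k U U' f : U' `<=` U -> classC k U f -> classC k U' f.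
Proof.
move=> UU'; elim: k f => /= [|k IH] f; first by move=> h x /UU' /h.
by case=> a b c; split; [move=> x /UU' /a|exact: IH|exact: IH].
Qed.

Lemma classC_cup k U U' f : classC k U f -> classC k U' f -> classC k (U `|` U') f.
Proof.
elim: k f => /= [|k IH] f; first by move=> h h' x [/h|/h'].
case=> a b c [a' b' c']; split; [by move=> x [/a|/a']|exact: IH|exact: IH].
Qed.

Lemma classC_differentiable k U f z :
  classC k.+1 U f -> U z -> differentiable f z.
Proof. by case=> + _ _; exact. Qed.

Lemma classC_pd_u k U f : classC k.+1 U f -> classC k U (pd_u f).
Proof. by case. Qed.

Lemma classC_pd_v k U f : classC k.+1 U f -> classC k U (pd_v f).
Proof. by case. Qed.

Lemma classC_continuous k U f z : classC k U f -> U z -> {for z, continuous f}.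
Proof.
case: k => [|k]; first exact.
by case=> df _ _ Uz; apply: differentiable_continuous; exact: df.
Qed.

Lemma classCS k U f : classC k.+1 U f -> classC k U f.
Proof.
elim: k f => [|k IH] f h; first by move=> x; exact: classC_continuous h.
by case: h => a b c; split; [exact: a|exact: (IH _ b)|exact: (IH _ c)].
Qed.

Lemma classC_le k k' U f : (k <= k')%N -> classC k' U f -> classC k U f.
Proof.
move=> /subnK <-; elim: (k' - k)%N => // n IH; rewrite addSn => /classCS.
exact: IH.
Qed.

Lemma classC_congr k U f g : open U -> (forall z, U z -> f z = g z) ->
  classC k U f -> classC k U g.
Proof.
move=> oU; elim: k f g => [|k IH] f g fg.
  move=> h x Ux; have fgx := fg _ Ux.
  rewrite /prop_for /continuous_at -fgx; apply: cvg_trans (h _ Ux).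
  by apply: near_eq_cvg; apply: filterS (open_nbhs_nbhs (conj oU Ux)).
have nfg z : U z -> \near z, f z = g z.
  by move=> Uz; apply: filterS (open_nbhs_nbhs (conj oU Uz)) => y /fg.
case=> a b c; split.
- by move=> x Ux; apply: near_eq_differentiable (a _ Ux); exact: nfg.
- by apply: IH b => z Uz; apply: near_eq_pd_u; exact: nfg.
- by apply: IH c => z Uz; apply: near_eq_pd_v; exact: nfg.
Qed.

Lemma classC_cst k U (a : W) : classC k U (cst a).
Proof.
elim: k a => [|k IH] a; first by move=> x _; exact: cvg_cst.
have E w : (fun x => 'D_w (cst a : R * R -> W) x) = cst 0.
  by apply/funext => x; rewrite derive_cst.
by split; [move=> x _; exact: differentiable_cst|
  rewrite /pd_u E; exact: IH|rewrite /pd_v E; exact: IH].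
Qed.

Lemma classCD k U f g : open U -> classC k U f -> classC k U g ->
  classC k U (fun z => f z + g z).
Proof.
move=> oU; elim: k f g => [|k IH] f g.
  by move=> hf hg x Ux; apply: cvgD; [exact: hf|exact: hg].
case=> a b c [a' b' c']; split.
- by move=> x Ux; apply: differentiableD; [exact: a|exact: a'].
- apply: classC_congr (IH _ _ b b') => // z Uz; rewrite /pd_u deriveD//;
  by apply: diff_derivable; auto.
- apply: classC_congr (IH _ _ c c') => // z Uz; rewrite /pd_v deriveD//;
  by apply: diff_derivable; auto.
Qed.

End Plane.

Section ProductRule.
Context {R : realType} {V U V' W' : normedModType R}.
Implicit Types (f : V -> U) (g : V -> V').

(** Products, scalings, [dot] and [cross] are all continuous bilinear maps, so a single product rule
    serves for the four. *)
Lemma differentiable_bilinear (B : {bilinear U -> V' -> W'}) f g z :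
  continuous (fun p => B p.1 p.2) -> differentiable f z -> differentiable g z ->
  differentiable (fun x => B (f x) (g x)) z.
Proof.
move=> cB df dg.
apply: (@differentiable_comp _ _ _ _ (fun x => (f x, g x)) (fun p => B p.1 p.2)).
  exact: differentiable_pair.
exact: differentiable_bilin.
Qed.

Lemma derive_bilinear (B : {bilinear U -> V' -> W'}) f g z w :
  continuous (fun p => B p.1 p.2) -> differentiable f z -> differentiable g z ->
  'D_w (fun x => B (f x) (g x)) z = B (f z) ('D_w g z) + B ('D_w f z) (g z).
Proof.
move=> cB df dg; rewrite deriveE; last exact: differentiable_bilinear.
rewrite (@diff_comp _ _ _ _ (fun x => (f x, g x)) (fun p => B p.1 p.2)).
- by rewrite /= diff_bilin// diff_pair//= -!deriveE.
- exact: differentiable_pair.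
- exact: differentiable_bilin.
Qed.

End ProductRule.

Section ClassCBilinear.
Context {R : realType} {U V' W' : normedModType R}.
Implicit Types (f : R * R -> U) (g : R * R -> V') (A : set (R * R)) (k : nat).

Lemma classC_bilinear (B : {bilinear U -> V' -> W'}) k A f g :
  continuous (fun p => B p.1 p.2) -> open A -> classC k A f -> classC k A g ->
  classC k A (fun x => B (f x) (g x)).
Proof.
move=> cB oA; elim: k f g => [|k IH] f g.
  move=> hf hg x Ax.
  apply: (@continuous_comp _ _ _ (fun x => (f x, g x)) (fun p => B p.1 p.2)).
    by apply: cvg_pair; [exact: hf|exact: hg].
  exact: cB.
move=> hf hg; have := hf; have := hg; case=> a' b' c' [a b c].
have hf0 := classCS hf; have hg0 := classCS hg.
split.
- by move=> x Ax; apply: differentiable_bilinear => //; [exact: a|exact: a'].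
- apply: classC_congr (classCD oA (IH _ _ hf0 b') (IH _ _ b hg0)) => // z Az.
  by rewrite /pd_u derive_bilinear//; [exact: a|exact: a'].
- apply: classC_congr (classCD oA (IH _ _ hf0 c') (IH _ _ c hg0)) => // z Az.
  by rewrite /pd_v derive_bilinear//; [exact: a|exact: a'].
Qed.

Lemma classC_linear (l : {linear U -> W'}) k A f :
  continuous l -> open A -> classC k A f -> classC k A (l \o f).
Proof.
move=> cl oA; elim: k f => [|k IH] f.
  move=> hf x Ax; apply: continuous_comp; [exact: hf|exact: cl].
case=> a b c; split.
- move=> x Ax; apply: differentiable_comp; first exact: a.
  exact: linear_differentiable.
- apply: classC_congr (IH _ b) => // z Az.
  by rewrite /pd_u derive_linear//; exact: a.
- apply: classC_congr (IH _ c) => // z Az.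
  by rewrite /pd_v derive_linear//; exact: a.
Qed.

End ClassCBilinear.

Section Bilinear.
Context {R : realType}.

Lemma scale_is_bilinear (W : normedModType R) :
  bilinear_for
    (GRing.Scale.Law.clone _ _ *:%R _) (GRing.Scale.Law.clone _ _ *:%R _)
    (fun (a : R) (x : W) => a *: x).
Proof.
split=> [u'|u] a x y /=; first by rewrite scalerDl scalerA.
by rewrite scalerDr !scalerA mulrC.
Qed.

Definition scale_bilinear (W : normedModType R) : {bilinear R -> W -> W} :=
  HB.pack (fun (a : R) (x : W) => a *: x)
    (bilinear_isBilinear.Build R R W W _ _ _ (@scale_is_bilinear W)).

Lemma continuous_scale (W : normedModType R) :
  continuous (fun p : R * W => scale_bilinear W p.1 p.2).
Proof. move=> p; exact: scale_continuous. Qed.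

Lemma dotE (u v : 'rV[R]_3) :
  dot u v = u 0 0 * v 0 0 + u 0 1 * v 0 1 + u 0 (1 + 1) * v 0 (1 + 1).
Proof.
rewrite /dot !big_ord_recr big_ord0 /= add0r.
by congr (_ + _ + _); congr (u 0 _ * v 0 _); apply/val_inj.
Qed.

Lemma rV3P (u v : 'rV[R]_3) : u 0 0 = v 0 0 -> u 0 1 = v 0 1 ->
  u 0 (1 + 1) = v 0 (1 + 1) -> u = v.
Proof.
move=> h0 h1 h2; apply/rowP; case=> [[|[|[|//]]] i] /=.
- by rewrite (_ : Ordinal i = 0)//; apply/val_inj.
- by rewrite (_ : Ordinal i = 1)//; apply/val_inj.
- by rewrite (_ : Ordinal i = 1 + 1)//; apply/val_inj.
Qed.

Lemma crossE (u v : 'rV[R]_3) :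
  (cross u v 0 0 = u 0 1 * v 0 (1 + 1) - u 0 (1 + 1) * v 0 1) *
  (cross u v 0 1 = u 0 (1 + 1) * v 0 0 - u 0 0 * v 0 (1 + 1)) *
  (cross u v 0 (1 + 1) = u 0 0 * v 0 1 - u 0 1 * v 0 0).
Proof.
split; first split; rewrite mxE;
 by congr (u 0 _ * v 0 _ - u 0 _ * v 0 _); apply/val_inj.
Qed.

Lemma dot_is_bilinear :
  bilinear_for
    (GRing.Scale.Law.clone _ _ *:%R _) (GRing.Scale.Law.clone _ _ *:%R _)
    (@dot R).
Proof.
by split=> [u'|u] a x y /=; rewrite !dotE !mxE /GRing.scale /=; ring.
Qed.
HB.instance Definition _ :=
  bilinear_isBilinear.Build R _ _ _ _ _ (@dot R) dot_is_bilinear.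

Lemma cross_is_bilinear :
  bilinear_for
    (GRing.Scale.Law.clone _ _ *:%R _) (GRing.Scale.Law.clone _ _ *:%R _)
    (@cross R).
Proof.
by split=> [u'|u] a x y /=; apply: rV3P;
  rewrite !(crossE, mxE) /GRing.scale /=; ring.
Qed.
HB.instance Definition _ :=
  bilinear_isBilinear.Build R _ _ _ _ _ (@cross R) cross_is_bilinear.

Lemma continuous_coord2 (i j : 'I_3) :
  continuous (fun p : 'rV[R]_3 * 'rV[R]_3 => p.1 0 i * p.2 0 j).
Proof.
move=> p; apply: cvgM.
  by apply: (@continuous_comp _ _ _ fst (fun u : 'rV[R]_3 => u 0 i));
    [exact: cvg_fst|exact: coord_continuous].
by apply: (@continuous_comp _ _ _ snd (fun u : 'rV[R]_3 => u 0 j));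
    [exact: cvg_snd|exact: coord_continuous].
Qed.

Lemma continuous_dot : continuous (fun p => dot p.1 p.2 : R).
Proof.
move=> p; rewrite /continuous_at dotE.
rewrite (_ : (fun p => _) = (fun p : 'rV[R]_3 * 'rV[R]_3 => p.1 0 0 * p.2 0 0 + p.1 0 1 * p.2 0 1
   + p.1 0 (1+1) * p.2 0 (1+1))); last by apply/funext => q; rewrite dotE.
by apply: cvgD; first apply: cvgD; apply: continuous_coord2.
Qed.

Lemma continuous_cross : continuous (fun p => @cross R p.1 p.2).
Proof.
move=> p; rewrite /continuous_at.
have E (q : 'rV[R]_3 * 'rV[R]_3) : cross q.1 q.2 = (cross q.1 q.2 0 0) *: delta_mx 0 0
  + (cross q.1 q.2 0 1) *: delta_mx 0 1
  + (cross q.1 q.2 0 (1 + 1)) *: delta_mx 0 (1 + 1).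
  move: (cross q.1 q.2) => u; apply: rV3P; rewrite !mxE /=;
  by rewrite ?(mulr1, mulr0, addr0, add0r).
rewrite E (_ : (fun p => _) = (fun q : 'rV[R]_3 * 'rV[R]_3 =>
  (cross q.1 q.2 0 0) *: delta_mx 0 0
  + (cross q.1 q.2 0 1) *: delta_mx 0 1
  + (cross q.1 q.2 0 (1 + 1)) *: delta_mx 0 (1 + 1))); last first.
  by apply/funext => q; exact: E.
have C j : (cross q.1 q.2 0 j) @[q --> p] --> cross p.1 p.2 0 j.
  rewrite mxE (_ : (fun p => _) = (fun q : 'rV[R]_3 * 'rV[R]_3 =>
    q.1 0 (j + 1) * q.2 0 (j + 2) - q.1 0 (j + 2) * q.2 0 (j + 1))); last first.
    by apply/funext => q; rewrite mxE.
  by apply: cvgB; apply: continuous_coord2.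
by apply: cvgD; first apply: cvgD; apply: cvgZr_tmp; exact: C.
Qed.

End Bilinear.

Section ClassCAlgebra.
Context {R : realType}.
Implicit Types (f g : R * R -> R) (X Y : R * R -> 'rV[R]_3) (U : set (R * R)) (k : nat).

Lemma classCM k U f g : open U -> classC k U f -> classC k U g ->
  classC k U (fun z => f z * g z).
Proof.
by apply: (@classC_bilinear R _ _ _ (@GRing.mul R)) => p; exact: mul_continuous.
Qed.

Lemma classCZ {W : normedModType R} k U f (X : R * R -> W) : open U ->
  classC k U f -> classC k U X -> classC k U (fun z => f z *: X z).
Proof.
exact: (@classC_bilinear R _ _ _ (scale_bilinear _)) (@continuous_scale _ _).
Qed.

Lemma classC_dot k U X Y : open U -> classC k U X -> classC k U Y ->
  classC k U (fun z => dot (X z) (Y z)).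
Proof. exact: (@classC_bilinear R _ _ _ (@dot R)) (@continuous_dot _). Qed.

Lemma classC_cross k U X Y : open U -> classC k U X -> classC k U Y ->
  classC k U (fun z => cross (X z) (Y z)).
Proof. exact: (@classC_bilinear R _ _ _ (@cross R)) (@continuous_cross _). Qed.

Lemma classCN {W : normedModType R} k U (f : R * R -> W) : open U ->
  classC k U f -> classC k U (fun z => - f z).
Proof.
move=> oU hf; rewrite (_ : (fun z => _) = (fun z => (-1) *: f z)).
  exact: (classCZ (f := cst (-1)) oU (classC_cst k U (-1 : R)) hf).
by apply/funext => z; rewrite scaleN1r.
Qed.

Lemma classCB {W : normedModType R} k U (f g : R * R -> W) : open U ->
  classC k U f -> classC k U g -> classC k U (fun z => f z - g z).
Proof. by move=> oU hf hg; apply: classCD => //; exact: classCN. Qed.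

Lemma classCX k U f n : open U -> classC k U f -> classC k U (fun z => f z ^+ n).
Proof.
move=> oU hf; elim: n => [|n IH]; first exact: classC_cst.
by under eq_fun do rewrite exprS; exact: classCM.
Qed.

Lemma derive_inv f z w : differentiable f z -> f z != 0 ->
  'D_w (fun x => (f x)^-1) z = - (f z)^-1 ^+ 2 * 'D_w f z.
Proof.
by move=> df f0; rewrite deriveV//; [rewrite exprVn|exact: diff_derivable].
Qed.

Lemma classCV k U f : open U -> (forall z, U z -> f z != 0) ->
  classC k U f -> classC k U (fun z => (f z)^-1).
Proof.
move=> oU f0; elim: k => [|k IH] hf.
  by move=> x Ux; apply: cvgV; [exact: f0|exact: hf].
have hf0 := classCS hf; have [a b c] := hf.
have h2 : classC k U (fun z => - (f z)^-1 ^+ 2) by apply: classCN => //; apply: classCX => //; exact: IH.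
split.
- by move=> x Ux; apply: differentiableV; [exact: a|exact: f0].
- apply: classC_congr (classCM oU h2 b) => // z Uz.
  by rewrite /pd_u derive_inv//; [exact: a|exact: f0].
- apply: classC_congr (classCM oU h2 c) => // z Uz.
  by rewrite /pd_v derive_inv//; [exact: a|exact: f0].
Qed.

Lemma differentiable_sqrt {V : normedModType R} (f : V -> R) z : differentiable f z ->
  0 < f z -> differentiable (fun x => Num.sqrt (f x)) z.
Proof.
move=> df f0; apply: (@differentiable_comp _ _ _ _ f Num.sqrt) => //.
by apply/derivable1_diffP; have [] := is_derive1_sqrt f0.
Qed.

Lemma derive_comp1 {V : normedModType R} (h : R -> R) (f : V -> R) z w :
  derivable h (f z) 1 -> differentiable f z ->
  'D_w (fun x => h (f x)) z = 'D_1 h (f z) * 'D_w f z.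
Proof.
move=> /derivable1_diffP dh df; rewrite deriveE; last exact: differentiable_comp.
by rewrite diff_comp// diff1E//= -deriveE// derive1E mulrC.
Qed.

Lemma classC_sqrt k U f : open U -> (forall z, U z -> 0 < f z) ->
  classC k U f -> classC k U (fun z => Num.sqrt (f z)).
Proof.
move=> oU f0; elim: k => [|k IH] hf.
  move=> x Ux; apply: (@continuous_comp _ _ _ f Num.sqrt); first exact: hf.
  exact: sqrt_continuous.
have hf0 := classCS hf; have [a b c] := hf.
have h2 : classC k U (fun z => (2 * Num.sqrt (f z))^-1).
  apply: classCV => //.
    by move=> z Uz; rewrite mulf_neq0// gt_eqF// sqrtr_gt0; exact: f0.
  by apply: classCM => //; [exact: classC_cst|exact: IH].
have E w z : U z -> 'D_w (fun x => Num.sqrt (f x)) z = (2 * Num.sqrt (f z))^-1 * 'D_w f z.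
  move=> Uz; have := is_derive1_sqrt (f0 _ Uz) => -[dd ddE].
  by rewrite derive_comp1 ?ddE//; exact: a.
split.
- by move=> x Ux; apply: differentiable_sqrt; [exact: a|exact: f0].
- by apply: classC_congr (classCM oU h2 b) => // z Uz; rewrite /pd_u E.
- by apply: classC_congr (classCM oU h2 c) => // z Uz; rewrite /pd_v E.
Qed.

Lemma classC_fst k U (f : R * R -> R * R) : open U -> classC k U f -> classC k U (fun z => (f z).1).
Proof. by move=> oU; apply: (classC_linear (l := fst)) => // x; exact: cvg_fst. Qed.

Lemma classC_snd k U (f : R * R -> R * R) : open U -> classC k U f -> classC k U (fun z => (f z).2).
Proof. by move=> oU; apply: (classC_linear (l := snd)) => // x; exact: cvg_snd. Qed.

Lemma classC_comp {W : normedModType R} k U U' (f : R * R -> W) (phi : R * R -> R * R) :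
  open U' -> (forall z, U' z -> U (phi z)) -> classC k U f -> classC k U' phi ->
  classC k U' (f \o phi).
Proof.
move=> oU' UU; elim: k f => [|k IH] f.
  move=> hf hphi x Ux; apply: continuous_comp; first exact: hphi.
  by apply: hf; exact: UU.
move=> hf hphi; have h0 := classCS hphi; have [a b c] := hf; have [a' b' c'] := hphi.
split.
- by move=> x Ux; apply: differentiable_comp; [exact: a'|apply: a; exact: UU].
- apply: classC_congr (classCD oU' (classCZ oU' (classC_fst oU' b') (IH _ b h0))
    (classCZ oU' (classC_snd oU' b') (IH _ c h0))) => // z Uz.
  by rewrite [RHS]derive_pair//; [apply: a; exact: UU|exact: a'].
- apply: classC_congr (classCD oU' (classCZ oU' (classC_fst oU' c') (IH _ b h0))
    (classCZ oU' (classC_snd oU' c') (IH _ c h0))) => // z Uz.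
  by rewrite [RHS]derive_pair//; [apply: a; exact: UU|exact: a'].
Qed.

Lemma classC_id k U : classC k U (id : R * R -> R * R).
Proof.
case: k => [|k]; first by move=> x _; exact: cvg_id.
have E w : (fun z : R * R => 'D_w id z) = cst w by apply/funext => z; rewrite derive_id.
by split; rewrite /pd_u /pd_v ?E; [|exact: classC_cst|exact: classC_cst].
Qed.

Lemma classC_proj1 k U : open U -> classC k U (fst : R * R -> R).
Proof. by move=> oU; apply: (classC_fst oU (classC_id k U)). Qed.

Lemma classC_proj2 k U : open U -> classC k U (snd : R * R -> R).
Proof. by move=> oU; apply: (classC_snd oU (classC_id k U)). Qed.

Lemma classC_pair k U f g : open U -> classC k U f -> classC k U g ->
  classC k U (fun z => (f z, g z)).
Proof.
move=> oU; elim: k f g => [|k IH] f g.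
  by move=> hf hg x Ux; exact: (cvg_pair (hf _ Ux) (hg _ Ux)).
have E w z : differentiable f z -> differentiable g z ->
    'D_w (fun z => (f z, g z)) z = ('D_w f z, 'D_w g z).
  move=> df dg; rewrite deriveE; last exact: differentiable_pair.
  by rewrite diff_pair// -!deriveE.
case=> a b c [a' b' c']; split.
- by move=> x Ux; apply: differentiable_pair; [exact: a|exact: a'].
- by apply: classC_congr (IH _ _ b b') => // z Uz; rewrite /pd_u E//; [exact: a|exact: a'].
- by apply: classC_congr (IH _ _ c c') => // z Uz; rewrite /pd_v E//; [exact: a|exact: a'].
Qed.

(** The smoothness of [h] is expressed through [derive1n], as in [cutoff], and only on [I], because
    the slices of [m] are smooth on an interval only. *)
Lemma classC_comp1 k U (I : set R) (h : R -> R) f : open U ->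
  (forall z, U z -> I (f z)) ->
  (forall n v, (n < k)%N -> I v -> derivable (derive1n n h) v 1) ->
  (forall v, I v -> {for v, continuous (derive1n k h)}) ->
  classC k U f -> classC k U (fun z => h (f z)).
Proof.
move=> oU UI; elim: k h => [|k IH] h.
  move=> _ ch hf x Ux; apply: continuous_comp; first exact: hf.
  by apply: ch; exact: UI.
move=> dh ch hf; have h0 := classCS hf; have [a b c] := hf.
have D z : U z -> derivable h (f z) 1 by move=> /UI; exact: (dh 0%N).
have hh : classC k U (fun z => derive1 h (f z)).
  apply: IH => //; last by move=> v Iv; rewrite -derive1Sn; exact: ch.
  by move=> n v nk Iv; rewrite -derive1Sn; exact: dh.
split.
- move=> x Ux; apply: differentiable_comp; first exact: a.
  by apply/derivable1_diffP; exact: D.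
- apply: (classC_congr oU _ (classCM oU hh b)) => z Uz.
  by rewrite /pd_u (derive_comp1 _ (D _ Uz) (a _ Uz)) derive1E.
- apply: (classC_congr oU _ (classCM oU hh c)) => z Uz.
  by rewrite /pd_v (derive_comp1 _ (D _ Uz) (a _ Uz)) derive1E.
Qed.

Lemma open_gt0 U g : open U -> (forall z, U z -> {for z, continuous g}) ->
  open (U `&` [set z | 0 < g z]).
Proof.
move=> oU cg; rewrite openE => z [Uz /= gz].
apply: filterI; first exact: open_nbhs_nbhs.
exact: (cvgr_gt (g z) (cg _ Uz) 0 gz).
Qed.

End ClassCAlgebra.

(** * Fundamental forms of a patch *)

Section Slices.
Context {R : realType} {W : normedModType R}.
Implicit Types f : R * R -> W.

(** The two difference quotients are the same function, so the equality holds even where the limit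
    fails to exist. *)
Lemma derive_slice_u f x y : 'D_1 (fun t => f (t, y)) x = pd_u f (x, y).
Proof.
rewrite /pd_u /derive; set p := (fun h => _); set q := (fun h => _ : W).
suff -> : p = q by [].
apply/funext => h; rewrite /p /q /=.
by congr (h^-1 *: (f _ - _)); congr (_, _); rewrite /= ?scaler0 ?add0r.
Qed.

Lemma derive_slice_v f x y : 'D_1 (fun t => f (x, t)) y = pd_v f (x, y).
Proof.
rewrite /pd_v /derive; set p := (fun h => _); set q := (fun h => _ : W).
suff -> : p = q by [].
apply/funext => h; rewrite /p /q /=.
by congr (h^-1 *: (f _ - _)); congr (_, _); rewrite /= ?scaler0 ?add0r.
Qed.

Lemma is_derive_slice_u f x y : differentiable f (x, y) ->
  is_derive x 1 (fun t => f (t, y)) (pd_u f (x, y)).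
Proof.
move=> df; rewrite -derive_slice_u; apply/derivableP/derivable1_diffP.
apply: (@differentiable_comp _ _ _ _ (fun t => (t, y)) f) => //.
Qed.

Lemma is_derive_slice_v f x y : differentiable f (x, y) ->
  is_derive y 1 (fun t => f (x, t)) (pd_v f (x, y)).
Proof.
move=> df; rewrite -derive_slice_v; apply/derivableP/derivable1_diffP.
apply: (@differentiable_comp _ _ _ _ (fun t => (x, t)) f) => //.
Qed.

End Slices.

(** * Symmetry of the second derivatives *)

Section Schwarz.
Context {R : realType}.
Implicit Types (f : R * R -> R) (U : set (R * R)).

Lemma is_derive_continuous (f : R -> R) (x d : R) : is_derive x 1 f d -> {for x, continuous f}.
Proof. by case=> /derivable1_diffP df _; exact: differentiable_continuous. Qed.

Lemma mean_value (f df : R -> R) (a b : R) : a <= b ->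
  (forall x, a <= x <= b -> is_derive x 1 f (df x)) ->
  exists2 c, a <= c <= b & f b - f a = df c * (b - a).
Proof.
move=> ab H.
have [||c cab E] := @MVT_segment R f df a b ab.
- by move=> x; rewrite in_itv /= => /andP[ax xb]; apply: H; rewrite !ltW.
- apply: continuous_in_subspaceT => x; rewrite inE /= in_itv /= => xab.
  exact: is_derive_continuous (H _ xab).
- by exists c => //; move: cab; rewrite in_itv.
Qed.

(** The mean value theorem is applied in x to f(., b + h) - f(., b), then in y to the derivative so
    obtained. *)
Lemma second_difference f (a b h : R) : 0 <= h ->
  (forall x y, a <= x <= a + h -> b <= y <= b + h ->
    differentiable f (x, y) /\ differentiable (pd_u f) (x, y)) ->
  exists x y, [/\ a <= x <= a + h, b <= y <= b + h &
    f (a + h, b + h) - f (a + h, b) - (f (a, b + h) - f (a, b))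
      = pd_v (pd_u f) (x, y) * h * h].
Proof.
move=> h0 H.
have bb : b <= b <= b + h by rewrite lexx lerDl.
have bh : b <= b + h <= b + h by rewrite lexx lerDl h0.
have ah : a <= a + h by rewrite lerDl.
have [|x xa E] := @mean_value (fun x => f (x, b + h) - f (x, b))
  (fun x => pd_u f (x, b + h) - pd_u f (x, b)) a (a + h) ah.
  move=> x xa; apply: is_deriveB; apply: is_derive_slice_u;
  by [have [] := H _ _ xa bh|have [] := H _ _ xa bb].
have [||y yb E'] := @mean_value (fun y => pd_u f (x, y))
  (fun y => pd_v (pd_u f) (x, y)) b (b + h).
- by rewrite lerDl.
- by move=> y yb; apply: is_derive_slice_v; have [] := H _ _ xa yb.
exists x, y; split => //; rewrite E E'.
by congr (_ * _ * _); ring.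
Qed.

Lemma schwarz U f z : open U -> classC 2 U f -> U z ->
  pd_v (pd_u f) z = pd_u (pd_v f) z.
Proof.
move=> oU [d0 [d1 _ c1] [d2 c2 _]] Uz; apply/eqP.
rewrite -subr_eq0 -normr_le0.
apply/ler_addgt0Pl => e e0; rewrite addr0.
have e2 : 0 < e / 2 by rewrite divr_gt0.
have /nbhs_ballP[r /= r0 B] : nbhs z [set x | [/\ U x,
    `|pd_v (pd_u f) z - pd_v (pd_u f) x| < e / 2 &
    `|pd_u (pd_v f) z - pd_u (pd_v f) x| < e / 2]].
  have N0 := open_nbhs_nbhs (conj oU Uz).
  have N1 := (cvgrPdist_lt _ _).1 (c1 _ Uz) _ e2.
  have N2 := (cvgrPdist_lt _ _).1 (c2 _ Uz) _ e2.
  exact: filterS3 (fun x a b c => And3 a b c) N0 (N1 _) (N2 _).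
case: z Uz B => a b Uz B; pose h := r / 2.
have h0 : 0 < h by rewrite divr_gt0.
have {}B x y : a <= x <= a + h -> b <= y <= b + h -> [/\ U (x, y),
    `|pd_v (pd_u f) (a, b) - pd_v (pd_u f) (x, y)| < e / 2 &
    `|pd_u (pd_v f) (a, b) - pd_u (pd_v f) (x, y)| < e / 2].
  move=> /andP[ax xa] /andP[bx xb]; apply: B; rewrite /h in xa xb.
  by split; rewrite /ball /= ler0_norm; lra.
have [||x [y [xa yb E]]] := @second_difference f a b h; first exact: ltW.
  by move=> x y xa yb; have [/[dup] /d0 ? /d1] := B _ _ xa yb.
(* The second difference is symmetric in the two variables; read with them exchanged, it is a value
   of the other mixed derivative. *)
have [||y' [x' [yb' xa' E']]] :=
    @second_difference (fun x => f (x.2, x.1)) b a h; first exact: ltW.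
  move=> y' x' yb' xa'; have [Up _ _] := B _ _ xa' yb'.
  have S : differentiable (fun x : R * R => (x.2, x.1)) (y', x').
    by apply: differentiable_pair; apply: linear_differentiable => ?;
      [exact: cvg_snd|exact: cvg_fst].
  split.
    apply: (@differentiable_comp _ _ _ _ (fun x => (x.2, x.1)) f) => //.
    exact: d0.
  apply: (@differentiable_comp _ _ _ _ (fun x => (x.2, x.1)) (pd_v f)) => //.
  exact: d2.
have {}E' : f (a + h, b + h) - f (a + h, b) - (f (a, b + h) - f (a, b))
    = pd_u (pd_v f) (x', y') * h * h by rewrite -E' /=; ring.
have cancel (p q t : R) : t = p * h * h -> t = q * h * h -> p = q.
  have hN : h * h != 0 by rewrite mulf_neq0// gt_eqF.
  by move=> tp tq; apply: (mulIf hN); rewrite !(mulrA _ h h) -tp.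
have hh := cancel _ _ _ E E'.
have [_ A1 _] := B _ _ xa yb; have [_ _ A2] := B _ _ xa' yb'.
move: A1 A2; rewrite hh => A1 A2.
have triangle (p q t : R) : `|p - t| < e / 2 -> `|q - t| < e / 2 -> `|p - q| <= e.
  move=> pt qt; have -> : p - q = (p - t) - (q - t) by ring.
  apply: le_trans (ler_normB _ _) _; rewrite [leRHS]splitr.
  exact: lerD (ltW pt) (ltW qt).
exact: triangle A1 A2.
Qed.

End Schwarz.

Section SpaceAlgebra.
Context {R : realType}.
Implicit Types u v w : 'rV[R]_3.

Lemma dotC u v : dot u v = dot v u.
Proof. by rewrite !dotE; ring. Qed.

Lemma dotDl u v w : dot (u + v) w = dot u w + dot v w.
Proof. exact: linearDl. Qed.

Lemma dotDr u v w : dot w (u + v) = dot w u + dot w v.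
Proof. exact: linearDr. Qed.

Lemma dotZl (a : R) u w : dot (a *: u) w = a * dot u w.
Proof. exact: linearZl_LR. Qed.

Lemma dotZr (a : R) u w : dot w (a *: u) = a * dot w u.
Proof. exact: linearZr_LR. Qed.

Lemma dot_ge0 u : 0 <= dot u u.
Proof. by rewrite dotE -!expr2 !addr_ge0// sqr_ge0. Qed.

Lemma dot_eq0 u : (dot u u == 0) = (u == 0).
Proof.
apply/idP/eqP => [|->]; last by rewrite dotE !mxE !mulr0 !addr0.
rewrite dotE -!expr2 !paddr_eq0 ?addr_ge0 ?sqr_ge0// !sqrf_eq0.
by move=> /andP[/andP[/eqP a /eqP b] /eqP c]; apply: rV3P; rewrite !mxE.
Qed.

Lemma dot_gt0 u : u != 0 -> 0 < dot u u.
Proof. by move=> u0; rewrite lt_neqAle dot_ge0 eq_sym dot_eq0 u0. Qed.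

Lemma crossZl (a : R) u w : cross (a *: u) w = a *: cross u w.
Proof. exact: linearZl_LR. Qed.

Lemma cross_comb (a b c d : R) u v :
  cross (a *: u + b *: v) (c *: u + d *: v) = (a * d - b * c) *: cross u v.
Proof. by apply: rV3P; rewrite !(crossE, mxE); ring. Qed.

Lemma cross0l u : cross 0 u = 0.
Proof. exact: linear0l. Qed.

Lemma cross0r u : cross u 0 = 0.
Proof. exact: linear0r. Qed.

Lemma dot_comb (a b c d : R) u v u' v' :
  dot (a *: u + b *: v) (c *: u' + d *: v') =
    a * c * dot u u' + a * d * dot u v' + b * c * dot v u' + b * d * dot v v'.
Proof. rewrite !(dotDl, dotDr, dotZl, dotZr); ring. Qed.

Lemma dot_crossl u v : dot (cross u v) u = 0.
Proof. by rewrite dotE !crossE; ring. Qed.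

Lemma dot_crossr u v : dot (cross u v) v = 0.
Proof. by rewrite dotE !crossE; ring. Qed.

Lemma dot_cross_cross u v :
  dot (cross u v) (cross u v) = dot u u * dot v v - dot u v ^+ 2.
Proof. by rewrite !dotE !crossE; ring. Qed.

Lemma cross_cross_comb (a b : R) u v :
  cross (cross u v) (a *: u + b *: v) =
    (a * dot u u + b * dot u v) *: v - (a * dot u v + b * dot v v) *: u.
Proof. by apply: rV3P; rewrite !dotE !(crossE, mxE); ring. Qed.

Lemma dot_comb_form2 (e f g a b : R) nu nv u v : dot nu u = - e ->
  dot nu v = - f -> dot nv u = - f -> dot nv v = - g ->
  e * a ^+ 2 + 2 * f * a * b + g * b ^+ 2 =
  - dot (a *: nu + b *: nv) (a *: u + b *: v).
Proof. by move=> h1 h2 h3 h4; rewrite dot_comb h1 h2 h3 h4; ring. Qed.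

(** By (u /\ v) /\ w = <u, w> v - <v, w> u, the torsion becomes a quadratic form in (a, b) whose
    coefficients are the minors of the two fundamental forms. *)
Lemma dot_comb_torsion (e f g a b r : R) nu nv u v : dot nu u = - e ->
  dot nu v = - f -> dot nv u = - f -> dot nv v = - g ->
  - dot (a *: nu + b *: nv) (cross (r *: cross u v) (a *: u + b *: v)) =
  ((dot u u * f - dot u v * e) * a ^+ 2
   + (dot u u * g - dot v v * e) * a * b
   + (dot u v * g - dot v v * f) * b ^+ 2) * r.
Proof.
move=> h1 h2 h3 h4; rewrite crossZl cross_cross_comb dotZr.
rewrite [X in dot _ X]addrC -[X in dot _ (X + _)]scaleNr.
by rewrite dot_comb h1 h2 h3 h4; ring.
Qed.

Lemma cross_cross_same u v : cross v (cross u v) = dot v v *: u - dot u v *: v.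
Proof. by apply: rV3P; rewrite !dotE !(crossE, mxE); ring. Qed.

End SpaceAlgebra.

Section FundamentalForms.
Context {R : realType}.
Implicit Types (X : R * R -> 'rV[R]_3) (z w : R * R) (U : set (R * R)) (k : nat).

Definition coef_E X z := dot (pd_u X z) (pd_u X z).
Definition coef_F X z := dot (pd_u X z) (pd_v X z).
Definition coef_G X z := dot (pd_v X z) (pd_v X z).
Definition coef_e X z := dot (pd_u (pd_u X) z) (unit_normal X z).
Definition coef_f X z := dot (pd_v (pd_u X) z) (unit_normal X z).
Definition coef_g X z := dot (pd_v (pd_v X) z) (unit_normal X z).
Definition area2 X z := coef_E X z * coef_G X z - coef_F X z ^+ 2.

Definition regular_at X z := cross (pd_u X z) (pd_v X z) != 0.

Lemma area2E X z :
  area2 X z = dot (cross (pd_u X z) (pd_v X z)) (cross (pd_u X z) (pd_v X z)).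
Proof. by rewrite dot_cross_cross. Qed.

Lemma area2_gt0 X z : regular_at X z -> 0 < area2 X z.
Proof. by rewrite area2E; exact: dot_gt0. Qed.

Lemma coef_E_gt0 X z : regular_at X z -> 0 < coef_E X z.
Proof.
move=> rX; rewrite /coef_E; apply: dot_gt0; apply: contra_neq rX => ->.
by rewrite cross0l.
Qed.

Lemma unit_normalE X z : unit_normal X z =
  (Num.sqrt (area2 X z))^-1 *: cross (pd_u X z) (pd_v X z).
Proof. by rewrite area2E. Qed.

Lemma unit_normal_u X z : dot (unit_normal X z) (pd_u X z) = 0.
Proof. by rewrite unit_normalE dotZl dot_crossl mulr0. Qed.

Lemma unit_normal_v X z : dot (unit_normal X z) (pd_v X z) = 0.
Proof. by rewrite unit_normalE dotZl dot_crossr mulr0. Qed.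

Lemma unit_normal_unit X z : regular_at X z ->
  dot (unit_normal X z) (unit_normal X z) = 1.
Proof.
move=> /area2_gt0 a0; rewrite unit_normalE dotZl dotZr -area2E mulrA.
rewrite -expr2 exprVn sqr_sqrtr ?ltW// mulVf// gt_eqF//.
Qed.

Lemma classC_normal k U X : open U -> classC k.+1 U X ->
  (forall z, U z -> regular_at X z) -> classC k U (unit_normal X).
Proof.
move=> oU [_ a b] rX.
have cn : classC k U (fun z => cross (pd_u X z) (pd_v X z)).
  exact: (classC_cross oU a b).
have n0 z : U z -> 0 < dot (cross (pd_u X z) (pd_v X z)) (cross (pd_u X z) (pd_v X z)).
  by move=> Uz; apply: dot_gt0; exact: rX.
apply: (classCZ oU _ cn); apply: classCV => //.
  by move=> z Uz; rewrite gt_eqF// sqrtr_gt0 n0.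
by apply: classC_sqrt => //; exact: classC_dot.
Qed.

Lemma form1E X z w : form1 X z w = dot (dvec X z w) (dvec X z w).
Proof.
rewrite /form1 /dvec; move: (pd_u X z) (pd_v X z) => u v.
by rewrite !dotE !mxE; ring.
Qed.

Lemma form1_gt0 X z w : regular_at X z -> w != 0 -> 0 < form1 X z w.
Proof.
move=> rX w0; rewrite form1E; apply: dot_gt0.
apply: contra_neq w0 => d0; have rX' := rX.
have : cross (dvec X z w) (pd_v X z) = w.1 *: cross (pd_u X z) (pd_v X z).
  rewrite -[X in cross _ X]scale1r -[X in cross _ X]add0r -(scale0r (pd_u X z)).
  by rewrite cross_comb mulr1 mulr0 subr0.
have : cross (pd_u X z) (dvec X z w) = w.2 *: cross (pd_u X z) (pd_v X z).
  rewrite -[X in cross X _]scale1r -[X in cross X _]addr0 -(scale0r (pd_v X z)).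
  by rewrite cross_comb mul1r mul0r subr0.
rewrite d0 cross0l cross0r.
move=> /esym/eqP; rewrite scaler_eq0 (negPf rX') orbF => /eqP w2.
move=> /esym/eqP; rewrite scaler_eq0 (negPf rX') orbF => /eqP w1.
by rewrite [w]surjective_pairing w1 w2.
Qed.

Lemma form_coefE X z w : form1 X z w =
  coef_E X z * w.1 ^+ 2 + 2 * coef_F X z * w.1 * w.2 + coef_G X z * w.2 ^+ 2.
Proof. by []. Qed.

Lemma form2_coefE X z w : form2 X z w =
  coef_e X z * w.1 ^+ 2 + 2 * coef_f X z * w.1 * w.2 + coef_g X z * w.2 ^+ 2.
Proof. by []. Qed.

Section Weingarten.
Variables (U : set (R * R)) (X : R * R -> 'rV[R]_3).
Hypotheses (oU : open U) (cX : classC 2 U X).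
Hypothesis rX : forall z, U z -> regular_at X z.

Let cN : classC 1 U (unit_normal X). Proof. exact: classC_normal. Qed.

Let dN z : U z -> differentiable (unit_normal X) z.
Proof. by move=> Uz; exact: classC_differentiable cN Uz. Qed.

Let dXu z : U z -> differentiable (pd_u X) z.
Proof. exact: classC_differentiable (classC_pd_u cX). Qed.

Let dXv z : U z -> differentiable (pd_v X) z.
Proof. exact: classC_differentiable (classC_pd_v cX). Qed.

Let normal_derive (Y : R * R -> 'rV[R]_3) z w : U z -> differentiable Y z ->
  (forall z, dot (unit_normal X z) (Y z) = 0) ->
  dot ('D_w (unit_normal X) z) (Y z) = - dot ('D_w Y z) (unit_normal X z).
Proof.
move=> Uz dY NY; apply/eqP; rewrite -addr_eq0; apply/eqP.
rewrite addrC [X in X + _]dotC.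
rewrite -(derive_bilinear (B := @dot R) w (@continuous_dot R) (dN Uz) dY).
by rewrite (_ : (fun z => _) = cst 0) ?derive_cst//; apply/funext => x; exact: NY.
Qed.

(** [schwarz] concerns scalar functions; pairing with a constant vector reduces to it, and the
    second derivatives of a patch occur in such pairings with the normal. *)
Lemma schwarz_space z v : U z ->
  dot v (pd_v (pd_u X) z) = dot v (pd_u (pd_v X) z).
Proof.
move=> Uz; have c2 := classC_dot oU (classC_cst 2 U v) cX.
have [d0 _ _] := cX.
have D (Y : R * R -> 'rV[R]_3) w y : differentiable Y y ->
    'D_w (fun z => dot (cst v z) (Y z)) y = dot v ('D_w Y y).
  move=> dY.
  rewrite (derive_bilinear (B := @dot R) w (@continuous_dot R) (differentiable_cst _ _) dY).
  by rewrite derive_cst [X in _ + X]linear0l addr0.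
have S2 := schwarz oU c2 Uz.
have E1 : \near z, pd_u (fun z => dot (cst v z) (X z)) z = dot v (pd_u X z).
  apply: filterS (open_nbhs_nbhs (conj oU Uz)) => y Uy; exact: (D X (1, 0) y (d0 y Uy)).
have E2 : \near z, pd_v (fun z => dot (cst v z) (X z)) z = dot v (pd_v X z).
  apply: filterS (open_nbhs_nbhs (conj oU Uz)) => y Uy; exact: (D X (0, 1) y (d0 y Uy)).
exact: etrans (esym (etrans (near_eq_pd_v E1) (D _ _ _ (dXu Uz)))) (etrans S2
  (etrans (near_eq_pd_u E2) (D _ _ _ (dXv Uz)))).
Qed.

(** Derivatives of <N, X_u> = 0 and <N, X_v> = 0. Since [coef_f] is built on [pd_v (pd_u X)], the
    entry <N_u, X_v> is the one that calls for the symmetry of second derivatives. *)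
Lemma weingarten z : U z ->
  [/\ dot (pd_u (unit_normal X) z) (pd_u X z) = - coef_e X z,
      dot (pd_u (unit_normal X) z) (pd_v X z) = - coef_f X z,
      dot (pd_v (unit_normal X) z) (pd_u X z) = - coef_f X z &
      dot (pd_v (unit_normal X) z) (pd_v X z) = - coef_g X z].
Proof.
move=> Uz.
have hu w := normal_derive w Uz (dXu Uz) (unit_normal_u X).
have hv w := normal_derive w Uz (dXv Uz) (unit_normal_v X).
have S := schwarz_space (unit_normal X z) Uz.
have fE : coef_f X z = dot ('D_(1, 0) (pd_v X) z) (unit_normal X z).
  exact: etrans (dotC (pd_v (pd_u X) z) (unit_normal X z))
    (etrans S (dotC (unit_normal X z) (pd_u (pd_v X) z))).
split; [exact: hu|exact: etrans (hv _) (esym (congr1 -%R fE))|exact: hu|exact: hv].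
Qed.

Lemma form2E z w : U z ->
  form2 X z w = - dot (dvec (unit_normal X) z w) (dvec X z w).
Proof.
move=> /weingarten[h1 h2 h3 h4]; rewrite form2_coefE.
exact: (@dot_comb_form2 R _ _ _ w.1 w.2 _ _ _ _ h1 h2 h3 h4).
Qed.

Lemma geod_torsionE z w : U z ->
  geod_torsion X z w =
    ((coef_E X z * coef_f X z - coef_F X z * coef_e X z) * w.1 ^+ 2
     + (coef_E X z * coef_g X z - coef_G X z * coef_e X z) * w.1 * w.2
     + (coef_F X z * coef_g X z - coef_G X z * coef_f X z) * w.2 ^+ 2)
    / (Num.sqrt (area2 X z) * form1 X z w).
Proof.
move=> /weingarten[h1 h2 h3 h4].
rewrite /geod_torsion invfM mulrA unit_normalE; congr (_ * _).
exact: (@dot_comb_torsion R _ _ _ w.1 w.2 _ _ _ _ _ h1 h2 h3 h4).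
Qed.

End Weingarten.

End FundamentalForms.

(** * Principal curvatures as extrema of a quotient of quadratic forms *)

Section RayleighQuotient.
Context {R : realType}.
Variables E F G e f g : R.
Hypotheses (E0 : 0 < E) (D0 : 0 < E * G - F ^+ 2).

Let D := E * G - F ^+ 2.
Let H := (e * G - 2 * f * F + g * E) / (2 * D).
Let K := (e * g - f ^+ 2) / D.

(** An explicit sum of squares; it makes the square root in the formulas for the principal
    curvatures a genuine one. *)
Lemma mean_gauss_ge0 : 0 <= H ^+ 2 - K.
Proof.
have -> : H ^+ 2 - K = ((E * (e * G - g * E) - 2 * F * (e * F - f * E)) ^+ 2 / 4
   + D * (e * F - f * E) ^+ 2) / (E * D) ^+ 2.
  by rewrite /H /K /D; field; rewrite !gt_eqF.
apply: divr_ge0; last exact: sqr_ge0.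
by rewrite addr_ge0// ?divr_ge0 ?sqr_ge0// mulr_ge0 ?sqr_ge0 ?ltW.
Qed.

Let I w1 w2 := E * w1 ^+ 2 + 2 * F * w1 * w2 + G * w2 ^+ 2.
Let J w1 w2 := e * w1 ^+ 2 + 2 * f * w1 * w2 + g * w2 ^+ 2.

(** For a root k of the characteristic equation, II - k I has determinant zero, and k <= H makes its
    trace relative to I nonnegative. Such a form is semidefinite with a null vector, so k is the
    minimum of II / I, and it is attained. *)
Lemma quadratic_semidefinite (k a b c : R) :
  a = e - k * E -> b = f - k * F -> c = g - k * G ->
  k ^+ 2 - 2 * H * k + K = 0 -> 0 <= H - k ->
  (forall w1 w2, 0 <= J w1 w2 - k * I w1 w2) /\
  exists w1 w2, [/\ (w1, w2) != 0 :> R * R & J w1 w2 = k * I w1 w2].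
Proof.
move=> aE bE cE kroot kH.
have G0 : 0 < G.
  have : 0 < E * G by apply: lt_le_trans D0 _; rewrite gerBl sqr_ge0.
  by rewrite pmulr_rgt0.
have det : a * c = b ^+ 2.
  have : a * c - b ^+ 2 = D * (k ^+ 2 - 2 * H * k + K).
    by rewrite aE bE cE /H /K /D; field; rewrite gt_eqF.
  by rewrite kroot mulr0 => /eqP; rewrite subr_eq0 => /eqP.
have tr : 0 <= a * G - 2 * b * F + c * E.
  have -> : a * G - 2 * b * F + c * E = 2 * D * (H - k).
    by rewrite aE bE cE /H /D; field; rewrite gt_eqF.
  by rewrite !mulr_ge0// ltW.
have JI w1 w2 : J w1 w2 - k * I w1 w2 = a * w1 ^+ 2 + 2 * b * w1 * w2 + c * w2 ^+ 2.
  by rewrite /J /I aE bE cE; ring.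
(* multiplying by E: E (a G - 2 b F + c E) = a D + (square) when ac = b^2 *)
have aEc : a * (E * (a * G - 2 * b * F + c * E)) = a ^+ 2 * D + (a * F - b * E) ^+ 2.
  have -> : a * (E * (a * G - 2 * b * F + c * E)) =
    a ^+ 2 * E * G - 2 * a * b * F * E + (a * c) * E ^+ 2 by ring.
  by rewrite det /D; ring.
have cEc : c * (G * (a * G - 2 * b * F + c * E)) = c ^+ 2 * D + (c * F - b * G) ^+ 2.
  have -> : c * (G * (a * G - 2 * b * F + c * E)) =
    c ^+ 2 * E * G - 2 * c * b * F * G + (a * c) * G ^+ 2 by ring.
  by rewrite det /D; ring.
(* For x < 0 the left side of the equation would be nonpositive and the right side positive. *)
have sgn x y T S : 0 < y -> 0 <= T -> x * (y * T) = x ^+ 2 * D + S ^+ 2 -> 0 <= x.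
  move=> y0 T0 xE; rewrite leNgt; apply/negP => x0.
  have : x * (y * T) <= 0 by rewrite mulr_le0_ge0// ?mulr_ge0// ltW.
  rewrite xE leNgt => /negP; apply; apply: ltr_wpDr; first exact: sqr_ge0.
  by rewrite mulr_gt0// lt_neqAle sqr_ge0 eq_sym expf_neq0// lt_eqF.
have a0 : 0 <= a by exact: sgn aEc.
have c0 : 0 <= c by exact: sgn cEc.
split.
  move=> w1 w2; rewrite JI.
  have [az|an] := eqVneq a 0.
    have /eqP := det; rewrite az mul0r eq_sym sqrf_eq0 => /eqP ->.
    by rewrite mulr0 !mul0r !add0r mulr_ge0// sqr_ge0.
  have ap : 0 < a by rewrite lt_neqAle eq_sym an.
  rewrite -(pmulr_rge0 _ ap).
  have -> : a * (a * w1 ^+ 2 + 2 * b * w1 * w2 + c * w2 ^+ 2) =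
    (a * w1) ^+ 2 + 2 * a * b * w1 * w2 + (a * c) * w2 ^+ 2 by ring.
  rewrite det (_ : _ + _ = (a * w1 + b * w2) ^+ 2) ?sqr_ge0//; ring.
have [az|an] := eqVneq a 0.
  exists 1, 0; split; first by rewrite -pair_eqE /= oner_eq0.
  by apply/eqP; rewrite -subr_eq0 JI az; apply/eqP; ring.
(* The null vector of a degenerate symmetric matrix whose first entry a is not zero. *)
exists (- b), a; split; first by rewrite -pair_eqE /= (negPf an) andbF.
apply/eqP; rewrite -subr_eq0 JI; apply/eqP.
have -> : a * (- b) ^+ 2 + 2 * b * - b * a + c * a ^+ 2 = a * (a * c - b ^+ 2) by ring.
by rewrite det subrr mulr0.
Qed.

End RayleighQuotient.

Section PrincipalCurvatures.
Context {R : realType}.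

Lemma inf_min (A : set R) x : A x -> (forall y, A y -> x <= y) -> inf A = x.
Proof.
move=> Ax lb; apply/eqP; rewrite eq_le; apply/andP; split.
  by apply: ge_inf => //; exists x.
by apply: lb_le_inf => //; exists x.
Qed.

Lemma rayleigh_inf (E F G e f g : R) (q : R * R -> R) :
  let D := E * G - F ^+ 2 in
  let H := (e * G - 2 * f * F + g * E) / (2 * D) in
  let K := (e * g - f ^+ 2) / D in
  let I (w : R * R) := E * w.1 ^+ 2 + 2 * F * w.1 * w.2 + G * w.2 ^+ 2 in
  let J (w : R * R) := e * w.1 ^+ 2 + 2 * f * w.1 * w.2 + g * w.2 ^+ 2 in
  0 < E -> 0 < D -> (forall w, w != 0 -> 0 < I w) ->
  (forall w, q w = J w / I w) ->
  inf [set q w | w in [set w | w != 0]] = H - Num.sqrt (H ^+ 2 - K).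
Proof.
move=> D H K I J E0 D0 I0 qE.
set k := H - _; have HK := mean_gauss_ge0 e f g E0 D0.
have [|||||qk [w1 [w2 [w0 wk]]]] :=
    @quadratic_semidefinite R E F G e f g E0 D0 k (e - k * E) (f - k * F) (g - k * G) => //.
- rewrite -/D -/H -/K.
  rewrite (_ : _ + _ = Num.sqrt (H ^+ 2 - K) ^+ 2 - (H ^+ 2 - K)).
    by rewrite sqr_sqrtr// subrr.
  by rewrite /k; ring.
- by rewrite /k -/D -/H opprB addrC subrK sqrtr_ge0.
apply: inf_min.
  exists (w1, w2) => //; rewrite qE -[k](mulfK (lt0r_neq0 (I0 _ w0))).
  by congr (_ / _).
move=> _ [w /= wn0 <-]; rewrite qE ler_pdivlMr ?I0// -subr_ge0.
exact: qk.
Qed.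

Lemma rayleigh_sup (E F G e f g : R) (q : R * R -> R) :
  let D := E * G - F ^+ 2 in
  let H := (e * G - 2 * f * F + g * E) / (2 * D) in
  let K := (e * g - f ^+ 2) / D in
  let I (w : R * R) := E * w.1 ^+ 2 + 2 * F * w.1 * w.2 + G * w.2 ^+ 2 in
  let J (w : R * R) := e * w.1 ^+ 2 + 2 * f * w.1 * w.2 + g * w.2 ^+ 2 in
  0 < E -> 0 < D -> (forall w, w != 0 -> 0 < I w) ->
  (forall w, q w = J w / I w) ->
  sup [set q w | w in [set w | w != 0]] = H + Num.sqrt (H ^+ 2 - K).
Proof.
move=> D H K I J E0 D0 I0 qE.
(* Changing the sign of the second form exchanges maximum and minimum, turns H into -H and leaves K
   unchanged. *)
have := @rayleigh_inf E F G (- e) (- f) (- g) (fun w => - q w) E0 D0 I0.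
rewrite -/D.
have -> : (- e * G - 2 * - f * F + - g * E) / (2 * D) = - H by rewrite /H; ring.
have -> : (- e * - g - (- f) ^+ 2) / D = K by rewrite /K; ring.
rewrite sqrrN => h; apply/eqP; rewrite -eqr_opp opprD; apply/eqP; rewrite -h.
  rewrite /inf; congr (- sup _).
  apply/seteqP; split.
    by move=> _ [w w0 <-]; exists (- q w); [exists w|rewrite opprK].
  by move=> _ [_ [w w0 <-] <-]; exists w => //; rewrite opprK.
by move=> w; rewrite qE /J -mulNr; congr (_ / _); ring.
Qed.

Implicit Types (X : R * R -> 'rV[R]_3) (z w : R * R).

(** The curvatures of a patch are defined through an infimum and a supremum; these classical
    rational expressions make the smoothness of H and K visible. *)
Definition coef_H X z :=
  (coef_e X z * coef_G X z - 2 * coef_f X z * coef_F X z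
   + coef_g X z * coef_E X z) / (2 * area2 X z).
Definition coef_K X z := (coef_e X z * coef_g X z - coef_f X z ^+ 2) / area2 X z.

Lemma coef_HK_ge0 X z : regular_at X z -> 0 <= coef_H X z ^+ 2 - coef_K X z.
Proof. by move=> rX; apply: mean_gauss_ge0; [exact: coef_E_gt0|exact: area2_gt0]. Qed.

Lemma kappa1E X z : regular_at X z ->
  kappa1 X z = coef_H X z - Num.sqrt (coef_H X z ^+ 2 - coef_K X z).
Proof.
move=> rX; apply: (@rayleigh_inf (coef_E X z) (coef_F X z) (coef_G X z)
  (coef_e X z) (coef_f X z) (coef_g X z)) => //.
- exact: coef_E_gt0.
- exact: area2_gt0.
- by move=> w; exact: form1_gt0.
Qed.

Lemma kappa2E X z : regular_at X z ->
  kappa2 X z = coef_H X z + Num.sqrt (coef_H X z ^+ 2 - coef_K X z).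
Proof.
move=> rX; apply: (@rayleigh_sup (coef_E X z) (coef_F X z) (coef_G X z)
  (coef_e X z) (coef_f X z) (coef_g X z)) => //.
- exact: coef_E_gt0.
- exact: area2_gt0.
- by move=> w; exact: form1_gt0.
Qed.

Lemma meanHE X z : regular_at X z -> meanH X z = coef_H X z.
Proof.
move=> rX; rewrite /meanH kappa1E// kappa2E//.
by move: (coef_H X z) (Num.sqrt _) => h s; field.
Qed.

Lemma gaussKE X z : regular_at X z -> gaussK X z = coef_K X z.
Proof.
move=> rX; rewrite /gaussK kappa1E// kappa2E//.
have := sqr_sqrtr (coef_HK_ge0 rX).
move: (coef_H X z) (coef_K X z) (Num.sqrt _) => h k s sE.
have -> : (h - s) * (h + s) = h ^+ 2 - s ^+ 2 by ring.
by rewrite sE; ring.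
Qed.

End PrincipalCurvatures.

(** * Invariance under orientation preserving changes of coordinates *)

Section ChangeOfChart.
Context {R : realType}.
Variables (U U' : set (R * R)) (X : R * R -> 'rV[R]_3) (phi : R * R -> R * R).
Hypotheses (oU : open U) (oU' : open U') (cX : classC 2 U X).
Hypothesis rX : forall z, U z -> regular_at X z.
Hypotheses (cphi : classC 1 U' phi) (phiU : forall z, U' z -> U (phi z)).
Hypothesis detphi : forall z, U' z -> 0 < det2 (pd_u phi z) (pd_v phi z).
Hypothesis cXphi : classC 2 U' (X \o phi).

Let dphi z : U' z -> differentiable phi z.
Proof. by move=> U'z; exact: classC_differentiable cphi U'z. Qed.

Lemma dvec_comp (Y : R * R -> 'rV[R]_3) z w : differentiable phi z ->
  differentiable Y (phi z) -> dvec (Y \o phi) z w = dvec Y (phi z) ('D_w phi z).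
Proof.
move=> dp dY; have dc : differentiable (Y \o phi) z by exact: differentiable_comp.
exact: (etrans (esym (derive_plane w dc)) (@derive_pair R (R * R)%type _ Y phi z w dY dp)).
Qed.

Lemma cross_comp z : differentiable phi z -> differentiable X (phi z) ->
  cross (pd_u (X \o phi) z) (pd_v (X \o phi) z) =
  det2 (pd_u phi z) (pd_v phi z) *: cross (pd_u X (phi z)) (pd_v X (phi z)).
Proof.
move=> dp dX.
have hu : pd_u (X \o phi) z = (pd_u phi z).1 *: pd_u X (phi z) + (pd_u phi z).2 *: pd_v X (phi z).
  exact: (@derive_pair R (R * R)%type _ X phi z (1, 0) dX dp).
have hv : pd_v (X \o phi) z = (pd_v phi z).1 *: pd_u X (phi z) + (pd_v phi z).2 *: pd_v X (phi z).
  exact: (@derive_pair R (R * R)%type _ X phi z (0, 1) dX dp).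
exact: (etrans (congr2 (@cross R) hu hv) (@cross_comb R (pd_u phi z).1 (pd_u phi z).2
  (pd_v phi z).1 (pd_v phi z).2 (pd_u X (phi z)) (pd_v X (phi z)))).
Qed.

Let dX z : U' z -> differentiable X (phi z).
Proof. by move=> U'z; apply: classC_differentiable cX _; exact: phiU. Qed.

Lemma regular_comp z : U' z -> regular_at (X \o phi) z.
Proof.
move=> U'z; rewrite /regular_at (cross_comp (dphi U'z) (dX U'z)) scaler_eq0.
by rewrite negb_or gt_eqF ?detphi//=; exact/rX/phiU.
Qed.

Lemma unit_normal_comp z : U' z ->
  unit_normal (X \o phi) z = unit_normal X (phi z).
Proof.
move=> U'z.
apply: etrans (congr1 (fun n => (Num.sqrt (dot n n))^-1 *: n)
  (cross_comp (dphi U'z) (dX U'z))) _.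
rewrite /unit_normal; have := detphi U'z; have := rX (phiU U'z); rewrite /regular_at.
move: (det2 _ _) (cross _ _) => d n n0 d0.
rewrite dotZl dotZr mulrA -expr2 sqrtrM ?sqr_ge0// sqrtr_sqr gtr0_norm//.
by rewrite scalerA invfM mulrAC mulVf ?mul1r// gt_eqF.
Qed.

Let cN : classC 1 U (unit_normal X). Proof. exact: classC_normal. Qed.

Lemma dvec_unit_normal_comp z w : U' z ->
  dvec (unit_normal (X \o phi)) z w = dvec (unit_normal X) (phi z) ('D_w phi z).
Proof.
move=> U'z.
have E : \near z, unit_normal (X \o phi) z = (unit_normal X \o phi) z.
  by apply: filterS (open_nbhs_nbhs (conj oU' U'z)) => y /unit_normal_comp.
have dN : differentiable (unit_normal X) (phi z).
  exact: classC_differentiable cN (phiU U'z).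
apply: etrans (dvec_comp w (dphi U'z) dN).
exact: (congr2 (fun a b => w.1 *: a + w.2 *: b) (near_eq_pd_u E) (near_eq_pd_v E)).
Qed.

Lemma form1_comp z w : U' z ->
  form1 (X \o phi) z w = form1 X (phi z) ('D_w phi z).
Proof.
move=> U'z; have E := dvec_comp w (dphi U'z) (dX U'z).
exact: etrans (form1E _ _ _) (etrans (congr2 (@dot R) E E) (esym (form1E _ _ _))).
Qed.

(** In the form II = - <dN, dX> only first derivatives of [phi] enter, so the chain rule is enough
    and [phi] may be merely C^1. *)
Lemma normal_curv_comp z w : U' z ->
  normal_curv (X \o phi) z w = normal_curv X (phi z) ('D_w phi z).
Proof.
move=> U'z; have E := dvec_comp w (dphi U'z) (dX U'z).
have E2 := form2E oU' cXphi regular_comp w U'z.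
have E2' := form2E oU cX rX ('D_w phi z) (phiU U'z).
have EN := dvec_unit_normal_comp w U'z.
exact: (congr2 (fun a b => a / b) (etrans E2 (etrans (congr1 -%R (congr2 (@dot R) EN E))
  (esym E2'))) (form1_comp w U'z)).
Qed.

Lemma geod_torsion_comp z w : U' z ->
  geod_torsion (X \o phi) z w = geod_torsion X (phi z) ('D_w phi z).
Proof.
move=> U'z; have E := dvec_comp w (dphi U'z) (dX U'z).
exact: (congr2 (fun a b => - a / b) (congr2 (@dot R) (dvec_unit_normal_comp w U'z)
  (congr2 (@cross R) (unit_normal_comp U'z) E)) (form1_comp w U'z)).
Qed.

Lemma derive_eq0 z w : U' z -> 'D_w phi z = 0 -> w = 0.
Proof.
move=> U'z; rewrite derive_plane; last exact: dphi.
have := detphi U'z; rewrite /det2.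
case: (pd_u phi z) (pd_v phi z) w => a b [c d] [x y] /= det [] h1 h2.
have xd : x * (a * d - b * c) = 0.
  have -> : x * (a * d - b * c) = (x * a + y * c) * d - (x * b + y * d) * c by ring.
  by rewrite h1 h2 !mul0r subrr.
have yd : y * (a * d - b * c) = 0.
  have -> : y * (a * d - b * c) = (x * b + y * d) * a - (x * a + y * c) * b by ring.
  by rewrite h1 h2 !mul0r subrr.
by congr (_, _); apply/eqP; [move/eqP: xd|move/eqP: yd];
   rewrite mulf_eq0 (gt_eqF det) orbF.
Qed.

Lemma derive_surj z w' : U' z -> exists w, 'D_w phi z = w'.
Proof.
move=> U'z; have := detphi U'z; rewrite /det2.
have D w : 'D_w phi z = w.1 *: pd_u phi z + w.2 *: pd_v phi z.
  by rewrite derive_plane//; exact: dphi.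
move: D; move: (pd_u phi z) (pd_v phi z) w' => [a b] [c d] [x y] D /= det.
(* Cramer's rule. *)
exists ((x * d - y * c) / (a * d - b * c), (a * y - b * x) / (a * d - b * c)).
rewrite D; congr (_, _); rewrite /= /GRing.scale /=; field;
  by rewrite gt_eqF.
Qed.

Lemma normal_curv_set_comp z : U' z ->
  [set normal_curv (X \o phi) z w | w in [set w | w != 0]] =
  [set normal_curv X (phi z) w | w in [set w | w != 0]].
Proof.
move=> U'z; apply/seteqP; split=> _ [w /= w0 <-].
  exists ('D_w phi z); last exact: esym (normal_curv_comp w U'z).
  by apply: contra_neq w0; exact: derive_eq0.
have [w' w'E] := derive_surj w U'z; exists w' => /=.
  apply: contra_neq w0 => w'0; rewrite -w'E w'0.
  by rewrite derive0.
exact: etrans (normal_curv_comp w' U'z) (congr1 _ w'E).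
Qed.

Lemma kappa1_comp z : U' z -> kappa1 (X \o phi) z = kappa1 X (phi z).
Proof. by move=> U'z; exact: (congr1 (@inf R) (normal_curv_set_comp U'z)). Qed.

Lemma kappa2_comp z : U' z -> kappa2 (X \o phi) z = kappa2 X (phi z).
Proof. by move=> U'z; exact: (congr1 (@sup R) (normal_curv_set_comp U'z)). Qed.

End ChangeOfChart.

(** * Smoothness of the mean curvature function *)

Section PowerSeries.
Context {R : realType}.
Implicit Types (f : nat -> R) (x z q : R).

(** Each of the n + 1 terms of the geometric sum up to q^n is at least q^n. This bound absorbs the
    factor n + 1 of a differentiated power series. *)
Lemma mulrn_expr_le q n : 0 <= q < 1 -> n.+1%:R * q ^+ n <= (1 - q)^-1.
Proof.
move=> /andP[q0 q1]; have q10 : 0 < 1 - q by rewrite subr_gt0.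
rewrite -[leRHS]mul1r ler_pdivlMr//.
have : n.+1%:R * q ^+ n <= \sum_(i < n.+1) q ^+ i.
  rewrite -[X in X%:R]card_ord -sum1_card natr_sum mulr_suml.
  apply: ler_sum => i _; rewrite mul1r.
  by apply: ler_wiXn2l => //; [exact: ltW|rewrite -ltnS].
move=> /(ler_wpM2r (ltW q10)) /le_trans; apply.
have -> : (\sum_(i < n.+1) q ^+ i) * (1 - q) = 1 - q ^+ n.+1.
  by rewrite -[RHS]opprB subrX1 -mulNr opprB mulrC.
by rewrite gerBl exprn_ge0.
Qed.

Lemma is_cvg_pseries_diffs f x z : cvgn (pseries f x) -> `|z| < `|x| ->
  cvgn (pseries (pseries_diffs f) z).
Proof.
(* An intermediate radius: r < |x| gives absolute convergence at r, and |z| / r < 1 pays for the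
   factor n + 1. *)
move=> cf zx; pose r := (`|z| + `|x|) / 2.
have r0 : 0 < r by rewrite /r; have := normr_ge0 z; lra.
have zr : `|z| < r by rewrite /r; lra.
have rx : `|r| < `|x| by rewrite gtr0_norm// /r; lra.
have cr := is_cvg_pseries_inside_norm cf rx.
have q01 : 0 <= `|z| / r < 1 by rewrite divr_ge0 ?normr_ge0 ?ltW//= ltr_pdivrMr// mul1r.
pose C := (1 - `|z| / r)^-1 / r.
apply: normed_cvg.
apply: (@series_le_cvg _ _ (fun n => C * (`|f n.+1| * r ^+ n.+1))) => //.
- by move=> n /=; exact: normr_ge0.
- move=> n; rewrite mulr_ge0//; last by rewrite mulr_ge0// exprn_ge0// ltW.
  by rewrite /C divr_ge0// ltW// invr_gt0 subr_gt0; case/andP: q01.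
- move=> n /=; rewrite /pseries_diffs !normrM normrX [X in X * _ * _]ger0_norm//.
  have := mulrn_expr_le n q01; rewrite expr_div_n => H.
  rewrite /C exprS => {C}.
  have rn0 : 0 < r ^+ n by rewrite exprn_gt0.
  move: ((1 - `|z| / r)^-1) H => c H.
  have {}H : n.+1%:R * `|z| ^+ n <= c * r ^+ n by rewrite -ler_pdivrMr// -mulrA.
  rewrite (_ : c / r * _ = `|f n.+1| * (c * r ^+ n)); last by field; rewrite gt_eqF.
  rewrite (_ : n.+1%:R * _ * _ = `|f n.+1| * (n.+1%:R * `|z| ^+ n)); last by ring.
  by rewrite ler_wpM2l.
- apply: (@is_cvg_seriesZ R (fun n => `|f n.+1| * r ^+ n.+1)).
  have -> : series (fun n => `|f n.+1| * r ^+ n.+1) =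
      (fun n => series (fun n => `|f n| * r ^+ n) n.+1 - `|f 0%N|).
    apply/funext => n; rewrite /series /= big_nat_recl//= expr0 mulr1.
    by rewrite addrAC subrr add0r.
  by apply: is_cvgB; [rewrite -[X in cvg (X @ _)]/([sequence _]_n); apply/cvg_ex; move/cvg_ex: cr => [l cl]; exists l; rewrite cvg_shiftS|exact: is_cvg_cst].
Qed.

Lemma is_derive_pseries f x z : cvgn (pseries f x) -> `|z| < `|x| ->
  is_derive z 1 (fun y => limn (pseries f y)) (limn (pseries (pseries_diffs f) z)).
Proof.
(* Each differentiation of the series costs some radius: the first derived series is controlled at
   r1, the second at r2, with |z| < r2 < r1 < |x|. *)
move=> cf zx; pose r1 := (`|z| + `|x|) / 2; pose r2 := (`|z| + r1) / 2.
have z0 := normr_ge0 z.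
have h1 : `|r1| < `|x| by rewrite ger0_norm /r1; lra.
have h2 : `|r2| < `|r1| by rewrite !ger0_norm /r2 /r1; lra.
have h3 : `|z| < `|r2| by rewrite [ltRHS]ger0_norm /r2 /r1; lra.
have c1 := is_cvg_pseries_diffs cf h1.
have c2 := is_cvg_pseries_diffs c1 h2.
apply: (@pseries_snd_diffs R f r2 z) => //.
- by apply: is_cvg_pseries_inside cf _; apply: lt_trans h1.
- by apply: is_cvg_pseries_inside c1 _.
Qed.

End PowerSeries.

Section MeanFunction.
Context {R : realType}.
Variable m : R -> R -> R.
Hypothesis hm : mean_curvature_function m.

Lemma mean_slice_series (h y : R) : mean_domain (h, y) -> 0 < y -> y < h ^+ 2 ->
  exists (a : nat -> R) (rho : R), [/\ 0 < rho, cvgn (pseries a rho) &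
    forall t, `|t| < rho -> m h (y + t) = limn (pseries a t)].
Proof.
move=> dy y0 yh; have [a [rho [rho0 H]]] := mcf_analytic hm dy y0.
have E (t : R) n : \sum_(i < n.+1) a i (n - i)%N * 0 ^+ i * t ^+ (n - i) = a 0%N n * t ^+ n.
  rewrite big_ord_recl /= subn0 expr0 mulr1 big1 ?addr0// => i _.
  by rewrite expr0n /= mulr0 mul0r.
(* The last two bounds keep (h, y + t) in [mean_domain], where [m] agrees with the series; rho / 2
   puts the point r itself inside the square of convergence. *)
pose r := Num.min (rho / 2) (Num.min y (h ^+ 2 - y)).
have r0 : 0 < r by rewrite !lt_min y0 subr_gt0 yh divr_gt0.
have rrho : r < rho by rewrite gt_min; apply/orP; left; lra.
exists (a 0%N), r; split => //.
  have [||cr _] := H 0 r; [by rewrite normr0|by rewrite gtr0_norm|].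
  apply: normed_cvg; apply: (series_le_cvg _ _ _ cr) => n /=.
  - exact: normr_ge0.
  - exact: sumr_ge0.
  - by rewrite -E; exact: ler_norm_sum.
move=> t tr.
have [||_] := H 0 t; [by rewrite normr0|exact: lt_trans rrho|].
have : mean_domain (h + 0, y + t).
  move: tr; rewrite /r !lt_min => /and3P[_ ty th]; rewrite addr0.
  by split => /=; move: ty th; rewrite !ltr_norml => /andP[? ?] /andP[? ?]; lra.
rewrite addr0 => dyt /(_ dyt) /cvg_lim <-//.
by congr (limn _); rewrite /pseries; congr series; apply/funext => n /=; rewrite E.
Qed.

Lemma mean_slice_C1 (h y : R) : 0 < y -> y < h ^+ 2 ->
  derivable (m h) y 1 /\ {for y, continuous (derive1 (m h))}.
Proof.
move=> y0 yh.
have dy : mean_domain (h, y) by split; apply: ltW.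
have [a [rho [rho0 ca H]]] := mean_slice_series dy y0 yh.
have D t : `|t| < rho -> is_derive (y + t) 1 (m h) (limn (pseries (pseries_diffs a) t)).
  move=> trho.
  have rho' : `|t| < `|rho| by rewrite (gtr0_norm rho0).
  have D0 := is_derive_pseries ca rho'.
  have D1 : is_derive (y + t) 1 (fun x => x - y) 1.
    by apply: is_derive_eq; rewrite subr0.
  have D2 : is_derive (y + t) 1 ((fun y => limn (pseries a y)) \o (fun x => x - y))
      (limn (pseries (pseries_diffs a) t)).
    apply: is_derive_eq; last exact: mulr1.
    by apply: is_derive1_comp; rewrite (_ : y + t - y = t)//; ring.
  apply: near_eq_is_derive D2.
  have : \forall x \near y + t, `|x - y| < rho.
    have C : {for y + t, continuous (fun x => `|x - y|)}.
      by apply: (@continuous_comp _ _ _ (fun x => x - y) (fun x => `|x|));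
        [apply: cvgB; [exact: cvg_id|exact: cvg_cst]|exact: norm_continuous].
    by apply: (cvgr_lt _ C); rewrite (_ : y + t - y = t)//; ring.
  by apply: filterS => x xy /=; rewrite -H//; congr m; ring.
have N : \forall x \near y, derive1 (m h) x = limn (pseries (pseries_diffs a) (x - y)).
  have : \forall x \near y, `|x - y| < rho.
    have C : {for y, continuous (fun x => `|x - y|)}.
      by apply: (@continuous_comp _ _ _ (fun x => x - y) (fun x => `|x|));
        [apply: cvgB; [exact: cvg_id|exact: cvg_cst]|exact: norm_continuous].
    by apply: (cvgr_lt _ C); rewrite subrr normr0.
  apply: filterS => x xy; have := D _ xy; rewrite (_ : y + (x - y) = x); last by ring.
  by rewrite derive1E => -[].
have D0 := D 0; rewrite normr0 addr0 in D0; split; first by have [] := D0 rho0.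
have c1 := is_cvg_pseries_diffs ca.
have r2 : `|rho / 2| < `|rho| by rewrite !gtr0_norm//; lra.
have r2' : `|0 : R| < `|rho / 2| by rewrite normr0 gtr0_norm//; lra.
have D1 := is_derive_pseries (c1 _ r2) r2'.
have C1 := is_derive_continuous D1.
have C2 : {for y, continuous (fun x => limn (pseries (pseries_diffs a) (x - y)))}.
  apply: (@continuous_comp _ _ _ (fun x => x - y)
    (fun x => limn (pseries (pseries_diffs a) x))).
    by apply: cvgB; [exact: cvg_id|exact: cvg_cst].
  by rewrite subrr.
rewrite /prop_for /continuous_at (nbhs_singleton N).
apply: cvg_trans C2; apply: near_eq_cvg.
by apply: filterS N => x /esym.
Qed.

(** The interior of [mean_domain]: the pairs (H, K) of the points with K > 0 that are not
    umbilic. *)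
Definition elliptic : set (R * R) := [set z | 0 < z.2 /\ z.2 < z.1 ^+ 2].

Lemma open_elliptic : open elliptic.
Proof.
have -> : elliptic = (setT `&` [set z : R * R | 0 < z.2]) `&` [set z | 0 < z.1 ^+ 2 - z.2].
  by apply/seteqP; split => z /=; rewrite subr_gt0; [case|case=> -[]].
have o1 : open (setT `&` [set z : R * R | 0 < z.2]).
  apply: open_gt0; first exact: openT.
  by move=> z _; exact: cvg_snd.
apply: open_gt0 => // z _.
by apply: cvgB; [apply: cvgM; exact: cvg_fst|exact: cvg_snd].
Qed.

(* By homogeneity m(h, k) = |h| m(h / |h|, k / h^2), so the one-variable power
   series of m in k are enough. *)
Lemma classC_mean : classC 1 elliptic (fun z => m z.1 z.2).
Proof.
(* [sg] is the sign of h, so that |h| = sg h is smooth; the two components h > 0 and h < 0 lead to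
   the slices of [m] at 1 and at -1. *)
have half (sg : R) : sg ^+ 2 = 1 ->
    classC 1 (elliptic `&` [set z | 0 < sg * z.1]) (fun z => m z.1 z.2).
  move=> sg1.
  have oU : open (elliptic `&` [set z | 0 < sg * z.1]).
    apply: open_gt0; first exact: open_elliptic.
    by move=> z _; apply: cvgM; [exact: cvg_cst|exact: cvg_fst].
  set U := _ `&` _ in oU *.
  have U1 z : U z -> z.1 ^+ 2 != 0.
    by case=> -[/= a b] _; rewrite gt_eqF//; exact: lt_trans b.
  have c1 : classC 1 U (fun z => sg * z.1).
    by apply: classCM => //; [exact: classC_cst|exact: classC_proj1].
  have c2 : classC 1 U (fun z => z.2 / z.1 ^+ 2).
    apply: (classCM oU (classC_proj2 1 oU)).
    by apply: (classCV oU U1 (classCX 2 oU (classC_proj1 1 oU))).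
  have c3 : classC 1 U (fun z => m sg (z.2 / z.1 ^+ 2)).
    apply: (@classC_comp1 R 1 U [set y | 0 < y < 1] (m sg)) c2 => //.
    - move=> z Uz; have := U1 _ Uz; case: Uz => -[/= a b] _ z1.
      have z10 : 0 < z.1 ^+ 2 by exact: lt_trans b.
      by rewrite divr_gt0//= ltr_pdivrMr// mul1r.
    - move=> n v; rewrite ltnS leqn0 => /eqP -> /andP[v0 v1].
      by rewrite -sg1 in v1; have [h _] := mean_slice_C1 v0 v1; exact: h.
    - move=> v /andP[v0 v1].
      by rewrite -sg1 in v1; have [_ h] := mean_slice_C1 v0 v1; exact: h.
  apply: (classC_congr oU _ (classCM oU c1 c3)) => z Uz.
  have z1 := U1 _ Uz; case: Uz => -[/= a b] s0.
  have z10 : 0 < z.1 ^+ 2 by exact: lt_trans b.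
  have E1 : sg * z.1 * sg = z.1 by rewrite mulrAC -expr2 sg1 mul1r.
  have E2 : (sg * z.1) ^+ 2 * (z.2 / z.1 ^+ 2) = z.2.
    by rewrite exprMn sg1 mul1r mulrC divfK.
  rewrite -(mcf_homog hm (ltW s0)) ?E1 ?E2//; split => /=.
    by rewrite divr_ge0// ltW.
  by rewrite sg1 ler_pdivrMr// mul1r ltW.
have sp : (1 : R) ^+ 2 = 1 by rewrite expr1n.
have sn : (-1 : R) ^+ 2 = 1 by rewrite sqrrN expr1n.
apply: (classC_sub _ (classC_cup (half _ sp) (half _ sn))).
move=> z ez; have : z.1 != 0.
  by apply: contraTneq isT => z1; case: ez; rewrite z1 expr0n /= => a /(lt_trans a); rewrite ltxx.
by rewrite neq_lt => /orP[z1|z1]; [right|left]; split => //=; rewrite ?mulN1r ?oppr_gt0 ?mul1r.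
Qed.

Lemma derive1_mean_u h k :
  derive1 (fun h' => m h' k) h = pd_u (fun z => m z.1 z.2) (h, k).
Proof. by rewrite derive1E (derive_slice_u (fun z => m z.1 z.2)). Qed.

Lemma derive1_mean_v h k :
  derive1 (fun k' => m h k') k = pd_v (fun z => m z.1 z.2) (h, k).
Proof. by rewrite derive1E (derive_slice_v (fun z => m z.1 z.2)). Qed.

End MeanFunction.

(** * The return map of a scalar differential equation *)

Section Tube.
Context {R : realType}.

(** Compactness of the segment makes the widths of the neighbourhoods uniform; halving the width
    gives the closed inequality. *)
Lemma tube (a b : R) (P : R * R -> Prop) :
  (forall s, a <= s <= b -> nbhs (s, 0) P) ->
  exists2 rho : R, 0 < rho & forall s v, a <= s <= b -> `|v| <= rho -> P (s, v).
Proof.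
move=> H; have /compact_near_coveringP := @segment_compact R a b.
move=> /(_ R (nbhs 0) (fun v s => P (s, v)) _) [].
  move=> s; rewrite /= in_itv /= => /H [[A B] /= [nA nB] AB].
  by exists (A, B) => // -[x y] [? ?]; exact: AB.
move=> r /= r0 B; exists (r / 2); first by rewrite divr_gt0.
move=> s v sab vr; have /= := B v; move=> /(_ _ s); apply; last by rewrite /= in_itv.
by rewrite sub0r normrN; apply: le_lt_trans vr _; rewrite ltr_pdivrMr// ltr_pMr// ltr1n.
Qed.

(** The projection of the line onto [a, b]. It is 1-Lipschitz, so composing with it extends a
    function from a rectangle to the plane without enlarging its Lipschitz constant. *)
Definition clamp (a b x : R) := Num.max a (Num.min b x).

Lemma clamp_continuous a b : continuous (clamp a b).
Proof.
move=> x; apply: (@continuous_max _ _ (cst a) (fun x => Num.min b x)); first exact: cvg_cst.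
by apply: (@continuous_min _ _ (cst b) id); [exact: cvg_cst|exact: cvg_id].
Qed.

Lemma clamp_itv a b x : a <= b -> a <= clamp a b x <= b.
Proof.
by move=> ab; rewrite /clamp le_max lexx ge_max ab ge_min lexx.
Qed.

Lemma clamp_id a b x : a <= x <= b -> clamp a b x = x.
Proof. by case/andP=> ax xb; rewrite /clamp (min_idPr _)// (max_idPr _). Qed.

Lemma clamp_lipschitz a b x y : `|clamp a b x - clamp a b y| <= `|x - y|.
Proof.
have h1 := ler_norm (x - y); have := ler_norm (y - x); rewrite distrC => h2.
have mn : `|Num.min b x - Num.min b y| <= `|x - y|.
  by rewrite ler_norml; case: (leP b x) => ?; case: (leP b y) => ?; apply/andP; split; lra.
apply: le_trans mn; rewrite /clamp; move: (Num.min b x) (Num.min b y) => p q.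
have h3 := ler_norm (p - q); have := ler_norm (q - p); rewrite distrC => h4.
by rewrite ler_norml; case: (leP a p) => ?; case: (leP a q) => ?; apply/andP; split; lra.
Qed.

End Tube.

Section Primitive.
Context {R : realType}.
Implicit Types f : R -> R.

Lemma continuous_primitive f (a : R) : continuous f -> exists F : R -> R,
  forall x, a < x -> is_derive x 1 F (f x).
Proof.
move=> cf; pose F x := parameterized_integral lebesgue_measure a x f.
exists F => x ax.
have xu : x < x + 1 by rewrite ltrDl.
have [|||d dE] := @continuous_FTC1_closed R f a x (x + 1) xu.
- apply: continuous_compact_integrable; first exact: segment_compact.
  exact: continuous_subspaceT.
- exact: ax.
- exact: cf.
by rewrite -dE derive1E; apply/derivableP.
Qed.

(** An integral has the right derivative strictly to the right of its base point, hence the base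
    point a - 1; freezing F to the left of a then makes it continuous on the whole line. *)
Lemma bounded_primitive f (a x0 : R) : a < x0 -> continuous f -> exists F : R -> R,
  [/\ continuous F, F x0 = 0 & forall x, a < x -> is_derive x 1 F (f x)].
Proof.
move=> ax0 cf; have [F HF] := continuous_primitive (a - 1) cf.
exists (fun x => F (Num.max a x) - F x0); split.
- move=> x; apply: cvgB; last exact: cvg_cst.
  apply: (@continuous_comp _ _ _ (fun x => Num.max a x) F).
    by apply: (@continuous_max _ _ (cst a) id); [exact: cvg_cst|exact: cvg_id].
  apply: is_derive_continuous (HF _ _).
  by rewrite lt_max ltrBlDr ltrDl ltr01.
- by rewrite (max_idPr _) ?subrr// ltW.
- move=> x ax; have HFx : is_derive x 1 F (f x) by apply: HF; lra.
  apply: (@near_eq_is_derive _ _ _ (fun x => F x - F x0)).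
    near=> y; rewrite (max_idPr _)// ltW//; near: y.
    by apply: open_nbhs_nbhs; split; [exact: open_gt|exact: ax].
  by apply: is_derive_eq; rewrite subr0.
Unshelve. all: by end_near. Qed.

End Primitive.

Section Growth.
Context {R : realType}.
Implicit Types (w dw g dg : R -> R).

(** Both g - w and g + w have a nonnegative derivative; the mean value theorem is applied to
    each. *)
Lemma le_growth w dw g dg (T : R) : 0 <= T ->
  (forall t, 0 <= t <= T -> is_derive t 1 w (dw t)) ->
  (forall t, 0 <= t <= T -> is_derive t 1 g (dg t)) ->
  (forall t, 0 <= t <= T -> `|dw t| <= dg t) ->
  `|w T - w 0| <= g T - g 0.
Proof.
move=> T0 hw hg hd.
have [t tT] := @mean_value R (fun t => g t - w t) (fun t => dg t - dw t) 0 T T0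
  (fun t tT => is_deriveB (hg t tT) (hw t tT)).
have [s sT] := @mean_value R (fun t => g t + w t) (fun t => dg t + dw t) 0 T T0
  (fun t tT => is_deriveD (hg t tT) (hw t tT)).
rewrite subr0 => Es Et.
have := hd _ tT; rewrite ler_norml => /andP[_ h1].
have := hd _ sT; rewrite ler_norml => /andP[h2 _].
have p1 : 0 <= (dg t - dw t) * T by rewrite mulr_ge0// subr_ge0.
have p2 : 0 <= (dg s + dw s) * T by rewrite mulr_ge0//; lra.
by rewrite ler_norml; apply/andP; split; lra.
Qed.

Lemma is_derive_expM (c t : R) : is_derive t 1 (fun t => expR (c * t)) (c * expR (c * t)).
Proof.
have h1 : is_derive t 1 (fun t => c * t) c by apply: is_derive_eq; rewrite [_ *: _]mulr1.
have := is_derive1_comp (is_derive_expR (c * t)) h1.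
by rewrite mulrC.
Qed.

(** For t >= 0 the majorant is A exp(c s); negative times are reduced to this case by reversing
    time. *)
Lemma le_exp_growth w dw (A c b t : R) : 0 < c -> b < 0 -> b < t ->
  (forall s, b < s -> is_derive s 1 w (dw s)) ->
  (forall s, b < s -> `|dw s| <= A * c * expR (c * `|s|)) ->
  `|w t - w 0| <= A * (expR (c * `|t|) - 1).
Proof.
move=> c0 b0 bt hw hd.
have hg (s : R) : is_derive s 1 (fun t => A * expR (c * t)) (A * (c * expR (c * s))).
  exact: (@is_deriveZ _ _ _ (fun t => expR (c * t)) A s 1 _ (is_derive_expM c s)).
have [t_ge0|t_lt0] := leP 0 t.
  have := @le_growth w dw _ _ t t_ge0 _ (fun s _ => hg s).
  rewrite mulr0 expR0 mulr1 (ger0_norm t_ge0) mulrBr mulr1; apply.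
    by move=> s /andP[s0 st]; apply: hw; lra.
  move=> s /andP[s0 st]; rewrite mulrA (le_trans (hd _ _))//; first by lra.
  by rewrite ger0_norm.
have := @le_growth (fun s => w (- s)) (fun s => - dw (- s)) _ _ (- t) _ _ (fun s _ => hg s).
rewrite mulr0 expR0 mulr1 opprK oppr0 (ltr0_norm t_lt0) mulrBr mulr1; apply; first by lra.
  move=> s /andP[s0 st]; have h : is_derive (- s) 1 w (dw (- s)) by apply: hw; lra.
  have := is_derive1_comp h (is_deriveNid s 1).
  by rewrite mulrN1.
move=> s /andP[s0 st]; rewrite mulrA normrN (le_trans (hd _ _))//; first by lra.
by rewrite normrN ger0_norm.
Qed.

Lemma eq0_geometric (a C : R) : (forall n, `|a| <= C * 2^-1 ^+ n) -> a = 0.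
Proof.
move=> h; apply/eqP; rewrite -normr_le0.
have c0 : C * 2^-1 ^+ n @[n --> \oo] --> (0 : R).
  by apply: cvg_geometric; rewrite ger0_norm; lra.
by apply: (ler_cvg_to (cvg_cst _) c0); near=> n; exact: h.
Unshelve. all: by end_near. Qed.

End Growth.

(** * Picard iteration *)

Section Picard.
Context {R : realType}.
Variables (p : R -> R -> R) (k : R).
Hypotheses (k0 : 0 < k) (pc : continuous (fun z : R * R => p z.1 z.2)).
Hypothesis plip : forall t v v' : R, `|p t v - p t v'| <= k * `|v - v'|.
Hypothesis p0 : forall t, p t 0 = 0.

(** A leaf has to be defined on an open interval around its starting time 0, so the primitive must
    have a derivative also before 0; -1 is a convenient earlier time. *)
Definition primitive (f : R -> R) : R -> R := xget (fun=> 0)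
  [set F : R -> R | [/\ continuous F, F 0 = 0 & forall x : R, -1 < x -> is_derive x 1 F (f x)]].

Lemma primitiveP (f : R -> R) : continuous f -> [/\ continuous (primitive f),
  primitive f 0 = 0 & forall x : R, -1 < x -> is_derive x 1 (primitive f) (f x)].
Proof.
move=> cf; have [|F HF] := @bounded_primitive R f (-1) 0 _ cf; first by lra.
exact: (@xgetPex _ _ [set F : R -> R | [/\ continuous F, F 0 = 0 &
  forall x : R, -1 < x -> is_derive x 1 F (f x)]] (ex_intro _ F HF)).
Qed.

Lemma continuous_along (g : R -> R) : continuous g -> continuous (fun s => p s (g s)).
Proof.
move=> cg s; apply: (@continuous_comp _ _ _ (fun s => (s, g s)) (fun z => p z.1 z.2)).
  exact: (cvg_pair cvg_id (cg s)).
exact: pc.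
Qed.

Fixpoint picard (x : R) n : R -> R :=
  if n is n'.+1 then fun t => x + primitive (fun s => p s (picard x n' s)) t
  else fun=> x.

Lemma picard_continuous x n : continuous (picard x n).
Proof.
elim: n => [|n IH] /= t; first exact: cvg_cst.
apply: cvgD; first exact: cvg_cst.
by have [+ _ _] := primitiveP (continuous_along IH); apply.
Qed.

Lemma picard0 x n : picard x n 0 = x.
Proof.
case: n => //= n; have [_ -> _] := primitiveP (continuous_along (@picard_continuous x n)).
by rewrite addr0.
Qed.

Lemma is_derive_shiftD (a t d : R) (F : R -> R) : is_derive t 1 F d ->
  is_derive t 1 (fun t => a + F t) d.
Proof. by move=> h; have := is_deriveD (is_derive_cst a t 1) h; rewrite add0r. Qed.

Lemma picard_derive x n (t : R) : -1 < t ->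
  is_derive t 1 (picard x n.+1) (p t (picard x n t)).
Proof.
have [_ _ h] := primitiveP (continuous_along (@picard_continuous x n)).
by move=> /h; exact: is_derive_shiftD.
Qed.

(* The weight [expR (2 k |t|)] makes every step contract by 1/2, however long
   the time interval. *)
Lemma picard_step x n (t : R) : -1 < t ->
  `|picard x n.+1 t - picard x n t| <= `|x| * 2^-1 ^+ n * expR (2 * k * `|t|).
Proof.
have n10 : (-1 : R) < 0 by lra.
have c0 : 0 < 2 * k by rewrite mulr_gt0.
elim: n t => [|n IH] t t1.
  have := @le_exp_growth R _ _ `|x| (2 * k) (-1) t c0 n10 t1 (@picard_derive x 0).
  rewrite picard0 expr0 mulr1 /= => H; apply: le_trans (H _) _.
    move=> s s1; have := plip s x 0; rewrite p0 !subr0 => h.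
    apply: le_trans h _.
    have e1 : 1 <= expR (2 * k * `|s|) by rewrite -[leLHS]expR0 ler_expR mulr_ge0// ltW.
    rewrite (_ : _ * _ * _ = k * `|x| * (2 * expR (2 * k * `|s|))); last by ring.
    by rewrite ler_peMr ?mulr_ge0 ?(ltW k0)//; lra.
  by rewrite ler_wpM2l// gerBl.
have D (s : R) : -1 < s -> is_derive s 1 (fun t => picard x n.+2 t - picard x n.+1 t)
    (p s (picard x n.+1 s) - p s (picard x n s)).
  by move=> s1; apply: is_deriveB; exact: picard_derive.
have := @le_exp_growth R _ _ (`|x| * 2^-1 ^+ n.+1) (2 * k) (-1) t c0 n10 t1 D.
rewrite !picard0 subrr subr0 => H; apply: le_trans (H _) _.
  move=> s s1; apply: le_trans (plip _ _ _) _.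
  apply: (@le_trans _ _ (k * (`|x| * 2^-1 ^+ n * expR (2 * k * `|s|)))).
    by rewrite ler_wpM2l ?(ltW k0)//; exact: IH.
  by rewrite exprS le_eqVlt; apply/orP; left; apply/eqP; field.
by rewrite ler_wpM2l ?gerBl// mulr_ge0// exprn_ge0.
Qed.

(** The sum of the bounds of [picard_step]; with the difference 2^-n - 2^-(n+j) kept exact, the
    induction on j closes by an equality. *)
Lemma picard_tail x n j (t : R) : -1 < t -> `|picard x (n + j) t - picard x n t| <=
  2 * `|x| * expR (2 * k * `|t|) * (2^-1 ^+ n - 2^-1 ^+ (n + j)).
Proof.
move=> t1; elim: j => [|j IH]; first by rewrite addn0 !subrr normr0 mulr0.
rewrite -(subrKA (picard x (n + j) t)) (le_trans (ler_normD _ _))// addnS.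
apply: le_trans (lerD (picard_step _ _ t1) IH) _.
by rewrite exprS le_eqVlt; apply/orP; left; apply/eqP; field.
Qed.

Lemma picard_is_cvg x (t : R) : -1 < t -> cvgn (fun n => picard x n t).
Proof.
move=> t1; have : cvgn (series (telescope (fun n => picard x n t))).
  apply: normed_cvg.
  apply: (@series_le_cvg _ _ (geometric (`|x| * expR (2 * k * `|t|)) 2^-1)).
  - by move=> n; exact: normr_ge0.
  - by move=> n; rewrite /= mulr_ge0// ?mulr_ge0// ?exprn_ge0// expR_ge0.
  - by move=> n; rewrite /= mulrAC; exact: picard_step.
  - by apply: is_cvg_geometric_series; rewrite ger0_norm; lra.
rewrite telescopeK => /cvg_ex[l cl]; apply/cvg_ex; exists (l + x).
rewrite (_ : (fun n => _) = (fun n => (picard x n t - picard x 0 t) + x)).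
  exact: (cvgD cl (cvg_cst x)).
by apply/funext => n; rewrite subrK.
Qed.

Definition picard_lim x (t : R) : R := limn (fun n => picard x n t).

Lemma picard_lim_bound x n (t : R) : -1 < t ->
  `|picard_lim x t - picard x n t| <= 2 * `|x| * expR (2 * k * `|t|) * 2^-1 ^+ n.
Proof.
move=> t1.
have c1 : `|picard x m t - picard x n t| @[m --> \oo] --> `|picard_lim x t - picard x n t|.
  apply: cvg_norm; apply: cvgB; last exact: cvg_cst.
  exact: picard_is_cvg.
apply: (ler_cvg_to c1 (cvg_cst _)); near=> m.
have nm : (n <= m)%N by near: m; exact: nbhs_infty_ge.
rewrite -(subnKC nm); apply: le_trans (picard_tail _ _ _ t1) _.
by rewrite ler_wpM2l ?gerBl ?exprn_ge0// mulr_ge0 ?expR_ge0// mulr_ge0.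
Unshelve. all: by end_near. Qed.

(** The limit is controlled for t > -1 only, whereas [primitiveP] takes a function continuous on the
    whole line. Freezing it before time -1/2 stays away from the end -1. *)
Let W x (t : R) : R := picard_lim x (Num.max (- 2^-1) t).

Let max_gt (t : R) : -1 < Num.max (- 2^-1) t.
Proof. by rewrite lt_max; apply/orP; left; lra. Qed.

Let max_cont : continuous (fun t : R => Num.max (- 2^-1) t).
Proof.
by move=> x; apply: (@continuous_max _ _ (cst (- 2^-1)) id); [exact: cvg_cst|exact: cvg_id].
Qed.

Lemma picard_lim_continuous x : continuous (W x).
Proof.
move=> t0; apply/cvgrPdist_le => e e0.
(* A bound of the convergence rate that is uniform for |t - t0| < 1: frozen or not, the time has
   absolute value at most |t0| + 2. *)
pose C := 2 * `|x| * expR (2 * k * (`|t0| + 2)).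
have C0 : 0 <= C by rewrite /C mulr_ge0 ?expR_ge0// mulr_ge0.
have [n nC] : exists n, C * 2^-1 ^+ n <= e / 3.
  have c0 : C * 2^-1 ^+ n @[n --> \oo] --> (0 : R).
    by apply: cvg_geometric; rewrite ger0_norm; lra.
  have e3 : 0 < e / 3 by rewrite divr_gt0.
  have [N _ HN] := (cvgr_le 0 c0 _ e3); exists N; exact: (HN N (leqnn N)).
have B t : `|t0 - t| < 1 -> `|W x t - picard x n (Num.max (- 2^-1) t)| <= e / 3.
  move=> t01; apply: le_trans (picard_lim_bound _ _ (max_gt t)) _.
  apply: le_trans nC; rewrite ler_wpM2r ?exprn_ge0// ler_wpM2l ?mulr_ge0// ler_expR.
  rewrite ler_wpM2l ?mulr_ge0 ?(ltW k0)//.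
  have h1 := ler_norm t0; have := ler_norm (- t0); rewrite normrN => h2.
  move: t01; rewrite ltr_norml => /andP[h3 h4].
  by rewrite ler_norml; case: (leP (- 2^-1) t) => ?; apply/andP; split; lra.
have cn : {for t0, continuous (fun t : R => picard x n (Num.max (- 2^-1) t))}.
  apply: (@continuous_comp _ _ _ (fun t : R => Num.max (- 2^-1) t) (picard x n)).
    exact: max_cont.
  exact: picard_continuous.
have e3 : 0 < e / 3 by rewrite divr_gt0.
have N1 := (cvgrPdist_le _ _).1 cn _ e3.
have N2 : \forall t \near t0, `|t0 - t| < 1.
  by apply/nbhs_ballP; exists 1 => //=.
near=> t.
have b0 : `|W x t0 - picard x n (Num.max (- 2^-1) t0)| <= e / 3 by apply: B; rewrite subrr normr0.
have b1 : `|W x t - picard x n (Num.max (- 2^-1) t)| <= e / 3 by apply: B; near: t.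
have b2 : `|picard x n (Num.max (- 2^-1) t0) - picard x n (Num.max (- 2^-1) t)| <= e / 3 by near: t; exact: N1.
move: b0 b1 b2; rewrite !ler_norml => /andP[? ?] /andP[? ?] /andP[? ?].
by apply/andP; split; lra.
Unshelve. all: by end_near. Qed.

(** Z is x plus the primitive of p along the limit W. In place of an exchange of limit and integral,
    Z and W are both compared with the iterate n + 1: they differ by a multiple of 2^-n for every n,
    hence agree after -1/2, and Z solves the equation. *)
Lemma picard_solution x : exists Z : R -> R, Z 0 = x /\ forall t : R, - 2^-1 < t ->
  is_derive t 1 Z (p t (Z t)) /\ `|Z t| <= 3 * `|x| * expR (2 * k * `|t|).
Proof.
have cW := continuous_along (@picard_lim_continuous x).
have [_ P0 PD] := primitiveP cW.
pose Z t := x + primitive (fun s => p s (W x s)) t.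
have ZD (t : R) : -1 < t -> is_derive t 1 Z (p t (W x t)).
  by move=> /PD; exact: is_derive_shiftD.
have Z0 : Z 0 = x by rewrite /Z P0 addr0.
have c0 : 0 < 2 * k by rewrite mulr_gt0.
have WE (t : R) : - 2^-1 < t -> W x t = picard_lim x t by move=> t1; rewrite /W (max_idPr _)// ltW.
have ZW (t : R) : - 2^-1 < t -> Z t = W x t.
  move=> t1; apply/eqP; rewrite -subr_eq0; apply/eqP.
  apply: (@eq0_geometric R _ (2 * `|x| * expR (2 * k * `|t|))) => n.
  have D (s : R) : - 2^-1 < s -> is_derive s 1 (fun t => Z t - picard x n.+1 t)
      (p s (W x s) - p s (picard x n s)).
    by move=> s1; apply: is_deriveB; [apply: ZD|apply: picard_derive]; lra.
  have h12 : - 2^-1 < 0 :> R by lra.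
  have := @le_exp_growth R _ _ (`|x| * 2^-1 ^+ n) (2 * k) (- 2^-1) t c0 h12 t1 D.
  rewrite Z0 picard0 subrr subr0 => H.
  have {}H : `|Z t - picard x n.+1 t| <= `|x| * 2^-1 ^+ n * (expR (2 * k * `|t|) - 1).
    apply: H => s s1; apply: le_trans (plip _ _ _) _.
    have s2 : -1 < s by lra.
    rewrite WE//; have := picard_lim_bound x n s2 => h.
    apply: (le_trans (ler_wpM2l (ltW k0) h)).
    by rewrite le_eqVlt; apply/orP; left; apply/eqP; ring.
  have t2 : -1 < t by lra.
  have := picard_lim_bound x n.+1 t2; rewrite -WE// => H'.
  rewrite -(subrKA (picard x n.+1 t)) (le_trans (ler_normD _ _))//.
  rewrite distrC in H'; apply: le_trans (lerD H H') _; rewrite exprS.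
  have q0 : 0 <= `|x| * 2^-1 ^+ n by rewrite mulr_ge0// exprn_ge0.
  rewrite -subr_ge0 (_ : _ - _ = `|x| * 2^-1 ^+ n)//; by field.
exists Z; split => // t t1; split.
  by rewrite ZW//; apply: ZD; lra.
have t2 : -1 < t by lra.
(* The factor 3: the limit is within 2 |x| exp(2 k |t|) of the constant iterate x, and |x| itself is
   added. *)
rewrite ZW// WE//; have := picard_lim_bound x 0 t2; rewrite expr0 mulr1 /= => H.
rewrite -[picard_lim x t](subrK x) (le_trans (ler_normD _ _))//.
have e1 : 1 <= expR (2 * k * `|t|) by rewrite -[leLHS]expR0 ler_expR mulr_ge0// ltW.
have := ler_wpM2l (normr_ge0 x) e1; rewrite mulr1 => H1.
by rewrite (le_trans (lerD H H1))// le_eqVlt; apply/orP; left; apply/eqP; ring.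
Qed.

End Picard.

(** * Derivative of the flow at the zero solution *)

Section Flow.
Context {R : realType}.

Lemma lipschitz_derive (f df : R -> R) (a b K y y' : R) :
  (forall t, a <= t <= b -> is_derive t 1 f (df t)) ->
  (forall t, a <= t <= b -> `|df t| <= K) ->
  a <= y <= b -> a <= y' <= b -> `|f y - f y'| <= K * `|y - y'|.
Proof.
move=> hf hK; wlog yy : y y' / y' <= y => [H yab y'ab|].
  have [yy|/ltW yy] := leP y' y; first exact: H.
  by rewrite distrC [X in _ <= _ * X]distrC; exact: H.
move=> /andP[ay yb] /andP[ay' y'b].
have [|t tyy ->] := @mean_value R f df y' y yy.
  by move=> t /andP[t1 t2]; apply: hf; lra.
rewrite normrM ler_wpM2r//; apply: hK.
by case/andP: tyy => t1 t2; lra.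
Qed.

Lemma continuous_bounded (f : R -> R) (a b : R) : a <= b ->
  (forall t, a <= t <= b -> {for t, continuous f}) ->
  exists2 M : R, 0 < M & forall t, a <= t <= b -> `|f t| <= M.
Proof.
move=> ab cf.
have [|c cab H] := @EVT_max R (fun t => `|f t|) a b ab.
  apply: continuous_in_subspaceT => t; rewrite inE /= in_itv /= => tab.
  by apply: continuous_comp; [exact: cf|exact: norm_continuous].
exists (`|f c| + 1); first by rewrite ltr_wpDl.
by move=> t tab; apply: le_trans (H t _) _; rewrite ?in_itv// lerDl.
Qed.

Lemma is_derive_at0 (f : R -> R) (d : R) : f 0 = 0 ->
  (forall e : R, 0 < e -> \forall x \near (0 : R), `|f x - d * x| <= e * `|x|) ->
  is_derive (0 : R) 1 f d.
Proof.
move=> f0 H.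
have c : h^-1 *: ((f \o shift 0) (h *: 1) - f 0) @[h --> 0^'] --> d.
  apply/cvgrPdist_le => e e0; have := H _ e0; move=> Hn.
  near=> h; have h0 : h != 0 by near: h; exact: nbhs_dnbhs_neq.
  rewrite /= f0 subr0 addr0 [h *: 1]mulr1 /GRing.scale /= distrC.
  have -> : h^-1 * f h - d = h^-1 * (f h - d * h) by field.
  rewrite normrM normfV ler_pdivrMl ?normr_gt0// [leRHS]mulrC.
  by near: h; exact: (nbhs_dnbhs Hn).
split; first by apply/cvg_ex; exists d.
exact: cvg_lim c.
Unshelve. all: by end_near. Qed.

Variables (U : set (R * R)) (p : R * R -> R) (L : R) (Theta : R -> R).
Hypotheses (oU : open U) (U0 : forall s, U (s, 0)) (cp : classC 1 U p).
Hypotheses (p0 : forall s, p (s, 0) = 0) (L0 : 0 < L).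
Hypothesis dTheta : forall s : R, -1 < s -> is_derive s 1 Theta (pd_v p (s, 0)).

Let cpv z : U z -> {for z, continuous (pd_v p)}.
Proof. exact: classC_continuous (classC_pd_v cp). Qed.

Let slope_continuous (s : R) : {for s, continuous (fun s => pd_v p (s, 0))}.
Proof.
apply: (@continuous_comp _ _ _ (fun s => (s, 0)) (pd_v p)); last exact: cpv.
exact: (cvg_pair cvg_id (cvg_cst _)).
Qed.

Let slice_derive s v : U (s, v) -> is_derive v 1 (fun v => p (s, v)) (pd_v p (s, v)).
Proof. by move=> Usv; apply: is_derive_slice_v; exact: classC_differentiable cp Usv. Qed.

(** In a thin tube p_v is uniformly within e of its value on the axis, so the difference between p
    and its linear part is e-Lipschitz in v and vanishes at v = 0. *)
Lemma linear_slope (e : R) : 0 < e -> exists2 rho : R, 0 < rho &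
  forall s v, 0 <= s <= L -> `|v| <= rho -> `|p (s, v) - pd_v p (s, 0) * v| <= e * `|v|.
Proof.
move=> e0.
have [|rho rho0 H] := @tube R 0 L (fun z => U z /\ `|pd_v p z - pd_v p (z.1, 0)| <= e).
  move=> s _; apply: filterI; first by apply: open_nbhs_nbhs; split.
  have e2 : 0 < e / 2 by rewrite divr_gt0.
  have N1 := (cvgrPdist_le _ _).1 (cpv (U0 s)) _ e2.
  have c1 : {for (s, 0), continuous (fun z : R * R => pd_v p (z.1, 0))}.
    apply: (@continuous_comp _ _ _ fst (fun s => pd_v p (s, 0))); first exact: cvg_fst.
    exact: slope_continuous.
  have N2 := (cvgrPdist_le _ _).1 c1 _ e2.
  apply: filterS2 (N1 _) (N2 _) => z /=.
  by move: (pd_v p z) (pd_v p (z.1, 0)) (pd_v p (s, 0)) => x y t;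
    rewrite !ler_norml => /andP[? ?] /andP[? ?]; apply/andP; split; lra.
exists rho => // s v sL vrho.
have hd t : - rho <= t <= rho -> is_derive t 1 (fun v => p (s, v) - pd_v p (s, 0) * v)
    (pd_v p (s, t) - pd_v p (s, 0)).
  rewrite -ler_norml => /(H _ _ sL)[Ut _]; apply: is_deriveB; first exact: slice_derive.
  by apply: is_derive_eq; rewrite [_ *: _]mulr1.
have hb t : - rho <= t <= rho -> `|pd_v p (s, t) - pd_v p (s, 0)| <= e.
  by rewrite -ler_norml => /(H _ _ sL)[].
have := @lipschitz_derive _ _ (- rho) rho e v 0 hd hb.
rewrite p0 mulr0 !subr0; apply; first by rewrite -ler_norml.
by rewrite -ler_norml normr0 ltW.
Qed.

(** All solutions start close to the zero solution and remain within C |x| of it; there p differs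
    from its linear part by a small multiple of |x|, and the linearized flow exp(Theta) is the
    derivative in the initial value. *)
Lemma flow_near_zero : exists v : R -> R -> R, [/\ v 0 L = 0,
  (forall r : R, 0 < r -> \forall x \near (0 : R), v x 0 = x /\
     forall t : R, - 2^-1 < t < L + 2^-1 ->
       [/\ `|v x t| < r, U (t, v x t) & is_derive t 1 (v x) (p (t, v x t))]) &
  is_derive (0 : R) 1 (v ^~ L) (expR (Theta L - Theta 0))].
Proof.
have L0' := L0.
have L1 : (-1 : R) <= L + 1 by lra.
have [|k0 k00 Hk0] := @continuous_bounded (fun s => pd_v p (s, 0)) _ _ L1.
  by move=> t _; exact: slope_continuous.
(* The slack 1 lets the bound of p_v on the axis persist in a tube around it. *)
pose k := k0 + 1; have kp : 0 < k by rewrite addr_gt0.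
have [|rho rho0 H] := @tube R (-1) (L + 1) (fun z => U z /\ `|pd_v p z| <= k).
  move=> s sL; apply: filterI; first by apply: open_nbhs_nbhs; split.
  have cn : {for (s, 0), continuous (fun z => `|pd_v p z|)}.
    by apply: continuous_comp; [exact: cpv|exact: norm_continuous].
  apply: (cvgr_le _ cn); rewrite /k; apply: le_lt_trans (Hk0 _ sL) _.
  by rewrite ltrDl.
(* Clamping makes p globally Lipschitz and leaves it unchanged near v = 0. *)
pose q t v := p (clamp (-1) (L + 1) t, clamp (- rho) rho v).
have rr : - rho <= rho by lra.
have cl t := clamp_itv t L1; have cr v := clamp_itv v rr.
have qc : continuous (fun z : R * R => q z.1 z.2).
  move=> z.
  apply: (@continuous_comp _ _ _ (fun z : R * R => (clamp (-1) (L + 1) z.1, clamp (- rho) rho z.2)) p).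
    by apply: (cvg_pair (G := nbhs _) (H := nbhs _));
     [apply: (@continuous_comp _ _ _ fst (clamp (-1) (L + 1)));
        [exact: cvg_fst|exact: clamp_continuous]
     |apply: (@continuous_comp _ _ _ snd (clamp (- rho) rho));
        [exact: cvg_snd|exact: clamp_continuous]].
  by apply: (classC_continuous cp); have [|//] := H _ (clamp (- rho) rho z.2) (cl z.1); rewrite ler_norml.
have qlip t v v' : `|q t v - q t v'| <= k * `|v - v'|.
  apply: (@le_trans _ _ (k * `|clamp (- rho) rho v - clamp (- rho) rho v'|)).
    apply: (@lipschitz_derive (fun v => p (clamp (-1) (L + 1) t, v)) (fun v => pd_v p (clamp (-1) (L + 1) t, v)) (- rho) rho) => //.
      move=> y; rewrite -ler_norml => /(H _ _ (cl t))[Uy _]; exact: slice_derive.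
    by move=> y; rewrite -ler_norml => /(H _ _ (cl t))[].
  by rewrite ler_wpM2l ?(ltW kp)//; exact: clamp_lipschitz.
have q0 t : q t 0 = 0.
  by rewrite /q (@clamp_id _ (- rho) rho 0) ?p0//; lra.
have S x := cid (picard_solution kp qc qlip q0 x).
pose v x := projT1 (S x).
have v0 x : v x 0 = x by have [] := projT2 (S x).
have vD (x t : R) : - 2^-1 < t -> is_derive t 1 (v x) (q t (v x t)).
  by move=> t1; have [_ /(_ t t1)[]] := projT2 (S x).
pose C := 3 * expR (2 * k * (L + 1)).
have C0 : 0 < C by rewrite mulr_gt0// expR_gt0.
have vB (x t : R) : - 2^-1 < t < L + 2^-1 -> `|v x t| <= C * `|x|.
  move=> /andP[t1 t2]; have [_ /(_ t t1)[_ h]] := projT2 (S x).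
  apply: le_trans h _; rewrite /C mulrAC ler_wpM2r// ler_wpM2l// ler_expR.
  rewrite ler_wpM2l ?mulr_ge0 ?(ltW kp)//.
  by rewrite ler_norml; apply/andP; split; lra.
have small r : 0 < r -> \forall x \near (0 : R), C * `|x| < r.
  move=> r0; have cn : {for 0, continuous (fun x : R => C * `|x|)}.
    by apply: cvgM; [exact: cvg_cst|exact: norm_continuous].
  by apply: (cvgr_lt _ cn); rewrite normr0 mulr0.
have qp (x t : R) : C * `|x| < rho -> - 2^-1 < t < L + 2^-1 -> q t (v x t) = p (t, v x t).
  move=> xr tL; have := vB x _ tL; case/andP: tL => t1 t2 h.
  rewrite /q !clamp_id//; last by lra.
  by rewrite -ler_norml; apply: le_trans h (ltW xr).
exists v; split.
- have LL : - 2^-1 < L < L + 2^-1 by lra.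
  by have := vB 0 L LL; rewrite normr0 mulr0 normr_le0 => /eqP.
- move=> r r0; have mr : 0 < Num.min r rho by rewrite lt_min r0.
  apply: filterS (small _ mr) => x; rewrite lt_min => /andP[xr xrho]; split; first exact: v0.
  move=> t tL; have h := vB x _ tL; split.
  + exact: le_lt_trans h xr.
  + have [||] := H t (v x t) => //; first by lra.
    exact: le_trans h (ltW xrho).
  + by rewrite -qp//; apply: vD; case/andP: tL.
have L00 : 0 <= L by exact: ltW.
have [|M M0 HM] := @continuous_bounded (fun t => expR (- Theta t)) 0 L L00.
  move=> t /andP[t0 _]; apply: (@continuous_comp _ _ _ (fun t => - Theta t) expR).
    by apply: continuousN; apply: is_derive_continuous (dTheta _); lra.
  exact: continuous_expR.
apply: is_derive_at0.
  have LL : - 2^-1 < L < L + 2^-1 by lra.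
  by have := vB 0 L LL; rewrite normr0 mulr0 normr_le0 => /eqP.
move=> e e0.
(* The product of the constants met below, so that the accuracy e / c for the slope yields exactly
   the final error e |x|. *)
pose c := expR (Theta L) * M * C * L.
have c0 : 0 < c by rewrite /c !mulr_gt0// expR_gt0.
have ec0 : 0 < e / c by rewrite divr_gt0.
have [r r0 Hr] := linear_slope ec0.
have mr : 0 < Num.min r rho by rewrite lt_min r0.
apply: filterS (small _ mr) => x; rewrite lt_min => /andP[xr xrho].
have tI t : 0 <= t <= L -> - 2^-1 < t < L + 2^-1 by move=> /andP[? ?]; lra.
(* u is constant for the linearized equation. *)
pose u t := v x t * expR (- Theta t).
pose du t := (p (t, v x t) - pd_v p (t, 0) * v x t) * expR (- Theta t).
have uD t : 0 <= t <= L -> is_derive t 1 u (du t).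
  move=> tL; have t1 : - 2^-1 < t by case/andP: tL => ? ?; lra.
  have t2 : -1 < t by lra.
  have h1 := vD x t t1; rewrite qp ?tI// in h1.
  have h2 := @is_derive1_comp R expR (- Theta) t _ _ (is_derive_expR _) (is_deriveN (dTheta t2)).
  apply: (is_derive_eq (is_deriveM h1 h2)).
  apply: etrans (_ : v x t * (expR (- Theta t) * - pd_v p (t, 0)) +
    expR (- Theta t) * p (t, v x t) = _) => //.
  by rewrite /du; ring.
have uB t : 0 <= t <= L -> `|du t| <= e / c * (C * `|x|) * M.
  move=> tL; rewrite /du normrM.
  have h := vB x t (tI _ tL).
  apply: ler_pM => //; last exact: HM.
  apply: le_trans (Hr _ _ tL _) _; first exact: le_trans h (ltW xr).
  by rewrite ler_wpM2l// ltW.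
have lD (K : R) t : 0 <= t <= L -> is_derive t 1 (fun t => K * t) K.
  by move=> _; apply: is_derive_eq; rewrite [_ *: _]mulr1.
have := le_growth L00 uD (lD (e / c * (C * `|x|) * M)) uB.
rewrite mulr0 subr0 /u v0 => h.
have -> : v x L - expR (Theta L - Theta 0) * x =
    expR (Theta L) * (v x L * expR (- Theta L) - x * expR (- Theta 0)).
  have E : expR (Theta L) * expR (- Theta L) = 1 by rewrite -expRD subrr expR0.
  by rewrite expRD mulrBr [X in _ = X - _]mulrCA E; ring.
rewrite normrM gtr0_norm ?expR_gt0//.
apply: le_trans (ler_wpM2l (expR_ge0 _) h) _.
rewrite le_eqVlt; apply/orP; left; apply/eqP; rewrite /c.
by field; rewrite !gt_eqF// ?expR_gt0.
Qed.

End Flow.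

(** * The slope of the mean curvature lines *)

Section QuotientRule.
Context {R : realType} {V : normedModType R}.
Implicit Types f g : V -> R.

Lemma is_derive_inv f z w df : is_derive z w f df -> f z != 0 ->
  is_derive z w (fun x => (f x)^-1) (- (f z)^-1 ^+ 2 * df).
Proof.
move=> [dxf <-] f0; split; first exact: derivableV.
by rewrite deriveV// exprVn.
Qed.

Lemma is_derive_div f g z w df dg : is_derive z w f df -> is_derive z w g dg ->
  g z != 0 ->
  is_derive z w (fun x => f x / g x) ((df * g z - f z * dg) / g z ^+ 2).
Proof.
move=> hf hg g0; apply: (is_derive_eq (is_deriveM hf (is_derive_inv hg g0))).
by rewrite /GRing.scale /=; field.
Qed.

End QuotientRule.

Section CurvatureDerivative.
Context {R : realType} {V : normedModType R}.
Variables (E F G e f g : V -> R) (z w : V) (E' F' G' e' f' g' : R).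
Hypotheses (dE : is_derive z w E E') (dF : is_derive z w F F').
Hypotheses (dG : is_derive z w G G') (de : is_derive z w e e').
Hypotheses (df : is_derive z w f f') (dg : is_derive z w g g').
Hypotheses (Ez : E z = 1) (Fz : F z = 0) (Gz : G z = 1).

(** [dH] and [dK] are the derivatives of H and K at a point where E = G = 1 and F = 0; there E' + G'
    is the derivative of E G - F^2. *)
Definition dH (e g E' F' G' e' g' f : R) :=
  ((e' + e * G' - 2 * f * F' + g' + g * E') - (e + g) * (E' + G')) / 2.
Definition dK (e g E' G' e' f' g' f : R) :=
  (e' * g + e * g' - 2 * f * f') - (e * g - f ^+ 2) * (E' + G').

Let D x := E x * G x - F x ^+ 2.

Let Dz : D z = 1. Proof. by rewrite /D Ez Fz Gz; ring. Qed.

Let dD : is_derive z w D (E' + G').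
Proof.
have -> : D = (fun x => E x * G x - F x * F x) by apply/funext => x; rewrite /D expr2.
apply: (is_derive_eq (is_deriveB (is_deriveM dE dG) (is_deriveM dF dF))).
by rewrite /GRing.scale /= Ez Fz Gz; ring.
Qed.

Lemma is_derive_mean : is_derive z w
  (fun x => (e x * G x - 2 * f x * F x + g x * E x) / (2 * D x))
  (dH (e z) (g z) E' F' G' e' g' (f z)).
Proof.
have h1 := is_deriveD (is_deriveB (is_deriveM de dG)
  (is_deriveM (is_deriveM (is_derive_cst (2 : R) z w) df) dF)) (is_deriveM dg dE).
have h2 := is_deriveM (is_derive_cst (2 : R) z w) dD.
have D2 : (cst 2 * D) z != 0.
  by have -> : (cst 2 * D) z = 2 * D z by []; rewrite Dz mulr1 pnatr_eq0.
apply: (is_derive_eq (is_derive_div h1 h2 D2)).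
by rewrite !fctE /GRing.scale /= Dz Ez Fz Gz /dH; field.
Qed.

Lemma is_derive_gauss : is_derive z w (fun x => (e x * g x - f x ^+ 2) / D x)
  (dK (e z) (g z) E' G' e' f' g' (f z)).
Proof.
have -> : (fun x => (e x * g x - f x ^+ 2) / D x) = (fun x => (e x * g x - f x * f x) / D x).
  by apply/funext => x; rewrite expr2.
have h1 := is_deriveB (is_deriveM de dg) (is_deriveM df df).
have D0 : D z != 0 by rewrite Dz.
apply: (is_derive_eq (is_derive_div h1 dD D0)).
by rewrite !fctE /GRing.scale /= Dz /dK; field.
Qed.

End CurvatureDerivative.

Section Slope.
Context {R : realType}.
Variable m : R -> R -> R.
Hypothesis hm : mean_curvature_function m.
Implicit Types (X : R * R -> 'rV[R]_3) (z w : R * R) (U : set (R * R)).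

Definition curv_M X z := m (coef_H X z) (coef_K X z).
Definition shift_e X z := coef_e X z - curv_M X z * coef_E X z.
Definition shift_f X z := coef_f X z - curv_M X z * coef_F X z.
Definition shift_g X z := coef_g X z - curv_M X z * coef_G X z.
Definition disc X z := shift_f X z ^+ 2 - shift_e X z * shift_g X z.

(* The lines (ds, dv) = (1, p) satisfy e~ + 2 f~ p + g~ p^2 = 0 with e~ = e - M E,
   f~ = f - M F, g~ = g - M G; this is the root which vanishes with e~. *)
Definition slope X z :=
  - shift_e X z / (shift_f X z + Num.sqrt (disc X z)).

(** The first two conditions put (H, K) where [m] is C^1; the third makes M differ from both
    principal curvatures and the square root smooth; the last keeps the denominator of [slope]
    positive. On c it says that tau_g > 0. *)
Definition transverse X z := [/\ 0 < coef_K X z, coef_K X z < coef_H X z ^+ 2,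
  0 < disc X z & 0 < shift_f X z].

Lemma curv_ME X z : regular_at X z -> mean_of m X z = curv_M X z.
Proof. by move=> rX; rewrite /mean_of meanHE// gaussKE. Qed.

(** - [disc] is the determinant of II - M I, that is the characteristic polynomial of II relative to
    I at M, times det I. *)
Lemma disc_curvatures X z : regular_at X z -> disc X z =
  area2 X z * ((kappa2 X z - curv_M X z) * (curv_M X z - kappa1 X z)).
Proof.
move=> rX; have a0 := lt0r_neq0 (area2_gt0 rX).
rewrite kappa1E// kappa2E//.
have := sqr_sqrtr (coef_HK_ge0 rX).
move: (Num.sqrt _) => s sE.
have -> : (coef_H X z + s - curv_M X z) * (curv_M X z - (coef_H X z - s)) =
   s ^+ 2 - (coef_H X z - curv_M X z) ^+ 2 by ring.
rewrite sE /disc /shift_e /shift_f /shift_g /coef_H /coef_K.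
move: a0; rewrite /area2; move: (curv_M X z) (coef_E X z) (coef_F X z) (coef_G X z)
  (coef_e X z) (coef_f X z) (coef_g X z) => M E F G e f g a0.
by field.
Qed.

(** The equality b + c p = sqrt D serves the torsion: its positive sign is what attaches this root
    to the maximal foliation. *)
Lemma quadratic_root (a b c D : R) : 0 < D -> 0 < b -> D = b ^+ 2 - a * c ->
  let p := - a / (b + Num.sqrt D) in
  a + 2 * b * p + c * p ^+ 2 = 0 /\ b + c * p = Num.sqrt D.
Proof.
move=> D0 b0 DE p; have s0 : 0 < Num.sqrt D by rewrite sqrtr_gt0.
have bs : b + Num.sqrt D != 0 by rewrite gt_eqF// addr_gt0.
have := sqr_sqrtr (ltW D0); move: (Num.sqrt D) @p s0 bs => s p s0 bs sE.
have ac : a * c = b ^+ 2 - s ^+ 2 by rewrite sE DE; ring.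
have h : b + c * p = s.
  have -> : b + c * p = (b * (b + s) - a * c) / (b + s) by rewrite /p; field.
  by rewrite ac; field.
split => //.
have -> : a + 2 * b * p + c * p ^+ 2 = a + p * (b + (b + c * p)) by ring.
by rewrite h /p; field.
Qed.

(* With e~ + f~ p = - p (f~ + g~ p), the numerator of the torsion of (1, p)
   factors as (f~ + g~ p) I(1, p). *)
Lemma torsion_root (E F G e f g M p s r : R) : 0 < r -> 0 < E + 2 * F * p + G * p ^+ 2 ->
  (e - M * E) + 2 * (f - M * F) * p + (g - M * G) * p ^+ 2 = 0 ->
  (f - M * F) + (g - M * G) * p = s ->
  ((E * f - F * e) * 1 ^+ 2 + (E * g - G * e) * 1 * p + (F * g - G * f) * p ^+ 2)
    / (r * (E * 1 ^+ 2 + 2 * F * 1 * p + G * p ^+ 2)) = s / r.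
Proof.
move=> r0 I0 q0 sE.
have -> : E * 1 ^+ 2 + 2 * F * 1 * p + G * p ^+ 2 = E + 2 * F * p + G * p ^+ 2 by ring.
have -> : (E * f - F * e) * 1 ^+ 2 + (E * g - G * e) * 1 * p + (F * g - G * f) * p ^+ 2
  = ((f - M * F) + (g - M * G) * p) * (E + 2 * F * p + G * p ^+ 2)
    - (F + G * p) * ((e - M * E) + 2 * (f - M * F) * p + (g - M * G) * p ^+ 2) by ring.
by rewrite q0 sE mulr0 subr0; field; rewrite !gt_eqF.
Qed.

Lemma slope_line U X z : open U -> classC 2 U X -> (forall z, U z -> regular_at X z) ->
  U z -> transverse X z ->
  [/\ 0 < gaussK X z, kappa1 X z < kappa2 X z,
      normal_curv X z (1, slope X z) = mean_of m X z &
      geod_torsion X z (1, slope X z) =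
        Num.sqrt ((kappa2 X z - mean_of m X z) * (mean_of m X z - kappa1 X z))].
Proof.
move=> oU cX rX Uz [K0 KH D0 f0]; have rz := rX _ Uz.
have [q0 sE] := quadratic_root D0 f0 (erefl _); rewrite -/(slope X z) in q0 sE.
have I0 : 0 < form1 X z (1, slope X z).
  by apply: form1_gt0 => //; rewrite -pair_eqE /= oner_eq0.
have a0 := area2_gt0 rz.
split.
- by rewrite gaussKE.
- by rewrite kappa1E// kappa2E// ltrBlDr -addrA ltrDl -mulr2n mulrn_wgt0// sqrtr_gt0 subr_gt0.
- rewrite curv_ME//; apply/eqP; rewrite /normal_curv eq_sym -(can2_eq (mulfK (lt0r_neq0 I0)) (divfK (lt0r_neq0 I0))); apply/eqP.
  rewrite form2_coefE form_coefE /=; move: q0; rewrite /shift_e /shift_f /shift_g.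
  move: (slope X z) (curv_M X z) (coef_E X z) (coef_F X z) (coef_G X z)
    (coef_e X z) (coef_f X z) (coef_g X z) => p M E F G e f g q0.
  apply/eqP; rewrite -subr_eq0; apply/eqP; rewrite -[RHS]oppr0 -q0; ring.
- rewrite (geod_torsionE oU cX rX)// form_coefE /=.
  rewrite (@torsion_root (coef_E X z) (coef_F X z) (coef_G X z) (coef_e X z)
    (coef_f X z) (coef_g X z) (curv_M X z) (slope X z) (Num.sqrt (disc X z))) => //.
  + rewrite disc_curvatures// curv_ME// sqrtrM; last exact: ltW.
    by rewrite mulrC mulKf// gt_eqF// sqrtr_gt0.
  + by rewrite sqrtr_gt0.
  + have I1 (E F G p : R) : E * 1 ^+ 2 + 2 * F * 1 * p + G * p ^+ 2 =
        E + 2 * F * p + G * p ^+ 2 by ring.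
    by rewrite -I1; exact: I0.
Qed.

Section Smooth.
Variables (U : set (R * R)) (X : R * R -> 'rV[R]_3) (k : nat).
Hypotheses (oU : open U) (cX : classC k.+2 U X).
Hypothesis rX : forall z, U z -> regular_at X z.

Let cu : classC k.+1 U (pd_u X). Proof. exact: classC_pd_u cX. Qed.
Let cv : classC k.+1 U (pd_v X). Proof. exact: classC_pd_v cX. Qed.
Let cu' : classC k U (pd_u X). Proof. exact: classCS cu. Qed.
Let cv' : classC k U (pd_v X). Proof. exact: classCS cv. Qed.
Let cN : classC k U (unit_normal X).
Proof. exact: classCS (classC_normal oU cX rX). Qed.

Lemma classC_E : classC k U (coef_E X). Proof. exact: classC_dot. Qed.
Lemma classC_F : classC k U (coef_F X). Proof. exact: classC_dot. Qed.
Lemma classC_G : classC k U (coef_G X). Proof. exact: classC_dot. Qed.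

Lemma classC_e : classC k U (coef_e X).
Proof. exact: (classC_dot oU (classC_pd_u cu) cN). Qed.

Lemma classC_f : classC k U (coef_f X).
Proof. exact: (classC_dot oU (classC_pd_v cu) cN). Qed.

Lemma classC_g : classC k U (coef_g X).
Proof. exact: (classC_dot oU (classC_pd_v cv) cN). Qed.

Lemma classC_area2 : classC k U (area2 X).
Proof.
exact: (classCB oU (classCM oU classC_E classC_G) (classCX 2 oU classC_F)).
Qed.

Let area_neq0 z : U z -> area2 X z != 0.
Proof. by move=> /rX /area2_gt0 /lt0r_neq0. Qed.

Lemma classC_H : classC k U (coef_H X).
Proof.
apply: (classCM oU).
  apply: (classCD oU); last exact: (classCM oU classC_g classC_E).
  apply: (classCB oU (classCM oU classC_e classC_G)).
  apply: (classCM oU _ classC_F); apply: (classCM oU _ classC_f).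
  exact: classC_cst.
apply: classCV => // [z Uz|]; first by rewrite mulf_neq0 ?area_neq0.
by apply: (classCM oU _ classC_area2); exact: classC_cst.
Qed.

Lemma classC_K : classC k U (coef_K X).
Proof.
apply: (classCM oU).
  exact: (classCB oU (classCM oU classC_e classC_g) (classCX 2 oU classC_f)).
exact: (classCV oU area_neq0 classC_area2).
Qed.

End Smooth.

Section SlopeSmooth.
Variables (U : set (R * R)) (X : R * R -> 'rV[R]_3).
Hypotheses (oU : open U) (cX : classC 3 U X).
Hypothesis rX : forall z, U z -> regular_at X z.

(** [disc] and [shift_f] contain [curv_M], which is known to be smooth where (H, K) is in
    [elliptic]. So the transverse region is cut out in two stages: V first, then the signs of two
    functions continuous on V. *)
Let V := U `&` [set z | 0 < coef_K X z] `&` [set z | 0 < coef_H X z ^+ 2 - coef_K X z].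

Let oV1 : open (U `&` [set z | 0 < coef_K X z]).
Proof.
apply: open_gt0 => // z Uz; exact: classC_continuous (classC_K oU cX rX) Uz.
Qed.

Let cHK : classC 1 U (fun z => coef_H X z ^+ 2 - coef_K X z).
Proof.
exact: (classCB oU (classCX 2 oU (classC_H oU cX rX)) (classC_K oU cX rX)).
Qed.

Let oV : open V.
Proof.
apply: open_gt0 => // z [Uz _]; exact: classC_continuous cHK Uz.
Qed.

Let VU : V `<=` U. Proof. by move=> z [[]]. Qed.

Lemma classC_M : classC 1 V (curv_M X).
Proof.
apply: (@classC_comp R _ 1 elliptic V (fun z => m z.1 z.2)
  (fun z => (coef_H X z, coef_K X z))) => //.
- by move=> z [[_ a] b]; split => //=; rewrite -subr_gt0.
- exact: classC_mean.
- apply: classC_pair => //; apply: (classC_sub VU); first exact: classC_H.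
  exact: classC_K.
Qed.

Lemma classC_shift_e : classC 1 V (shift_e X).
Proof.
apply: (classCB oV (classC_sub VU (classC_e oU cX rX))).
exact: (classCM oV classC_M (classC_sub VU (classC_E oU cX))).
Qed.

Lemma classC_shift_f : classC 1 V (shift_f X).
Proof.
apply: (classCB oV (classC_sub VU (classC_f oU cX rX))).
exact: (classCM oV classC_M (classC_sub VU (classC_F oU cX))).
Qed.

Lemma classC_shift_g : classC 1 V (shift_g X).
Proof.
apply: (classCB oV (classC_sub VU (classC_g oU cX rX))).
exact: (classCM oV classC_M (classC_sub VU (classC_G oU cX))).
Qed.

Lemma classC_disc : classC 1 V (disc X).
Proof.
exact: (classCB oV (classCX 2 oV classC_shift_f) (classCM oV classC_shift_e classC_shift_g)).
Qed.

Let T := V `&` [set z | 0 < disc X z] `&` [set z | 0 < shift_f X z].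

Lemma open_transverse : open T.
Proof.
have o1 : open (V `&` [set z | 0 < disc X z]).
  by apply: open_gt0 => // z Vz; exact: classC_continuous classC_disc Vz.
apply: open_gt0 => // z [Vz _]; exact: classC_continuous classC_shift_f Vz.
Qed.

Lemma transverseE : T = U `&` [set z | transverse X z].
Proof.
apply/seteqP; split=> z.
  by move=> [[[[Uz K0] HK] D0] f0]; split => //; split => //; rewrite -subr_gt0.
by move=> [Uz [K0 HK D0 f0]]; rewrite /T /V /= subr_gt0.
Qed.

Let TV : T `<=` V. Proof. by move=> z [[]]. Qed.

(** The slope is [shift_e] times this C^1 factor; where [shift_e] vanishes, the derivative of the
    factor drops out of the product rule. *)
Lemma classC_slope_denominator :
  classC 1 T (fun z => - (shift_f X z + Num.sqrt (disc X z))^-1).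
Proof.
have oT := open_transverse.
apply: (classCN oT); apply: classCV => //.
  move=> z [[Vz D0] f0]; rewrite gt_eqF// ltr_wpDr// sqrtr_ge0//.
apply: (classCD oT (classC_sub TV classC_shift_f)).
by apply: classC_sqrt => //; [move=> z [[]]|exact: classC_sub TV classC_disc].
Qed.

Lemma slopeE z : slope X z = shift_e X z * - (shift_f X z + Num.sqrt (disc X z))^-1.
Proof. by rewrite /slope mulNr mulrN. Qed.

Lemma classC_slope : classC 1 T (slope X).
Proof.
have oT := open_transverse.
apply: (classC_congr oT _ (classCM oT (classC_sub TV classC_shift_e)
  classC_slope_denominator)) => z _.
by rewrite slopeE.
Qed.

End SlopeSmooth.

Section SlopeDerivative.
Variables (U : set (R * R)) (X : R * R -> 'rV[R]_3) (z : R * R).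
Hypotheses (oU : open U) (cX : classC 3 U X).
Hypothesis rX : forall z, U z -> regular_at X z.
Hypotheses (Uz : U z) (Ez : coef_E X z = 1) (Fz : coef_F X z = 0) (Gz : coef_G X z = 1).
Hypotheses (ez : coef_e X z = curv_M X z) (fz : 0 < coef_f X z).
Hypotheses (Kz : 0 < coef_K X z) (HKz : coef_K X z < coef_H X z ^+ 2).

Lemma core_shift : shift_e X z = 0 /\ shift_f X z = coef_f X z.
Proof. by rewrite /shift_e /shift_f Ez Fz ez mulr1 mulr0 subrr subr0. Qed.

Lemma core_disc : disc X z = coef_f X z ^+ 2.
Proof. by have [a b] := core_shift; rewrite /disc a b mul0r subr0. Qed.

Lemma core_transverse : transverse X z.
Proof.
split => //; first by rewrite core_disc exprn_gt0.
by have [_ ->] := core_shift.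
Qed.

Lemma core_slope : slope X z = 0.
Proof. by have [a _] := core_shift; rewrite /slope a oppr0 mul0r. Qed.

(** On the axis [shift_e] = 0 and the remaining factor is - 1 / (2 f), so p_v = - (e - M E)_v / (2
    f); M_v is expanded by the chain rule. *)
Lemma core_slope_derive :
  pd_v (slope X) z = - (2 * coef_f X z)^-1 *
    (pd_v (coef_e X) z
     - (dH (coef_e X z) (coef_g X z) (pd_v (coef_E X) z) (pd_v (coef_F X) z)
           (pd_v (coef_G X) z) (pd_v (coef_e X) z) (pd_v (coef_g X) z) (coef_f X z)
          * pd_u (fun z => m z.1 z.2) (coef_H X z, coef_K X z)
        + dK (coef_e X z) (coef_g X z) (pd_v (coef_E X) z)
           (pd_v (coef_G X) z) (pd_v (coef_e X) z) (pd_v (coef_f X) z)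
           (pd_v (coef_g X) z) (coef_f X z)
          * pd_v (fun z => m z.1 z.2) (coef_H X z, coef_K X z))
     - coef_e X z * pd_v (coef_E X) z).
Proof.
set w := ((0, 1) : R * R).
have D (f : R * R -> R) : classC 1 U f -> is_derive z w f (pd_v f z).
  by move=> cf; apply: derivableP; apply: diff_derivable; exact: classC_differentiable cf Uz.
have dE := D _ (classC_E oU cX); have dF := D _ (classC_F oU cX).
have dG := D _ (classC_G oU cX); have de := D _ (classC_e oU cX rX).
have df := D _ (classC_f oU cX rX); have dg := D _ (classC_g oU cX rX).
have dHz := D _ (classC_H oU cX rX); have dKz := D _ (classC_K oU cX rX).
have [_ HE] := is_derive_mean dE dF dG de df dg Ez Fz Gz.
have [_ KE] := is_derive_gauss dE dF dG de df dg Ez Fz Gz.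
have Vz : (U `&` [set z | 0 < coef_K X z] `&` [set z | 0 < coef_H X z ^+ 2 - coef_K X z]) z.
  by split => //=; rewrite subr_gt0.
have ME : pd_v (curv_M X) z = pd_v (coef_H X) z * pd_u (fun z => m z.1 z.2) (coef_H X z, coef_K X z)
   + pd_v (coef_K X) z * pd_v (fun z => m z.1 z.2) (coef_H X z, coef_K X z).
  have dm : differentiable (fun z : R * R => m z.1 z.2) (coef_H X z, coef_K X z).
    by apply: (classC_differentiable (classC_mean hm)).
  have dHK : differentiable (fun z => (coef_H X z, coef_K X z)) z.
    apply: differentiable_pair; [exact: classC_differentiable (classC_H oU cX rX) Uz|
      exact: classC_differentiable (classC_K oU cX rX) Uz].
  have := @derive_pair R _ _ (fun z : R * R => m z.1 z.2)
    (fun z => (coef_H X z, coef_K X z)) z w dm dHK.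
  rewrite -(derive_fst w dHK) -(derive_snd w dHK); exact.
have dM : is_derive z w (curv_M X) (pd_v (curv_M X) z).
  apply: derivableP; apply: diff_derivable.
  exact: classC_differentiable (classC_M oU cX rX) Vz.
have dse : is_derive z w (shift_e X) (pd_v (coef_e X) z - pd_v (curv_M X) z
    - coef_e X z * pd_v (coef_E X) z).
  apply: (is_derive_eq (is_deriveB de (is_deriveM dM dE))).
  by rewrite /GRing.scale /= Ez -ez; ring.
have Tz : (U `&` [set z | 0 < coef_K X z] `&` [set z | 0 < coef_H X z ^+ 2 - coef_K X z]
    `&` [set z | 0 < disc X z] `&` [set z | 0 < shift_f X z]) z.
  by have [_ _ d f] := core_transverse; split => //; split.
have cQ := classC_slope_denominator oU cX rX.
have dQ : is_derive z w (fun z => - (shift_f X z + Num.sqrt (disc X z))^-1)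
    (pd_v (fun z => - (shift_f X z + Num.sqrt (disc X z))^-1) z).
  by apply: derivableP; apply: diff_derivable; exact: classC_differentiable cQ Tz.
have -> : slope X = (fun z => shift_e X z * - (shift_f X z + Num.sqrt (disc X z))^-1).
  by apply/funext => y; exact: slopeE.
have [_ SE] := is_deriveM dse dQ; apply: etrans SE _.
have [s0 s1] := core_shift.
apply: etrans (_ : - (2 * coef_f X z)^-1 * (pd_v (coef_e X) z - pd_v (curv_M X) z -
  coef_e X z * pd_v (coef_E X) z) = _).
  rewrite s0 core_disc s1 sqrtr_sqr (gtr0_norm fz) scale0r add0r /GRing.scale /=.
  by congr (- _^-1 * _); exact: esym (mulr_natl _ 2).
by rewrite ME (HE : pd_v (coef_H X) z = _) (KE : pd_v (coef_K X) z = _).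
Qed.

End SlopeDerivative.

End Slope.

(** * Dependence of the fundamental forms on the jet of the patch *)

Section Jets.
Context {R : realType}.
Implicit Types (X : R * R -> 'rV[R]_3) (z w : R * R) (U : set (R * R)).

Lemma derive_dot (A B : R * R -> 'rV[R]_3) z w : differentiable A z -> differentiable B z ->
  'D_w (fun z => dot (A z) (B z)) z = dot (A z) ('D_w B z) + dot ('D_w A z) (B z).
Proof. exact: (derive_bilinear (B := @dot R) w (@continuous_dot R)). Qed.

Lemma derive_cross (A B : R * R -> 'rV[R]_3) z w : differentiable A z -> differentiable B z ->
  'D_w (fun z => cross (A z) (B z)) z = cross (A z) ('D_w B z) + cross ('D_w A z) (B z).
Proof. exact: (derive_bilinear (B := @cross R) w (@continuous_cross R)). Qed.

Lemma derive_scale {W : normedModType R} (a : R * R -> R) (B : R * R -> W) z w :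
  differentiable a z -> differentiable B z ->
  'D_w (fun z => a z *: B z) z = a z *: 'D_w B z + 'D_w a z *: B z.
Proof. exact: (derive_bilinear (B := scale_bilinear W) w (@continuous_scale R W)). Qed.

(** The derivative of n / |n| when n has velocity n'. Naming it as a function of n and n' shows that
    N_v depends on the 2-jet of the patch alone. *)
Definition normalize_derive (n n' : 'rV[R]_3) :=
  (Num.sqrt (dot n n))^-1 *: n' - ((Num.sqrt (dot n n))^-1 ^+ 3 * dot n n') *: n.

Lemma derive_normalize (A : R * R -> 'rV[R]_3) z w : differentiable A z -> A z != 0 ->
  'D_w (fun z => (Num.sqrt (dot (A z) (A z)))^-1 *: A z) z =
  normalize_derive (A z) ('D_w A z).
Proof.
move=> dA A0; have n0 := dot_gt0 A0.
have dd : differentiable (fun z => dot (A z) (A z)) z.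
  exact: (differentiable_bilinear (B := @dot R) (@continuous_dot R)).
have [ds dsE] := is_derive1_sqrt n0.
have dsq : differentiable (fun z => Num.sqrt (dot (A z) (A z))) z.
  exact: differentiable_sqrt.
have s0 : Num.sqrt (dot (A z) (A z)) != 0 by rewrite gt_eqF// sqrtr_gt0.
have dinv : differentiable (fun z => (Num.sqrt (dot (A z) (A z)))^-1) z.
  exact: differentiableV.
rewrite (derive_scale w dinv dA) (derive_inv _ dsq s0).
rewrite (derive_comp1 w ds dd) dsE (derive_dot w dA dA) /normalize_derive.
move: (A z) ('D_w A z) s0 => a a' s0; rewrite -[X in _ = _ + X]scaleNr [dot a' a]dotC.
move: (Num.sqrt (dot a a)) (dot a a') s0 => s t s0.
by congr (_ + _); congr (_ *: _); field.
Qed.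

(** N and N_v are the same for both patches, as they only read the 2-jet. Hence X_vvv is seen by one
    coefficient, g_v, through <X_vvv, N>. *)
Lemma coef_jet U X1 X2 z d : open U -> classC 3 U X1 -> classC 3 U X2 -> U z ->
  (forall z, U z -> regular_at X1 z) -> (forall z, U z -> regular_at X2 z) ->
  [/\ pd_u X1 z = pd_u X2 z, pd_v X1 z = pd_v X2 z,
      pd_u (pd_u X1) z = pd_u (pd_u X2) z, pd_v (pd_u X1) z = pd_v (pd_u X2) z &
      pd_v (pd_v X1) z = pd_v (pd_v X2) z] ->
  [/\ pd_v (pd_u (pd_u X2)) z = pd_v (pd_u (pd_u X1)) z,
      pd_v (pd_v (pd_u X2)) z = pd_v (pd_v (pd_u X1)) z &
      pd_v (pd_v (pd_v X2)) z = pd_v (pd_v (pd_v X1)) z + d] ->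
  [/\ pd_v (coef_E X2) z = pd_v (coef_E X1) z, pd_v (coef_F X2) z = pd_v (coef_F X1) z &
      pd_v (coef_G X2) z = pd_v (coef_G X1) z] /\
  [/\ pd_v (coef_e X2) z = pd_v (coef_e X1) z, pd_v (coef_f X2) z = pd_v (coef_f X1) z &
      pd_v (coef_g X2) z = pd_v (coef_g X1) z + dot d (unit_normal X1 z)].
Proof.
move=> oU c1 c2 Uz r1 r2 [eu ev euu euv evv] [euuv euvv evvv].
have Dd X : classC 3 U X -> [/\ differentiable (pd_u X) z, differentiable (pd_v X) z,
    differentiable (pd_u (pd_u X)) z, differentiable (pd_v (pd_u X)) z &
    differentiable (pd_v (pd_v X)) z].
  move=> cX; have cu := classC_pd_u cX; have cv := classC_pd_v cX.
  split; [exact: classC_differentiable cu Uz|exact: classC_differentiable cv Uz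
    |exact: classC_differentiable (classC_pd_u cu) Uz
    |exact: classC_differentiable (classC_pd_v cu) Uz
    |exact: classC_differentiable (classC_pd_v cv) Uz].
have Dn X : (forall z, U z -> regular_at X z) -> classC 3 U X ->
    differentiable (unit_normal X) z /\ pd_v (unit_normal X) z =
      normalize_derive (cross (pd_u X z) (pd_v X z))
        (cross (pd_u X z) (pd_v (pd_v X) z) + cross (pd_v (pd_u X) z) (pd_v X z)).
  move=> rX cX; have [du dv _ _ _] := Dd _ cX; split.
    exact: classC_differentiable (classC_normal oU cX rX) Uz.
  have dc : differentiable (fun z => cross (pd_u X z) (pd_v X z)) z.
    exact: (differentiable_bilinear (B := @cross R) (@continuous_cross R) du dv).
  rewrite -(derive_cross (0, 1) du dv).
  exact: (derive_normalize (0, 1) dc (rX _ Uz)).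
have [du1 dv1 duu1 duv1 dvv1] := Dd _ c1; have [du2 dv2 duu2 duv2 dvv2] := Dd _ c2.
have [dn1 n1E] := Dn _ r1 c1; have [dn2 n2E] := Dn _ r2 c2.
have nE : unit_normal X2 z = unit_normal X1 z.
  exact: (congr2 (fun a b => (Num.sqrt (dot (cross a b) (cross a b)))^-1 *: cross a b) (esym eu) (esym ev)).
have dnE : pd_v (unit_normal X2) z = pd_v (unit_normal X1) z.
  have G (a b c e a' b' c' e' : 'rV[R]_3) : a = a' -> b = b' -> c = c' -> e = e' ->
      normalize_derive (cross a b) (cross a e + cross c b) =
      normalize_derive (cross a' b') (cross a' e' + cross c' b').
    by move=> -> -> -> ->.
  exact: (etrans n2E (etrans (G _ _ _ _ _ _ _ _ (esym eu) (esym ev) (esym euv) (esym evv))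
    (esym n1E))).
have gen (A1 A2 B1 B2 : R * R -> 'rV[R]_3) e : differentiable A1 z -> differentiable A2 z ->
    differentiable B1 z -> differentiable B2 z -> A2 z = A1 z -> B2 z = B1 z ->
    pd_v A2 z = pd_v A1 z + e -> pd_v B2 z = pd_v B1 z ->
    pd_v (fun z => dot (A2 z) (B2 z)) z = pd_v (fun z => dot (A1 z) (B1 z)) z + dot e (B1 z).
  move=> dA1 dA2 dB1 dB2 hA hB hA' hB'.
  apply: etrans (derive_dot (0, 1) dA2 dB2) _.
  apply: etrans (congr1 (+%R^~ _) (esym (derive_dot (0, 1) dA1 dB1))).
  move: hA hB hA' hB'; rewrite /pd_v.
  move: (A1 z) (A2 z) (B1 z) (B2 z) ('D_(0, 1) A1 z) ('D_(0, 1) A2 z) ('D_(0, 1) B1 z)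
    ('D_(0, 1) B2 z) => a1 a2 b1 b2 a1' a2' b1' b2' -> -> -> ->.
  by rewrite dotDl addrA.
have gen0 (A1 A2 B1 B2 : R * R -> 'rV[R]_3) : differentiable A1 z -> differentiable A2 z ->
    differentiable B1 z -> differentiable B2 z -> A2 z = A1 z -> B2 z = B1 z ->
    pd_v A2 z = pd_v A1 z -> pd_v B2 z = pd_v B1 z ->
    pd_v (fun z => dot (A2 z) (B2 z)) z = pd_v (fun z => dot (A1 z) (B1 z)) z.
  move=> dA1 dA2 dB1 dB2 hA hB hA' hB'.
  have hA0 : pd_v A2 z = pd_v A1 z + 0 by rewrite addr0.
  have := gen _ _ _ _ _ dA1 dA2 dB1 dB2 hA hB hA0 hB'.
  have -> : dot 0 (B1 z) = 0 by exact: linear0l.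
  by rewrite addr0.
split; split.
- exact: (gen0 _ _ _ _ du1 du2 du1 du2 (esym eu) (esym eu) (esym euv) (esym euv)).
- exact: (gen0 _ _ _ _ du1 du2 dv1 dv2 (esym eu) (esym ev) (esym euv) (esym evv)).
- exact: (gen0 _ _ _ _ dv1 dv2 dv1 dv2 (esym ev) (esym ev) (esym evv) (esym evv)).
- exact: (gen0 _ _ _ _ duu1 duu2 dn1 dn2 (esym euu) nE euuv dnE).
- exact: (gen0 _ _ _ _ duv1 duv2 dn1 dn2 (esym euv) nE euvv dnE).
- exact: (gen _ _ _ _ _ dvv1 dvv2 dn1 dn2 (esym evv) nE evvv dnE).
Qed.

End Jets.

(** * Perturbations of order three *)

Lemma congr6 {A T : Type} (q : A -> A -> A -> A -> A -> A -> T) a b c d e f a' b' c' d' e' f' :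
  a = a' -> b = b' -> c = c' -> d = d' -> e = e' -> f = f' -> q a b c d e f = q a' b' c' d' e' f'.
Proof. by move=> -> -> -> -> -> ->. Qed.

Section TwoJets.
Context {R : realType}.
Implicit Types (X : R * R -> 'rV[R]_3) (z w : R * R) (U : set (R * R)).

(** These are exactly the derivatives that the normal and the six coefficients read. *)
Definition same_2jet X1 X2 z :=
  [/\ pd_u X1 z = pd_u X2 z, pd_v X1 z = pd_v X2 z,
      pd_u (pd_u X1) z = pd_u (pd_u X2) z, pd_v (pd_u X1) z = pd_v (pd_u X2) z &
      pd_v (pd_v X1) z = pd_v (pd_v X2) z].

Lemma same_2jet_normal X1 X2 z : same_2jet X1 X2 z ->
  unit_normal X1 z = unit_normal X2 z.
Proof.
move=> [eu ev _ _ _].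
exact: (congr2 (fun a b => (Num.sqrt (dot (cross a b) (cross a b)))^-1 *: cross a b) eu ev).
Qed.

Lemma same_2jet_coef X1 X2 z : same_2jet X1 X2 z ->
  [/\ coef_E X1 z = coef_E X2 z, coef_F X1 z = coef_F X2 z & coef_G X1 z = coef_G X2 z] /\
  [/\ coef_e X1 z = coef_e X2 z, coef_f X1 z = coef_f X2 z & coef_g X1 z = coef_g X2 z].
Proof.
move=> J; have n := same_2jet_normal J; case: J => eu ev euu euv evv; split; split.
- exact: (congr2 (@dot R) eu eu).
- exact: (congr2 (@dot R) eu ev).
- exact: (congr2 (@dot R) ev ev).
- exact: (congr2 (@dot R) euu n).
- exact: (congr2 (@dot R) euv n).
- exact: (congr2 (@dot R) evv n).
Qed.

Lemma same_2jet_HK X1 X2 z : same_2jet X1 X2 z ->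
  coef_H X1 z = coef_H X2 z /\ coef_K X1 z = coef_K X2 z.
Proof.
move=> /same_2jet_coef[[hE hF hG] [he hf hg]].
split.
  exact: (congr6 (fun E F G e f g => (e * G - 2 * f * F + g * E) / (2 * (E * G - F ^+ 2)))
    hE hF hG he hf hg).
exact: (congr6 (fun E F G e f g => (e * g - f ^+ 2) / (E * G - F ^+ 2)) hE hF hG he hf hg).
Qed.

Lemma same_2jet_normal_curv X1 X2 z : same_2jet X1 X2 z ->
  normal_curv X1 z = normal_curv X2 z.
Proof.
move=> /same_2jet_coef[[hE hF hG] [he hf hg]]; apply/funext => w.
exact: (congr6 (fun E F G e f g =>
  (e * w.1 ^+ 2 + 2 * f * w.1 * w.2 + g * w.2 ^+ 2) /
  (E * w.1 ^+ 2 + 2 * F * w.1 * w.2 + G * w.2 ^+ 2)) hE hF hG he hf hg).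
Qed.

Lemma same_2jet_kappa X1 X2 z : same_2jet X1 X2 z ->
  kappa1 X1 z = kappa1 X2 z /\ kappa2 X1 z = kappa2 X2 z.
Proof.
move=> /same_2jet_normal_curv h; split.
  exact: (congr1 (fun q : R * R -> R => inf [set q w | w in [set w | w != 0]]) h).
exact: (congr1 (fun q : R * R -> R => sup [set q w | w in [set w | w != 0]]) h).
Qed.

Lemma same_2jet_torsion U X1 X2 z w : open U -> U z -> classC 2 U X1 -> classC 2 U X2 ->
  (forall z, U z -> regular_at X1 z) -> (forall z, U z -> regular_at X2 z) ->
  same_2jet X1 X2 z -> geod_torsion X1 z w = geod_torsion X2 z w.
Proof.
move=> oU Uz c1 c2 r1 r2 /same_2jet_coef[[hE hF hG] [he hf hg]].
apply: (etrans (geod_torsionE oU c1 r1 w Uz)).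
apply: (etrans _ (esym (geod_torsionE oU c2 r2 w Uz))).
exact: (congr6 (fun E F G e f g =>
  ((E * f - F * e) * w.1 ^+ 2 + (E * g - G * e) * w.1 * w.2 + (F * g - G * f) * w.2 ^+ 2)
  / (Num.sqrt (E * G - F ^+ 2) *
     (E * w.1 ^+ 2 + 2 * F * w.1 * w.2 + G * w.2 ^+ 2))) hE hF hG he hf hg).
Qed.

Lemma same_2jet_trans X1 X2 X3 z :
  same_2jet X1 X2 z -> same_2jet X2 X3 z -> same_2jet X1 X3 z.
Proof.
move=> [a1 a2 a3 a4 a5] [b1 b2 b3 b4 b5].
split; [exact: (etrans a1 b1)|exact: (etrans a2 b2)|exact: (etrans a3 b3)|
  exact: (etrans a4 b4)|exact: (etrans a5 b5)].
Qed.

Lemma same_2jet_core m X1 X2 z : same_2jet X1 X2 z ->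
  coef_E X1 z = 1 -> coef_F X1 z = 0 -> coef_G X1 z = 1 ->
  coef_e X1 z = curv_M m X1 z -> 0 < coef_f X1 z -> 0 < coef_K X1 z ->
  coef_K X1 z < coef_H X1 z ^+ 2 ->
  [/\ coef_E X2 z = 1, coef_F X2 z = 0 & coef_G X2 z = 1] /\
  [/\ coef_e X2 z = curv_M m X2 z, 0 < coef_f X2 z, 0 < coef_K X2 z &
      coef_K X2 z < coef_H X2 z ^+ 2].
Proof.
move=> J Ez Fz Gz ez fz Kz HKz.
have [[eE eF eG] [ee ef _]] := same_2jet_coef J; have [HE KE] := same_2jet_HK J.
have G1 (a b c d : R) : a = b -> c = d -> 0 < a -> a < c ^+ 2 -> 0 < b /\ b < d ^+ 2.
  by move=> -> -> h1 h2; split; [exact: h1|exact: h2].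
have [K1 K2] := G1 _ _ _ _ KE HE Kz HKz.
split; split; [exact: (etrans (esym eE) Ez)|exact: (etrans (esym eF) Fz)
  |exact: (etrans (esym eG) Gz)| |exact: (eq_ind _ (fun x => 0 < x) fz _ ef)
  |exact: K1|exact: K2].
exact: (etrans (esym ee) (etrans ez (congr2 m HE KE))).
Qed.

Lemma same_2jet_slope m X1 X2 z : same_2jet X1 X2 z -> slope m X1 z = slope m X2 z.
Proof.
move=> J; have [[hE hF hG] [he hf hg]] := same_2jet_coef J; have [HE KE] := same_2jet_HK J.
have hM : curv_M m X1 z = curv_M m X2 z := congr2 m HE KE.
apply: (etrans (congr6 (fun E F G e f g => - (e - curv_M m X1 z * E) /
  (f - curv_M m X1 z * F + Num.sqrt ((f - curv_M m X1 z * F) ^+ 2 -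
    (e - curv_M m X1 z * E) * (g - curv_M m X1 z * G)))) hE hF hG he hf hg)).
exact: (congr1 (fun M => - (coef_e X2 z - M * coef_E X2 z) /
  (coef_f X2 z - M * coef_F X2 z + Num.sqrt ((coef_f X2 z - M * coef_F X2 z) ^+ 2 -
    (coef_e X2 z - M * coef_E X2 z) * (coef_g X2 z - M * coef_G X2 z)))) hM).
Qed.

End TwoJets.

(** * Functions divisible by a power of v *)

Section VanishingOrder.
Context {R : realType} {W : normedModType R}.
Implicit Types (P Q A B : R * R -> W) (z : R * R) (U : set (R * R)) (n k : nat).

(** The shape v^n Q survives differentiation: [pd_u] keeps the order n and [pd_v] lowers it by one.
    Jets on the axis are thus read off from the order. *)
Definition vpow n Q : R * R -> W := fun z => z.2 ^+ n *: Q z.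

Lemma vpow0 n Q z : z.2 = 0 -> vpow n.+1 Q z = 0.
Proof. by move=> z0; rewrite /vpow z0 exprS mul0r scale0r. Qed.

Lemma derive_vpow n z w :
  'D_w (fun z : R * R => z.2 ^+ n.+1) z = n.+1%:R * z.2 ^+ n * w.2.
Proof.
have dp : derivable (fun t : R => t ^+ n.+1) z.2 1 by exact: exprn_derivable.
rewrite (derive_comp1 w dp (classC_differentiable (classC_proj2 1 openT) (Logic.I : setT z))) -derive1E exp_derive1.
have -> : 'D_w (snd : R * R -> R) z = w.2.
  have -> : 'D_w snd z = ('D_w id z).2.
    have di : differentiable (id : R * R -> R * R) z by [].
    exact: (derive_snd w di).
  by rewrite derive_id.
by [].
Qed.

Lemma differentiable_vpow n z : differentiable (fun z : R * R => z.2 ^+ n) z.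
Proof.
exact: classC_differentiable (classCX n openT (classC_proj2 1 openT)) _.
Qed.

Lemma pd_u_vpow n Q z : differentiable Q z -> pd_u (vpow n Q) z = vpow n (pd_u Q) z.
Proof.
move=> dQ; apply: etrans (derive_scale (1, 0) (differentiable_vpow n z) dQ) _.
case: n => [|n]; last by rewrite derive_vpow /= mulr0 scale0r addr0.
have -> : (fun z : R * R => z.2 ^+ 0) = cst 1 by [].
by rewrite derive_cst scale0r addr0.
Qed.

Lemma pd_v_vpow n Q z : differentiable Q z ->
  pd_v (vpow n.+1 Q) z = vpow n (fun z => n.+1%:R *: Q z + z.2 *: pd_v Q z) z.
Proof.
move=> dQ; apply: etrans (derive_scale (0, 1) (differentiable_vpow n.+1 z) dQ) _.
rewrite derive_vpow /= mulr1 /vpow scalerDr !scalerA addrC.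
by rewrite [n.+1%:R * _]mulrC exprSr.
Qed.

Lemma classC_vpow n k U Q : open U -> classC k U Q -> classC k U (vpow n Q).
Proof.
by move=> oU cQ; apply: (classCZ oU _ cQ); apply: (classCX n oU (classC_proj2 k oU)).
Qed.

Lemma classC_vpow_derive n k U Q : open U -> classC k.+1 U Q ->
  classC k U (fun z => n%:R *: Q z + z.2 *: pd_v Q z).
Proof.
move=> oU cQ; exact: (classCD oU (classCZ oU (classC_cst k U (n%:R : R)) (classCS cQ))
  (classCZ oU (classC_proj2 k oU) (classC_pd_v cQ))).
Qed.

Lemma vpow3_jet U P z : open U -> classC 3 U P -> U z -> z.2 = 0 ->
  [/\ pd_u (vpow 3 P) z = 0, pd_v (vpow 3 P) z = 0, pd_u (pd_u (vpow 3 P)) z = 0,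
      pd_v (pd_u (vpow 3 P)) z = 0 & pd_v (pd_v (vpow 3 P)) z = 0] /\
  [/\ pd_v (pd_u (pd_u (vpow 3 P))) z = 0, pd_v (pd_v (pd_u (vpow 3 P))) z = 0 &
      pd_v (pd_v (pd_v (vpow 3 P))) z = 6 *: P z].
Proof.
move=> oU c0 Uz z0.
have nU A B : (forall y, U y -> A y = B y) -> \near z, A z = B z.
  by move=> AB; apply: filterS (open_nbhs_nbhs (conj oU Uz)) => y; exact: AB.
have cu := classC_pd_u c0; have cuu := classC_pd_u cu.
(* Q1 and Q2 are the cofactors of v^2 and v after one and two derivatives in v; on v = 0 they reduce
   to 3 P and 6 P. *)
pose Q1 y := 3%:R *: P y + y.2 *: pd_v P y.
have c1 : classC 2 U Q1 by exact: classC_vpow_derive.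
pose Q1u y := 3%:R *: pd_u P y + y.2 *: pd_v (pd_u P) y.
have c1u : classC 1 U Q1u by exact: classC_vpow_derive.
pose Q2 y := 2%:R *: Q1 y + y.2 *: pd_v Q1 y.
have c2 : classC 1 U Q2 by exact: classC_vpow_derive.
have d k (Q : R * R -> W) y : classC k.+1 U Q -> U y -> differentiable Q y.
  exact: classC_differentiable.
have eu y : U y -> pd_u (vpow 3 P) y = vpow 3 (pd_u P) y.
  by move=> Uy; exact: pd_u_vpow (d _ _ _ c0 Uy).
have ev y : U y -> pd_v (vpow 3 P) y = vpow 2 Q1 y.
  by move=> Uy; exact: pd_v_vpow (d _ _ _ c0 Uy).
have ny (A B : R * R -> W) y : U y -> (forall y, U y -> A y = B y) -> \near y, A y = B y.
  by move=> Uy AB; apply: filterS (open_nbhs_nbhs (conj oU Uy)) => x; exact: AB.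
have euu y : U y -> pd_u (pd_u (vpow 3 P)) y = vpow 3 (pd_u (pd_u P)) y.
  move=> Uy; apply: etrans (near_eq_pd_u (ny _ _ _ Uy eu)) _.
  exact: pd_u_vpow (d _ _ _ cu Uy).
have euv y : U y -> pd_v (pd_u (vpow 3 P)) y = vpow 2 Q1u y.
  move=> Uy; apply: etrans (near_eq_pd_v (ny _ _ _ Uy eu)) _.
  exact: pd_v_vpow (d _ _ _ cu Uy).
have evv y : U y -> pd_v (pd_v (vpow 3 P)) y = vpow 1 Q2 y.
  move=> Uy; apply: etrans (near_eq_pd_v (ny _ _ _ Uy ev)) _.
  exact: pd_v_vpow (d _ _ _ c1 Uy).
split; split.
- exact: etrans (eu _ Uz) (vpow0 _ _ z0).
- exact: etrans (ev _ Uz) (vpow0 _ _ z0).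
- exact: etrans (euu _ Uz) (vpow0 _ _ z0).
- exact: etrans (euv _ Uz) (vpow0 _ _ z0).
- exact: etrans (evv _ Uz) (vpow0 _ _ z0).
- apply: etrans (near_eq_pd_v (nU _ _ euu)) _.
  exact: etrans (pd_v_vpow _ (d _ _ _ cuu Uz)) (vpow0 _ _ z0).
- apply: etrans (near_eq_pd_v (nU _ _ euv)) _.
  exact: etrans (pd_v_vpow _ (d _ _ _ c1u Uz)) (vpow0 _ _ z0).
- apply: etrans (near_eq_pd_v (nU _ _ evv)) _.
  apply: etrans (pd_v_vpow _ (d _ _ _ c2 Uz)) _.
  rewrite /vpow expr0 scale1r z0 scale0r addr0 scale1r /Q2 z0 scale0r addr0.
  by rewrite /Q1 z0 scale0r addr0 scalerA -natrM.
Qed.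

Lemma pd_uD U A B z : classC 1 U A -> classC 1 U B -> U z ->
  pd_u (fun z => A z + B z) z = pd_u A z + pd_u B z.
Proof.
move=> cA cB Uz; apply: deriveD; apply: diff_derivable;
  [exact: classC_differentiable cA Uz|exact: classC_differentiable cB Uz].
Qed.

Lemma pd_vD U A B z : classC 1 U A -> classC 1 U B -> U z ->
  pd_v (fun z => A z + B z) z = pd_v A z + pd_v B z.
Proof.
move=> cA cB Uz; apply: deriveD; apply: diff_derivable;
  [exact: classC_differentiable cA Uz|exact: classC_differentiable cB Uz].
Qed.

Lemma jetD U A B z : open U -> classC 3 U A -> classC 3 U B -> U z ->
  let X := fun z => A z + B z in
  [/\ pd_u X z = pd_u A z + pd_u B z, pd_v X z = pd_v A z + pd_v B z,
      pd_u (pd_u X) z = pd_u (pd_u A) z + pd_u (pd_u B) z,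
      pd_v (pd_u X) z = pd_v (pd_u A) z + pd_v (pd_u B) z &
      pd_v (pd_v X) z = pd_v (pd_v A) z + pd_v (pd_v B) z] /\
  [/\ pd_v (pd_u (pd_u X)) z = pd_v (pd_u (pd_u A)) z + pd_v (pd_u (pd_u B)) z,
      pd_v (pd_v (pd_u X)) z = pd_v (pd_v (pd_u A)) z + pd_v (pd_v (pd_u B)) z &
      pd_v (pd_v (pd_v X)) z = pd_v (pd_v (pd_v A)) z + pd_v (pd_v (pd_v B)) z].
Proof.
move=> oU cA cB Uz X.
have ny (C D : R * R -> W) y : U y -> (forall y, U y -> C y = D y) -> \near y, C y = D y.
  by move=> Uy CD; apply: filterS (open_nbhs_nbhs (conj oU Uy)) => x; exact: CD.
have l (C : R * R -> W) k : classC k.+1 U C -> classC 1 U C by exact: classC_le.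
have uA := classC_pd_u cA; have vA := classC_pd_v cA.
have uB := classC_pd_u cB; have vB := classC_pd_v cB.
have uuA := classC_pd_u uA; have uvA := classC_pd_v uA; have vvA := classC_pd_v vA.
have uuB := classC_pd_u uB; have uvB := classC_pd_v uB; have vvB := classC_pd_v vB.
have eu y : U y -> pd_u X y = pd_u A y + pd_u B y by exact: pd_uD (l _ _ cA) (l _ _ cB).
have ev y : U y -> pd_v X y = pd_v A y + pd_v B y by exact: pd_vD (l _ _ cA) (l _ _ cB).
have euu y : U y -> pd_u (pd_u X) y = pd_u (pd_u A) y + pd_u (pd_u B) y.
  move=> Uy; apply: etrans (near_eq_pd_u (ny _ _ _ Uy eu)) _.
  exact: pd_uD (l _ _ uA) (l _ _ uB) Uy.
have euv y : U y -> pd_v (pd_u X) y = pd_v (pd_u A) y + pd_v (pd_u B) y.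
  move=> Uy; apply: etrans (near_eq_pd_v (ny _ _ _ Uy eu)) _.
  exact: pd_vD (l _ _ uA) (l _ _ uB) Uy.
have evv y : U y -> pd_v (pd_v X) y = pd_v (pd_v A) y + pd_v (pd_v B) y.
  move=> Uy; apply: etrans (near_eq_pd_v (ny _ _ _ Uy ev)) _.
  exact: pd_vD (l _ _ vA) (l _ _ vB) Uy.
split; split; [exact: eu|exact: ev|exact: euu|exact: euv|exact: evv|..].
- apply: etrans (near_eq_pd_v (ny _ _ _ Uz euu)) _; exact: pd_vD uuA uuB Uz.
- apply: etrans (near_eq_pd_v (ny _ _ _ Uz euv)) _; exact: pd_vD uvA uvB Uz.
- apply: etrans (near_eq_pd_v (ny _ _ _ Uz evv)) _; exact: pd_vD vvA vvB Uz.
Qed.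

End VanishingOrder.

Section Perturbation.
Context {R : realType}.
Variable m : R -> R -> R.
Hypothesis hm : mean_curvature_function m.
Variables (U : set (R * R)) (X P : R * R -> 'rV[R]_3) (z : R * R).
Hypotheses (oU : open U) (cX : classC 3 U X) (cP : classC 3 U P).
Hypotheses (Uz : U z) (z0 : z.2 = 0).

Definition perturb : R * R -> 'rV[R]_3 := fun z => X z + vpow 3 P z.

Lemma classC_perturb : classC 3 U perturb.
Proof. exact: (classCD oU cX (classC_vpow 3 oU cP)). Qed.

Lemma perturb_jet : same_2jet X perturb z /\
  [/\ pd_v (pd_u (pd_u perturb)) z = pd_v (pd_u (pd_u X)) z,
      pd_v (pd_v (pd_u perturb)) z = pd_v (pd_v (pd_u X)) z &
      pd_v (pd_v (pd_v perturb)) z = pd_v (pd_v (pd_v X)) z + 6 *: P z].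
Proof.
have [[a1 a2 a3 a4 a5] [a6 a7 a8]] := jetD oU cX (classC_vpow 3 oU cP) Uz.
have [[b1 b2 b3 b4 b5] [b6 b7 b8]] := vpow3_jet oU cP Uz z0.
have G0 (x y t : 'rV[R]_3) : x = y + t -> t = 0 -> x = y by move=> -> ->; rewrite addr0.
split; split.
- exact: (esym (G0 _ _ _ a1 b1)).
- exact: (esym (G0 _ _ _ a2 b2)).
- exact: (esym (G0 _ _ _ a3 b3)).
- exact: (esym (G0 _ _ _ a4 b4)).
- exact: (esym (G0 _ _ _ a5 b5)).
- exact: (G0 _ _ _ a6 b6).
- exact: (G0 _ _ _ a7 b7).
- exact: (etrans a8 (congr1 (+%R _) b8)).
Qed.

Hypotheses (rX : forall z, U z -> regular_at X z) (rY : forall z, U z -> regular_at perturb z).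
Hypotheses (Ez : coef_E X z = 1) (Fz : coef_F X z = 0) (Gz : coef_G X z = 1).
Hypotheses (ez : coef_e X z = curv_M m X z) (fz : 0 < coef_f X z).
Hypotheses (Kz : 0 < coef_K X z) (HKz : coef_K X z < coef_H X z ^+ 2).

Lemma perturb_core : [/\ coef_E perturb z = 1, coef_F perturb z = 0 & coef_G perturb z = 1] /\
  [/\ coef_e perturb z = curv_M m perturb z, 0 < coef_f perturb z, 0 < coef_K perturb z &
      coef_K perturb z < coef_H perturb z ^+ 2].
Proof. exact: (same_2jet_core perturb_jet.1 Ez Fz Gz ez fz Kz HKz). Qed.

(** With a = <P, N>, g_v grows by 6 a, hence H_v by 3 a and K_v by 6 a e = 6 a M. As M_v enters p_v
    with the factor 1 / (2 f), the increment is 6 a / (4 f) times M_H + 2 M M_K. *)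
Lemma perturb_slope_derive :
  pd_v (slope m perturb) z = pd_v (slope m X) z
  + 6 * dot (P z) (unit_normal X z) / (4 * coef_f X z) *
    (pd_u (fun z => m z.1 z.2) (coef_H X z, coef_K X z)
     + 2 * curv_M m X z * pd_v (fun z => m z.1 z.2) (coef_H X z, coef_K X z)).
Proof.
have [J J3] := perturb_jet; have [[eE eF eG] [ee ef eg]] := same_2jet_coef J.
have [HE KE] := same_2jet_HK J.
have [[dE dF dG] [de df dg]] := coef_jet oU cX classC_perturb Uz rX rY J J3.
have [[hE hF hG] [he hf hK hHK]] := perturb_core.
have G (x1 x2 x3 x4 x5 x6 y1 y2 y3 y4 y5 y6 u v a M f f' g g' e e' u' v' : R) :
    0 < f -> e = e' -> f = f' -> g = g' -> u = u' -> v = v' -> e = M ->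
    y1 = x1 -> y2 = x2 -> y3 = x3 -> y4 = x4 -> y5 = x5 -> y6 = x6 + 6 * a ->
  - (2 * f')^-1 * (y4 - (dH e' g' y1 y2 y3 y4 y6 f' * u'
      + dK e' g' y1 y3 y4 y5 y6 f' * v') - e' * y1) =
  - (2 * f)^-1 * (x4 - (dH e g x1 x2 x3 x4 x6 f * u
      + dK e g x1 x3 x4 x5 x6 f * v) - e * x1) + 6 * a / (4 * f) * (u + 2 * M * v).
  move=> f0 <- <- <- <- <- <- -> -> -> -> -> ->; rewrite /dH /dK; field.
  by rewrite gt_eqF.
have du := congr2 (fun a b => pd_u (fun z : R * R => m z.1 z.2) (a, b)) HE KE.
have dv := congr2 (fun a b => pd_v (fun z : R * R => m z.1 z.2) (a, b)) HE KE.
have dg' := etrans dg (congr1 (+%R _) (dotZl 6 (P z) (unit_normal X z))).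
exact: (etrans (core_slope_derive hm oU classC_perturb rY Uz hE hF hG he hf hK hHK)
  (etrans (G _ _ _ _ _ _ _ _ _ _ _ _ _ _ _ _ _ _ _ _ _ _ _ _
     fz ee ef eg du dv ez dE dF dG de df dg')
   (congr1 (fun x => x + _) (esym (core_slope_derive hm oU cX rX Uz Ez Fz Gz ez fz Kz HKz))))).
Qed.

End Perturbation.

(** * Patches on a surface *)

Lemma near_eq_continuous {T U : topologicalType} (f g : T -> U) x :
  (\near x, f x = g x) -> {for x, continuous f} -> {for x, continuous g}.
Proof.
move=> e c; have e0 : f x = g x := nbhs_singleton e.
change (g y @[y --> x] --> g x); rewrite -e0.
by apply: cvg_trans c; exact: near_eq_cvg.
Qed.

Section Locality.
Context {R : realType} {W : normedModType R}.
Implicit Types (f : R * R -> W) (U : set (R * R)).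

Lemma classC_local k U f :
  (forall z, U z -> exists2 U', U' z & classC k U' f) -> classC k U f.
Proof.
elim: k f => [|k IH] f h /=.
  by move=> z /h[U' U'z cf]; exact: (cf z U'z).
split.
- by move=> z /h[U' U'z [df _ _]]; exact: (df z U'z).
- by apply: IH => z /h[U' U'z [_ cu _]]; exists U'.
- by apply: IH => z /h[U' U'z [_ _ cv]]; exists U'.
Qed.

Lemma det2_comp (f phi : R * R -> R * R) z :
  differentiable f (phi z) -> differentiable phi z ->
  det2 (pd_u (f \o phi) z) (pd_v (f \o phi) z) =
  det2 (pd_u phi z) (pd_v phi z) * det2 (pd_u f (phi z)) (pd_v f (phi z)).
Proof.
move=> df dp.
have G (a b x y x' y' : R * R) : x' = a.1 *: x + a.2 *: y -> y' = b.1 *: x + b.2 *: y ->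
  det2 x' y' = det2 a b * det2 x y.
  move=> -> ->; case: a b x y => [a1 a2] [b1 b2] [x1 x2] [y1 y2].
  by rewrite /det2 /=; rewrite !/(_ *: _) /=; ring.
exact: (G _ _ _ _ _ _ (@derive_pair R (R * R)%type (R * R)%type f phi z (1, 0) df dp)
  (@derive_pair R (R * R)%type (R * R)%type f phi z (0, 1) df dp)).
Qed.

Lemma near_eq_2jet (X Y : R * R -> 'rV[R]_3) z :
  (\near z, X z = Y z) -> same_2jet X Y z.
Proof.
move=> XY; have XY' := near_join XY.
have u : \near z, pd_u X z = pd_u Y z.
  by apply: filterS XY' => y; exact: near_eq_pd_u.
have v : \near z, pd_v X z = pd_v Y z.
  by apply: filterS XY' => y; exact: near_eq_pd_v.
split; [exact: (near_eq_pd_u XY)|exact: (near_eq_pd_v XY)|exact: (near_eq_pd_u u)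
  |exact: (near_eq_pd_v u)|exact: (near_eq_pd_v v)].
Qed.

End Locality.

Lemma dom_chart_at {R : realType} {r : nat} {V : oriented_surface R r} (p : V) :
  dom (chart_at p) p.
Proof. exact: (projT2 (cid (dom_cover p))). Qed.

Section Patch.
Context {R : realType} {r : nat} {V : oriented_surface R r}.
Implicit Types (b : V -> 'rV[R]_3) (z : R * R) (i j : idx V).
Variables (U : set (R * R)) (phi : R * R -> V) (k : nat).
Hypotheses (oU : open U) (phi_cont : forall z, U z -> {for z, continuous phi}).
Hypothesis phi_class : forall i,
  classC k.+1 (U `&` phi @^-1` dom i) (local_coord i \o phi).
Hypothesis kr : (k.+1 <= r)%N.

Definition jac i z := det2 (pd_u (local_coord i \o phi) z) (pd_v (local_coord i \o phi) z).

Lemma open_piece i : open (U `&` phi @^-1` dom i).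
Proof.
rewrite openE => z [Uz dz]; apply: filterI; first exact: open_nbhs_nbhs.
by apply: (phi_cont Uz); apply: open_nbhs_nbhs; split => //; exact: dom_open.
Qed.

Lemma coord_differentiable i z : U z -> dom i (phi z) ->
  differentiable (local_coord i \o phi) z.
Proof. by move=> Uz dz; apply: classC_differentiable (phi_class i) _. Qed.

Lemma patch_local (T : Type) (f : V -> T) i z : U z -> dom i (phi z) ->
  \near z, ((f \o local_param i) \o (local_coord i \o phi)) z = (f \o phi) z.
Proof.
move=> Uz dz.
have n : nbhs z (U `&` phi @^-1` dom i).
  by apply: open_nbhs_nbhs; split; [exact: open_piece|].
apply: filterS n.
by move=> y [_ dy] /=; rewrite coordK.
Qed.

Lemma patch_class n b : (n <= k.+1)%N ->
  (forall i, classC n (local_coord i @` dom i) (b \o local_param i)) ->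
  classC n U (b \o phi).
Proof.
move=> nk cb; apply: classC_local => z Uz; pose i := chart_at (phi z).
have dz : dom i (phi z) := dom_chart_at (phi z).
exists (U `&` phi @^-1` dom i) => //.
apply: (@classC_congr _ _ n _ ((b \o local_param i) \o (local_coord i \o phi))).
- exact: open_piece.
- by move=> y [_ dy] /=; rewrite coordK.
- apply: (@classC_comp _ _ n (local_coord i @` dom i) _ (b \o local_param i)).
  + exact: open_piece.
  + by move=> y [_ dy]; exists (phi y).
  + exact: cb.
  + exact: classC_le (phi_class i).
Qed.

Lemma patch_regular b i z : immersion 1 b -> U z -> dom i (phi z) -> jac i z != 0 ->
  regular_at (b \o phi) z.
Proof.
move=> ib Uz dz jz; have [cb rb] := ib i.
have xz : (local_coord i @` dom i) ((local_coord i \o phi) z) by exists (phi z).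
have db : differentiable (b \o local_param i) ((local_coord i \o phi) z).
  exact: classC_differentiable cb xz.
have e := cross_comp (coord_differentiable Uz dz) db.
have [eu ev _ _ _] := near_eq_2jet (patch_local b Uz dz).
have G (u v u' v' w : 'rV[R]_3) (d : R) : u = u' -> v = v' -> cross u v = d *: w ->
  d != 0 -> w != 0 -> cross u' v' != 0.
  by move=> -> -> -> d0 w0; rewrite scaler_eq0 negb_or d0 w0.
exact: (G _ _ _ _ _ _ eu ev e jz (rb _ xz)).
Qed.

Lemma jac_change i j z : U z -> dom i (phi z) -> dom j (phi z) ->
  exists2 d : R, 0 < d & jac j z = jac i z * d.
Proof.
move=> Uz di dj.
have xz : (local_coord i @` (dom i `&` dom j)) ((local_coord i \o phi) z) by exists (phi z).
exists (det2 (pd_u (local_coord j \o local_param i) ((local_coord i \o phi) z))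
             (pd_v (local_coord j \o local_param i) ((local_coord i \o phi) z))).
  exact: change_det.
have dc : differentiable (local_coord j \o local_param i) ((local_coord i \o phi) z).
  apply: classC_differentiable xz.
  exact: (classC_le (leq_trans (ltn0Sn k) kr) (change_class i j)).
have e := patch_local (local_coord j) Uz di.
apply: (etrans (congr2 (@det2 R) (esym (near_eq_pd_u e)) (esym (near_eq_pd_v e)))).
exact: (det2_comp dc (coord_differentiable Uz di)).
Qed.

(** All charts of the atlas give [jac] the same sign at a point, so one chart decides membership.
    For the cycle chart the orientation is determined on the axis, and this open set is the
    neighbourhood where the invariants are transported. *)
Definition positive_part := U `&` [set z | forall i, dom i (phi z) -> 0 < jac i z].

Lemma positive_partP i z : U z -> dom i (phi z) -> 0 < jac i z -> positive_part z.
Proof.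
move=> Uz di ji; split; first exact: Uz.
move=> j dj; have [d d0 e] := jac_change Uz di dj.
exact: (eq_ind_r (fun x => 0 < x) (mulr_gt0 ji d0) e).
Qed.

Lemma classC_jac i : classC k (U `&` phi @^-1` dom i) (jac i).
Proof.
have oi := @open_piece i; have ci := phi_class i.
have cu := classC_pd_u ci; have cv := classC_pd_v ci.
exact: (classCB oi (classCM oi (classC_fst oi cu) (classC_snd oi cv))
  (classCM oi (classC_snd oi cu) (classC_fst oi cv))).
Qed.

Lemma open_positive_part : open positive_part.
Proof.
rewrite openE => z [Uz pz]; pose i := chart_at (phi z).
have di : dom i (phi z) := dom_chart_at (phi z).
have o : open ((U `&` phi @^-1` dom i) `&` [set z | 0 < jac i z]).
  apply: open_gt0; first exact: open_piece.
  by move=> y; exact: classC_continuous (classC_jac i).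
apply: filterS (open_nbhs_nbhs (conj o (conj (conj Uz di) (pz i di)))).
by move=> y [[Uy dy] jy]; exact: positive_partP Uy dy jy.
Qed.

End Patch.

Section OrientedPatch.
Context {R : realType} {r : nat} {V : oriented_surface R r}.
Variables (U : set (R * R)) (phi : R * R -> V).
Hypotheses (oU : open U) (phi_cont : forall z, U z -> {for z, continuous phi}).
Hypothesis phi_class : forall i,
  classC 2 (U `&` phi @^-1` dom i) (local_coord i \o phi).
Hypothesis r2 : (2 <= r)%N.
Hypothesis phi_pos : forall i z, U z -> dom i (phi z) -> 0 < jac phi i z.
Variable b : V -> 'rV[R]_3.
Hypothesis ib : immersion 2 b.
Variables (i : idx V) (z : R * R).
Hypotheses (Uz : U z) (dz : dom i (phi z)).

Let U' := U `&` phi @^-1` dom i.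
Let X := b \o local_param i.
Let f := local_coord i \o phi.

Let oU' : open U'.
Proof. exact: open_piece. Qed.

Let cX : classC 2 (local_coord i @` dom i) X.
Proof. exact: (ib i).1. Qed.

Let rX x : (local_coord i @` dom i) x -> regular_at X x.
Proof. exact: (ib i).2. Qed.

Let cf : classC 1 U' f.
Proof. exact: classC_le (phi_class i). Qed.

Let fU x : U' x -> (local_coord i @` dom i) (f x).
Proof. by move=> [_ dx]; exists (phi x). Qed.

Let detf x : U' x -> 0 < det2 (pd_u f x) (pd_v f x).
Proof. by move=> [Ux dx]; exact: phi_pos. Qed.

Let cXf : classC 2 U' (X \o f).
Proof. exact: (classC_comp oU' fU cX (phi_class i)). Qed.

Let U'z : U' z. Proof. by []. Qed.

Let J : same_2jet (X \o f) (b \o phi) z.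
Proof. exact: near_eq_2jet (patch_local oU phi_cont b Uz dz). Qed.

Let oC : open (local_coord i @` dom i). Proof. exact: cod_open. Qed.

Lemma patch_class2 : classC 2 U (b \o phi).
Proof. by apply: (patch_class oU phi_cont phi_class) => // j; exact: (ib j).1. Qed.

Lemma patch_regular_pos y : U y -> regular_at (b \o phi) y.
Proof.
move=> Uy; have dy : dom (chart_at (phi y)) (phi y) := dom_chart_at (phi y).
have i1 : immersion 1 b by move=> j; split; [exact: classCS (ib j).1|exact: (ib j).2].
exact: (patch_regular oU phi_cont phi_class i1 Uy dy (lt0r_neq0 (phi_pos Uy dy))).
Qed.

(** Here and for the invariants below there are two moves: an orientation preserving change of
    coordinates [f], then the identity (b o local_param i) o f = b o phi near z, which makes the
    2-jets equal. *)
Lemma patch_unit_normal :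
  unit_normal (b \o local_param i) (local_coord i (phi z)) = unit_normal (b \o phi) z.
Proof.
exact: (etrans (esym (unit_normal_comp cX rX cf fU detf U'z)) (same_2jet_normal J)).
Qed.

Lemma patch_normal_curv w : normal_curv (b \o local_param i) (local_coord i (phi z))
  ('D_w (local_coord i \o phi) z) = normal_curv (b \o phi) z w.
Proof.
exact: (etrans (esym (normal_curv_comp oC oU' cX rX cf fU detf cXf w U'z))
  (congr1 (fun q => q w) (same_2jet_normal_curv J))).
Qed.

Lemma patch_kappa1 :
  kappa1 (b \o local_param i) (local_coord i (phi z)) = kappa1 (b \o phi) z.
Proof.
exact: (etrans (esym (kappa1_comp oC oU' cX rX cf fU detf cXf U'z)) (same_2jet_kappa J).1).
Qed.

Lemma patch_kappa2 :
  kappa2 (b \o local_param i) (local_coord i (phi z)) = kappa2 (b \o phi) z.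
Proof.
exact: (etrans (esym (kappa2_comp oC oU' cX rX cf fU detf cXf U'z)) (same_2jet_kappa J).2).
Qed.

Lemma patch_gaussK :
  gaussK (b \o local_param i) (local_coord i (phi z)) = gaussK (b \o phi) z.
Proof. exact: (congr2 *%R patch_kappa1 patch_kappa2). Qed.

Lemma patch_mean_of m :
  mean_of m (b \o local_param i) (local_coord i (phi z)) = mean_of m (b \o phi) z.
Proof.
exact: (congr2 (fun x y => m ((x + y) / 2) (x * y)) patch_kappa1 patch_kappa2).
Qed.

Lemma patch_torsion w : geod_torsion (b \o local_param i) (local_coord i (phi z))
  ('D_w (local_coord i \o phi) z) = geod_torsion (b \o phi) z w.
Proof.
apply: (etrans (esym (geod_torsion_comp oC oU' cX rX cf fU detf w U'z))).
apply: (same_2jet_torsion w oU' U'z cXf _ _ _ J).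
- by apply: (classC_sub _ patch_class2) => y [].
- exact: (regular_comp cX rX cf fU detf).
- by move=> y [Uy _]; exact: patch_regular_pos.
Qed.

End OrientedPatch.

(** * Curves read in a parametrization *)

Section PatchCurve.
Context {R : realType} {r : nat} {V : oriented_surface R r}.
Variables (U : set (R * R)) (phi : R * R -> V).
Hypotheses (oU : open U) (phi_cont : forall z, U z -> {for z, continuous phi}).
Hypothesis phi_class : forall i,
  classC 2 (U `&` phi @^-1` dom i) (local_coord i \o phi).

Lemma is_derive_coord i (g : R -> R * R) (t : R) w : U (g t) -> dom i (phi (g t)) ->
  is_derive t 1 g w ->
  is_derive t 1 (local_coord i \o (phi \o g)) ('D_w (local_coord i \o phi) (g t)).
Proof.
move=> Ut dt [dg gw]; have df := coord_differentiable phi_class Ut dt.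
have dg' : differentiable g t by exact/derivable1_diffP.
split; first by apply/derivable1_diffP; exact: (differentiable_comp dg' df).
apply: (etrans (@derive_pair R R (R * R)%type (local_coord i \o phi) g t 1 df dg')).
have e := @derive_plane R (R * R)%type _ _ w df.
by rewrite gw.
Qed.

Hypothesis r2 : (2 <= r)%N.
Hypothesis phi_pos : forall i z, U z -> dom i (phi z) -> 0 < jac phi i z.

Lemma coord_velocity_neq0 i z w : U z -> dom i (phi z) -> w != 0 ->
  'D_w (local_coord i \o phi) z != 0.
Proof.
move=> Uz dz; apply: contra_neq; have U'z : (U `&` phi @^-1` dom i) z by [].
apply: (derive_eq0 (classCS (phi_class i)) _ U'z) => y [Uy dy]; exact: phi_pos.
Qed.

Lemma regular_patch_curve (g dg : R -> R * R) (J : set R) : open J ->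
  (forall t, J t -> [/\ U (g t), is_derive t 1 g (dg t), {for t, continuous dg} & dg t != 0]) ->
  regular_curve (phi \o g) J.
Proof.
move=> oJ hg t Jt; have [Ut dt ct nt] := hg t Jt.
have cg s : J s -> {for s, continuous g}.
  by move=> /hg[_ [ds _] _ _]; apply: differentiable_continuous; exact/derivable1_diffP.
have cpg : {for t, continuous (phi \o g)}.
  by apply: continuous_comp; [exact: cg|exact: phi_cont].
split=> // i di; have [ex ed] := is_derive_coord Ut di dt.
split; [exact: ex| |]; last first.
  exact: (eq_ind_r (fun x => x != 0) (coord_velocity_neq0 Ut di nt)
    (etrans (derive1E _ _) ed)).
pose f := local_coord i \o phi.
have cu : {for g t, continuous (pd_u f)}.
  by apply: classC_continuous (classC_pd_u (phi_class i)) _.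
have cv : {for g t, continuous (pd_v f)}.
  by apply: classC_continuous (classC_pd_v (phi_class i)) _.
have e : \near t, (dg t).1 *: pd_u f (g t) + (dg t).2 *: pd_v f (g t) =
    derive1 (local_coord i \o (phi \o g)) t.
  have n1 : \near t, J t by exact: open_nbhs_nbhs.
  have n2 : \near t, dom i (phi (g t)).
    by apply: cpg; apply: open_nbhs_nbhs; split=> //; exact: dom_open.
  apply: filterS2 n1 n2 => s Js ds; have [Us es _ _] := hg s Js.
  have [_ e] := is_derive_coord Us ds es.
  apply: (etrans _ (esym (etrans (derive1E _ _) e))).
  exact: (esym (derive_plane (dg s) (coord_differentiable phi_class Us ds))).
have c : (fun t => (dg t).1 *: pd_u f (g t) + (dg t).2 *: pd_v f (g t)) x @[x --> t] -->
    (dg t).1 *: pd_u f (g t) + (dg t).2 *: pd_v f (g t).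
  apply: cvgD; apply: cvgZ.
  - exact: (cvg_comp _ _ ct (@cvg_fst _ _ _ _ _)).
  - exact: (cvg_comp _ _ (cg t Jt) cu).
  - exact: (cvg_comp _ _ ct (@cvg_snd _ _ _ _ _)).
  - exact: (cvg_comp _ _ (cg t Jt) cv).
exact: (near_eq_continuous e c).
Qed.

Variables (m : R -> R -> R) (b : V -> 'rV[R]_3).
Hypothesis ib : immersion 2 b.

(** The velocity in [chart_at] is the image of w under the differential of the change of
    coordinates, which is the direction that the transport lemmas expect. *)
Lemma patch_curve_point (g : R -> R * R) (t : R) w : U (g t) -> is_derive t 1 g w ->
  [/\ at_point (@gaussK R) b (phi (g t)) = gaussK (b \o phi) (g t),
      at_point (mean_of m) b (phi (g t)) = mean_of m (b \o phi) (g t),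
      at_point (@kappa1 R) b (phi (g t)) = kappa1 (b \o phi) (g t) &
      at_point (@kappa2 R) b (phi (g t)) = kappa2 (b \o phi) (g t)] /\
  [/\ at_point (@normal_curv R) b (phi (g t)) (velocity (phi \o g) t)
        = normal_curv (b \o phi) (g t) w &
      curve_torsion b (phi \o g) t = geod_torsion (b \o phi) (g t) w].
Proof.
move=> Ut dg; have dt : dom (chart_at (phi (g t))) (phi (g t)) := dom_chart_at _.
have [_ dc] := is_derive_coord Ut dt dg.
have e : velocity (phi \o g) t = 'D_w (local_coord (chart_at (phi (g t))) \o phi) (g t).
  exact: (etrans (derive1E _ _) dc).
split; split.
- exact: (patch_gaussK oU phi_cont phi_class phi_pos ib Ut dt).
- exact: (patch_mean_of oU phi_cont phi_class phi_pos ib Ut dt m).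
- exact: (patch_kappa1 oU phi_cont phi_class phi_pos ib Ut dt).
- exact: (patch_kappa2 oU phi_cont phi_class phi_pos ib Ut dt).
- exact: (etrans (congr1 (normal_curv (b \o local_param (chart_at (phi (g t))))
    (local_coord (chart_at (phi (g t))) (phi (g t)))) e) (patch_normal_curv oU phi_cont phi_class phi_pos ib Ut dt w)).
- exact: (etrans (congr1 (geod_torsion (b \o local_param (chart_at (phi (g t))))
    (local_coord (chart_at (phi (g t))) (phi (g t)))) e)
    (patch_torsion oU phi_cont phi_class phi_pos ib Ut dt w)).
Qed.

Lemma patch_mean_line (g dg : R -> R * R) (J : set R) : open J ->
  (forall t, J t -> [/\ U (g t), is_derive t 1 g (dg t), {for t, continuous dg} & dg t != 0]) ->
  (forall t, J t -> let X := b \o phi in let z := g t in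
    [/\ 0 < gaussK X z, kappa1 X z < kappa2 X z, normal_curv X z (dg t) = mean_of m X z &
        geod_torsion X z (dg t) =
          Num.sqrt ((kappa2 X z - mean_of m X z) * (mean_of m X z - kappa1 X z))]) ->
  mean_line Maximal m b (phi \o g) J.
Proof.
move=> oJ hg hm; split; first exact: (regular_patch_curve oJ hg).
move=> t Jt; have [Ut dt _ _] := hg t Jt.
have [[eK eM e1 e2] [en et]] := patch_curve_point Ut dt.
have G (K K' M M' k1 k1' k2 k2' n n' s s' : R) : K = K' -> M = M' -> k1 = k1' -> k2 = k2' ->
  n = n' -> s = s' -> [/\ 0 < K', k1' < k2', n' = M' & s' = Num.sqrt ((k2' - M') * (M' - k1'))] ->
  [/\ 0 < K, k1 < k2, n = M & s = 1 * Num.sqrt ((k2 - M) * (M - k1))].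
  by move=> -> -> -> -> -> -> [h1 h2 h3 h4]; split; [exact: h1|exact: h2|exact: h3|rewrite mul1r; exact: h4].
exact: (G _ _ _ _ _ _ _ _ _ _ _ _ eK eM e1 e2 en et (hm t Jt)).
Qed.

End PatchCurve.

(** * The cycle and its deformation *)

Lemma sqrt_gap_gt0 {R : realType} (H K : R) :
  H - Num.sqrt (H ^+ 2 - K) < H + Num.sqrt (H ^+ 2 - K) -> K < H ^+ 2.
Proof.
move=> h; have : 0 < Num.sqrt (H ^+ 2 - K) by move: h; set x := Num.sqrt _; lra.
by rewrite sqrtr_gt0 subr_gt0.
Qed.

Lemma near0_norm_lt {R : realType} (e : R) : 0 < e -> \forall x \near (0 : R), `|x| < e.
Proof. by move=> e0; exists e => // x /=; rewrite sub0r normrN. Qed.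

Lemma is_derive_scaler {R : realType} {W : normedModType R} (f : R -> R) (x d : R) (w : W) :
  is_derive x 1 f d -> is_derive x 1 (fun t => f t *: w) (d *: w).
Proof.
move=> [df fd]; have df' : differentiable f x by exact/derivable1_diffP.
have dw : differentiable (cst w : R -> W) x by exact: differentiable_cst.
have c := @continuous_scale R W; split.
  apply: diff_derivable.
  exact: (differentiable_bilinear (B := scale_bilinear W) (f := f) (g := cst w) c df' dw).
apply: (etrans (derive_bilinear (B := scale_bilinear W) (f := f) (g := cst w) 1 c df' dw)).
rewrite derive_cst fd /=; change (f x *: (0 : W) + d *: w = d *: w).
by rewrite scaler0 add0r.
Qed.

Lemma shift_itv {R : realType} (x L : R) : 0 < L -> exists n : int, 0 <= x + n%:~R * L <= L.
Proof.
move=> L0; exists (- Num.floor (x / L)).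
have h1 : (Num.floor (x / L))%:~R <= x / L by exact: floor_le_tmp.
have h2 : x / L < (Num.floor (x / L))%:~R + 1 by rewrite -intrD1 floorD1_gt.
rewrite ler_pdivlMr// in h1; rewrite ltr_pdivrMr// mulrDl mul1r in h2.
by rewrite mulrNz mulNr subr_ge0 h1 /= lerBlDr addrC ltW.
Qed.

(** For a = 0 the only root is the excluded e = 0; otherwise the root is at distance |a| / k from
    0. *)
Lemma near_shift_neq0 {R : realType} (a k : R) : 0 < k ->
  \forall e \near (0 : R), e != 0 -> a + e * k != 0.
Proof.
move=> k0; have [->|a0] := eqVneq a 0.
  by apply: filterE => e e0; rewrite add0r mulf_neq0// gt_eqF.
have ak : 0 < `|a| / k by rewrite divr_gt0// normr_gt0.
apply: filterS (near0_norm_lt ak) => e; rewrite ltr_pdivlMr// => h _.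
apply/eqP => /eqP; rewrite addr_eq0 => /eqP ae; move: h.
by rewrite ae normrN normrM (gtr0_norm k0) ltxx.
Qed.

Lemma is_derive_pair {R : realType} (f g : R -> R) (t f' g' : R) :
  is_derive t 1 f f' -> is_derive t 1 g g' ->
  is_derive t 1 (fun t => (f t, g t)) (f', g').
Proof.
move=> df dg.
have d1 := is_derive_scaler ((1, 0) : R * R) df.
have d2 := is_derive_scaler ((0, 1) : R * R) dg.
have e (a b : R) : a *: ((1, 0) : R * R) + b *: (0, 1) = (a, b).
  change ((a * 1 + b * 0, a * 0 + b * 1) = (a, b)).
  by rewrite !mulr1 !mulr0 addr0 add0r.
have -> : (fun t => (f t, g t)) = (fun t => f t *: ((1, 0) : R * R)) + (fun t => g t *: (0, 1)).
  by apply/funext => x; exact: (esym (e _ _)).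
by rewrite -e; exact: is_deriveD d1 d2.
Qed.

Lemma transverse_slope {R : realType} m U (X : R * R -> 'rV[R]_3) :
  mean_curvature_function m -> open U -> classC 3 U X -> (forall z, U z -> regular_at X z) ->
  classC 1 (U `&` [set z | transverse m X z]) (slope m X).
Proof.
move=> hm oU cX rX.
exact: (eq_ind _ (fun T => classC 1 T (slope m X)) (classC_slope hm oU cX rX) _
  (transverseE m U X)).
Qed.

Lemma open_transverse_part {R : realType} m U (X : R * R -> 'rV[R]_3) :
  mean_curvature_function m -> open U -> classC 3 U X -> (forall z, U z -> regular_at X z) ->
  open (U `&` [set z | transverse m X z]).
Proof.
move=> hm oU cX rX.
exact: (eq_ind _ (fun T : set (R * R) => open T) (open_transverse hm oU cX rX) _
  (transverseE m U X)).
Qed.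

Section CycleChart.
Context {R : realType} {r : nat} {V : oriented_surface R r}.
Variables (m : R -> R -> R) (alpha : V -> 'rV[R]_3) (c : R -> V) (L v0 : R).
Variables (chi : R * R -> V) (A A1 : R -> R) (B : R * R -> R).
Variables (delta : R -> R) (beta : R -> V -> 'rV[R]_3).
Hypothesis hm : mean_curvature_function m.
Hypotheses (hr : (6 <= r)%N) (halpha : immersion r alpha).
Hypothesis hc : mean_cycle Maximal m alpha c L.
Hypothesis harc : forall s, dot (frame_T alpha c s) (frame_T alpha c s) = 1.
Hypothesis hchi : cycle_chart m alpha c L v0 chi A B.
Hypothesis hA1 : forall s, A1 s = curve_torsion alpha c s.
Hypothesis hA1pos : forall s, 0 < A1 s.
Hypothesis hdelta : cutoff r v0 delta.
Hypothesis hbeta : deformation alpha c v0 chi A1 delta beta.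

Lemma open_strip : open (strip v0).
Proof.
have -> : strip v0 = [set: R * R] `&` [set z | 0 < v0 - `|z.2|].
  by apply/seteqP; split=> z /=; rewrite /strip /= subr_gt0 => // -[].
apply: open_gt0; first exact: openT.
move=> z _; apply: cvgB; first exact: cvg_cst.
by apply: cvg_norm; exact: cvg_snd.
Qed.

Lemma strip_core s : strip v0 (s, 0).
Proof. by rewrite /strip /= normr0; exact: (chart_width hchi). Qed.

Lemma chi_continuous z : strip v0 z -> {for z, continuous chi}.
Proof. exact: (chart_cont hchi). Qed.

(** The bound is r - 2 >= 4: a C^4 patch leaves A1 and the deformed patch of class C^3, and the
    slope of class C^1. *)
Lemma chi_class k i : (k <= 4)%N ->
  classC k (strip v0 `&` chi @^-1` dom i) (local_coord i \o chi).
Proof.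
move=> k4; apply: classC_le (chart_class hchi i).
by rewrite (leq_trans k4)// leq_subRL// (leq_trans _ hr).
Qed.

Lemma immersion_le k : (k <= r)%N -> immersion k alpha.
Proof. by move=> kr i; split; [exact: classC_le (halpha i).1|exact: (halpha i).2]. Qed.

(** The product of the Jacobians comes from differentiating local_coord o chi o h = id. It gives the
    regularity of [chi] and transfers the regularity of a patch back to the atlas. *)
Lemma chart_local_inverse i z : strip v0 z -> dom i (chi z) ->
  exists (W : set (R * R)) (h : R * R -> R * R),
    [/\ open W, W (local_coord i (chi z)) & W `<=` local_coord i @` dom i] /\
    [/\ classC 2 W h, h (local_coord i (chi z)) = z,
        forall y, W y -> strip v0 (h y) /\ chi (h y) = local_param i y &
        det2 (pd_u h (local_coord i (chi z))) (pd_v h (local_coord i (chi z))) * jac chi i z = 1].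
Proof.
move=> Sz dz; have [W [h [[oW Wy WC] [ch' hy hW]]]] := chart_inverse hchi Sz dz.
have ch : classC 2 W h by apply: classC_le ch'; rewrite leq_subRL (leq_trans _ hr).
exists W, h; split; first by split; [exact: oW|exact: Wy|exact: WC].
set y := local_coord i (chi z) in Wy hy *; pose f := local_coord i \o chi.
split; [exact: ch|exact: hy|exact: hW|].
have dh : differentiable h y by exact: classC_differentiable ch Wy.
have df : differentiable f (h y).
  by rewrite hy; exact: (coord_differentiable (fun i => @chi_class 1 i isT) Sz dz).
have e : \near y, (f \o h) y = id y.
  apply: filterS (open_nbhs_nbhs (conj oW Wy)) => x Wx; have [_ ex] := hW x Wx.
  by rewrite /f /= ex; have [p dp <-] := WC x Wx; rewrite coordK.
have d1 : det2 (pd_u (f \o h) y) (pd_v (f \o h) y) = 1.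
  have eu : pd_u (f \o h) y = (1, 0) := etrans (near_eq_pd_u e) (derive_id _ _).
  have ev : pd_v (f \o h) y = (0, 1) := etrans (near_eq_pd_v e) (derive_id _ _).
  by apply: (etrans (congr2 (@det2 R) eu ev)); rewrite /det2 /= mulr1 mulr0 subr0.
have := etrans (esym (det2_comp df dh)) d1; rewrite hy; exact.
Qed.

Lemma chi_jac_neq0 i z : strip v0 z -> dom i (chi z) -> jac chi i z != 0.
Proof.
move=> Sz dz; have [W [h [_ [_ _ _ e]]]] := chart_local_inverse Sz dz.
have G (a b : R) : a * b = 1 -> b != 0.
  by move=> ab; apply/eqP => b0; move/eqP: ab; rewrite b0 mulr0 eq_sym oner_eq0.
exact: (G _ _ e).
Qed.

Lemma core_strip_class : classC 4 (strip v0) (alpha \o chi).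
Proof.
apply: (patch_class open_strip chi_continuous (k := 3)) => //.
  by move=> i; exact: chi_class.
by move=> i; apply: classC_le (halpha i).1; exact: (leq_trans _ hr).
Qed.

Lemma chi_core : chi \o (fun s : R => (s, 0)) = c.
Proof. by apply/funext => s; exact: (chart_core hchi). Qed.

Lemma core_pd_u s : pd_u (alpha \o chi) (s, 0) = frame_T alpha c s.
Proof.
have e : (fun t : R => (alpha \o chi) (t, 0)) = alpha \o c.
  by apply/funext => t /=; rewrite (chart_core hchi).
exact: (etrans (esym (derive_slice_u (alpha \o chi) s 0))
  (etrans (congr1 (fun f : R -> 'rV[R]_3 => 'D_1 f s) e) (esym (derive1E _ _)))).
Qed.

(** The remainder B is given as continuous, so v^3 B is treated through the definition of the
    derivative: the normal displacement is v times a function that is continuous and zero at v =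
    0. *)
Lemma core_pd_v s :
  pd_v (alpha \o chi) (s, 0) = cross (frame_N alpha c s) (frame_T alpha c s).
Proof.
set N := frame_N alpha c s; set n := cross _ _.
pose h := 2 * at_point (@meanH R) alpha (c s) - at_point (mean_of m) alpha (c s).
pose rho (t : R) := h * (t ^+ 2 / 2) + A s / 6 * t ^+ 3 + t ^+ 3 * B (s, t).
have dr : is_derive (0 : R) 1 rho 0.
  apply: is_derive_at0; first by rewrite /rho !expr0n /= !mul0r !mulr0 !addr0.
  move=> e e0.
  have cq : {for (0 : R), continuous (fun t : R => h * (t / 2) + A s / 6 * t ^+ 2 + t ^+ 2 * B (s, t))}.
    have ct : {for (0 : R), continuous (fun t : R => t)} by exact: cvg_id.
    have c2 : {for (0 : R), continuous (fun t : R => t ^+ 2)} by exact: exprn_continuous.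
    apply: cvgD; first apply: cvgD.
    - by apply: cvgM; [exact: cvg_cst|apply: cvgM; [exact: ct|exact: cvg_cst]].
    - by apply: cvgM; [exact: cvg_cst|exact: c2].
    - apply: cvgM; first exact: c2.
      have cB := chart_rem_cont hchi (strip_core s).
      have cp : {for (0 : R), continuous (fun t : R => (s, t))}.
        apply: (cvg_pair (G := nbhs s) (H := nbhs (0 : R))); [exact: cvg_cst|exact: cvg_id].
      exact: (cvg_comp _ _ cp cB).
  have /cvgrPdist_le/(_ e e0) := cq; apply: filterS => t.
  have -> : h * (0 / 2) + A s / 6 * 0 ^+ 2 + 0 ^+ 2 * B (s, 0) = 0 by ring.
  rewrite sub0r normrN mul0r subr0 => ht.
  have -> : rho t = t * (h * (t / 2) + A s / 6 * t ^+ 2 + t ^+ 2 * B (s, t)).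
    by rewrite /rho; ring.
  by rewrite normrM mulrC ler_wpM2r.
have d : is_derive (0 : R) 1 (fun t : R => alpha (c s) + t *: n + rho t *: N) n.
  have d1 : is_derive (0 : R) 1 (fun t : R => t *: n) n.
    have := is_derive_scaler n (is_derive_id (0 : R) 1).
    by rewrite scale1r.
  have d2 : is_derive (0 : R) 1 (fun t : R => rho t *: N) 0.
    by have := is_derive_scaler N dr; rewrite scale0r.
  have := is_deriveD (is_deriveD (is_derive_cst (alpha (c s)) (0 : R) 1) d1) d2.
  by rewrite add0r addr0.
rewrite -derive_slice_v; have [_ <-] := d.
apply: near_eq_derive.
near=> t; rewrite /= (chart_form hchi) //.
by near: t; exact: (near0_norm_lt (chart_width hchi)).
Unshelve. all: by end_near. Qed.

(** The argument takes place in a chart of the atlas, since the orientation of [chi] is itself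
    deduced from this frame. *)
Lemma frame_normal s : dot (frame_N alpha c s) (frame_N alpha c s) = 1 /\
  dot (frame_N alpha c s) (frame_T alpha c s) = 0.
Proof.
have Sz := strip_core s; pose i := chart_at (c s).
have dz : dom i (chi (s, 0)) by rewrite (chart_core hchi); exact: dom_chart_at.
pose Y := alpha \o local_param i; pose y := (local_coord i \o chi) (s, 0).
have Cy : (local_coord i @` dom i) y by exists (chi (s, 0)).
have NE : frame_N alpha c s = unit_normal Y y.
  exact: (congr1 (fun p => unit_normal Y (local_coord i p)) (esym (chart_core hchi s))).
have rY : regular_at Y y := (halpha i).2 y Cy.
have dY : differentiable Y y.
  exact: classC_differentiable (classC_le (leq_trans (isT : (1 <= 6)%N) hr) (halpha i).1) Cy.
have df := coord_differentiable (fun i => @chi_class 1 i isT) Sz dz.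
have eT := etrans (esym (core_pd_u s)) (esym (near_eq_pd_u
  (patch_local open_strip chi_continuous alpha Sz dz))).
have eT' := etrans eT (@derive_pair R (R * R)%type _ Y _ (s, 0) (1, 0) dY df).
split; first exact: (eq_ind_r (fun N => dot N N = 1) (unit_normal_unit rY) NE).
have G (N N' T u v : 'rV[R]_3) (a b : R) : N = N' -> T = a *: u + b *: v ->
    dot N' u = 0 -> dot N' v = 0 -> dot N T = 0.
  by move=> -> -> hu hv; rewrite dotDr !dotZr hu hv !mulr0 addr0.
exact: (G _ _ _ _ _ _ _ NE eT' (unit_normal_u Y y) (unit_normal_v Y y)).
Qed.

(* T /\ (N /\ T) = N: the frame (X_s, X_v) is positively oriented along c. *)
Lemma core_positive s : positive_part (strip v0) chi (s, 0).
Proof.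
have Sz := strip_core s; pose i := chart_at (c s).
have dz : dom i (chi (s, 0)) by rewrite (chart_core hchi); exact: dom_chart_at.
have c1 j := @chi_class 1 j isT.
apply: (positive_partP open_strip chi_continuous c1 _ Sz dz); first exact: (leq_trans _ hr).
pose Y := alpha \o local_param i; pose y := (local_coord i \o chi) (s, 0).
have Cy : (local_coord i @` dom i) y by exists (chi (s, 0)).
have NE : frame_N alpha c s = unit_normal Y y.
  exact: (congr1 (fun p => unit_normal Y (local_coord i p)) (esym (chart_core hchi s))).
have rY : regular_at Y y := (halpha i).2 y Cy.
have dY : differentiable Y y.
  exact: classC_differentiable (classC_le (leq_trans (isT : (1 <= 6)%N) hr) (halpha i).1) Cy.
have df := coord_differentiable c1 Sz dz.
have e := near_eq_2jet (patch_local open_strip chi_continuous alpha Sz dz).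
case: e => eu ev _ _ _.
have [NN NT] := frame_normal s.
have G (N T w p q : 'rV[R]_3) (j k : R) : 0 < k -> N = k *: w ->
    p = T -> q = cross N T -> dot T T = 1 -> dot N T = 0 ->
    cross p q = j *: w -> w != 0 -> 0 < j.
  move=> k0 eN -> -> TT NT'; rewrite cross_cross_same TT NT' scale1r scale0r subr0 eN.
  move/eqP; rewrite -subr_eq0 -scalerBl scaler_eq0 => /orP[|/eqP->]; last by rewrite eqxx.
  by rewrite subr_eq0 => /eqP <-.
have k0 : 0 < (Num.sqrt (area2 Y y))^-1 by rewrite invr_gt0 sqrtr_gt0; exact: area2_gt0.
exact: (G _ _ _ _ _ _ _ k0 (etrans NE (unit_normalE Y y)) (etrans eu (core_pd_u s))
  (etrans ev (core_pd_v s)) (harc s) NT (cross_comp df dY) rY).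
Qed.

Local Notation X := (alpha \o chi).
Local Notation U := (positive_part (strip v0) chi).

Let r2 : (2 <= r)%N. Proof. exact: leq_trans hr. Qed.

Lemma sub_positive_part : U `<=` strip v0.
Proof. by move=> z []. Qed.

Lemma open_core : open U.
Proof.
apply: (open_positive_part (k := 1) open_strip chi_continuous) => //.
by move=> i; exact: chi_class.
Qed.

Lemma core_continuous z : U z -> {for z, continuous chi}.
Proof. by move=> [Sz _]; exact: chi_continuous. Qed.

Lemma core_coord_class i : classC 2 (U `&` chi @^-1` dom i) (local_coord i \o chi).
Proof.
apply: (classC_sub _ (@chi_class 2 i isT)) => z [[Sz _] dz]; split; [exact: Sz|exact: dz].
Qed.

Lemma core_pos i z : U z -> dom i (chi z) -> 0 < jac chi i z.
Proof. by move=> [_ h] dz; exact: (h i dz). Qed.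

Lemma core_class : classC 4 U X.
Proof. exact: classC_sub sub_positive_part core_strip_class. Qed.

Lemma core_regular z : U z -> regular_at X z.
Proof.
exact: (patch_regular_pos open_core core_continuous core_coord_class core_pos (immersion_le r2)).
Qed.

Lemma core_normal s : unit_normal X (s, 0) = frame_N alpha c s.
Proof.
have dz : dom (chart_at (c s)) (chi (s, 0)).
  by rewrite (chart_core hchi); exact: dom_chart_at.
apply: (etrans (esym (patch_unit_normal open_core core_continuous core_coord_class core_pos
  (immersion_le r2) (core_positive s) dz))).
exact: (congr1 (fun p => unit_normal (alpha \o local_param (chart_at (c s)))
  (local_coord (chart_at (c s)) p)) (chart_core hchi s)).
Qed.

Lemma is_derive_axis (s : R) : is_derive s 1 (fun s : R => (s, 0 : R)) (1, 0).
Proof.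
have d1 := is_derive_scaler ((1, 0) : R * R) (is_derive_id s 1).
have -> : (fun s : R => (s, 0 : R)) = (fun s : R => s *: ((1, 0) : R * R)).
  by apply/funext => t; change ((t, 0 : R) = (t * 1, t * 0)); rewrite mulr1 mulr0.
by move: d1; rewrite scale1r.
Qed.

Lemma core_forms s : [/\ coef_E X (s, 0) = 1, coef_F X (s, 0) = 0 & coef_G X (s, 0) = 1].
Proof.
have [NN NT] := frame_normal s.
have G (N T p q : 'rV[R]_3) : p = T -> q = cross N T -> dot T T = 1 ->
    dot N T = 0 -> dot N N = 1 -> [/\ dot p p = 1, dot p q = 0 & dot q q = 1].
  move=> -> -> TT hNT hNN; split; [exact: TT|rewrite dotC; exact: dot_crossr|].
  by rewrite dot_cross_cross hNN TT hNT expr2; ring.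
exact: (G _ _ _ _ (core_pd_u s) (core_pd_v s) (harc s) NT NN).
Qed.

(** In the direction (1, 0), with E = G = 1 and F = 0, one has k_n = e and tau_g = f: the conditions
    of a mean curvature line become e = M and f = A1, and k_1 < k_2 becomes K < H^2. *)
Lemma core_curvatures s :
  [/\ coef_e X (s, 0) = curv_M m X (s, 0), coef_f X (s, 0) = A1 s,
      0 < coef_K X (s, 0) & coef_K X (s, 0) < coef_H X (s, 0) ^+ 2].
Proof.
have := hc; rewrite -chi_core => -[_ _ [_ /(_ s Logic.I) hl] _].
have [[eK eM e1 e2] [en et]] := patch_curve_point open_core core_continuous core_coord_class
  core_pos m (immersion_le r2) (core_positive s) (is_derive_axis s).
have rz := core_regular (core_positive s).
have [EE FF GG] := core_forms s.
have eA : A1 s = geod_torsion X (s, 0) (1, 0).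
  apply: (etrans (hA1 s)); apply: (etrans _ et).
  exact: (congr1 (fun c => curve_torsion alpha c s) (esym chi_core)).
have G1 (K K' M M' k1 k1' k2 k2' n n' s0 t : R) : K = K' -> M = M' -> k1 = k1' -> k2 = k2' ->
  n = n' -> [/\ 0 < K, k1 < k2, n = M & t = s0] -> [/\ 0 < K', k1' < k2' & n' = M'].
  by move=> <- <- <- <- <- [h1 h2 h3 h4]; split; [exact: h1|exact: h2|exact: h3].
have [h1 h2 h3] := G1 _ _ _ _ _ _ _ _ _ _ _ _ eK eM e1 e2 en hl.
have n1 : normal_curv X (s, 0) (1, 0) = coef_e X (s, 0).
  have G (E F G e f g I J : R) : E = 1 ->
      I = E * 1 ^+ 2 + 2 * F * 1 * 0 + G * 0 ^+ 2 ->
      J = e * 1 ^+ 2 + 2 * f * 1 * 0 + g * 0 ^+ 2 -> J / I = e.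
    by move=> -> -> ->; rewrite !expr2 !mulr0 !addr0 !mulr1 divr1.
  exact: (G _ _ _ _ _ _ _ _ EE (form_coefE X (s, 0) (1, 0)) (form2_coefE X (s, 0) (1, 0))).
have t1 : geod_torsion X (s, 0) (1, 0) = coef_f X (s, 0).
  have G (E F G e f g I t : R) : E = 1 -> F = 0 -> G = 1 ->
      I = E * 1 ^+ 2 + 2 * F * 1 * 0 + G * 0 ^+ 2 ->
      t = ((E * f - F * e) * 1 ^+ 2 + (E * g - G * e) * 1 * 0 + (F * g - G * f) * 0 ^+ 2)
        / (Num.sqrt (E * G - F ^+ 2) * I) -> t = f.
    move=> -> -> -> -> ->; rewrite !expr2 !mulr0 !mul0r !addr0 !mulr1 !mul1r !subr0.
    by rewrite sqrtr1 divr1.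
  exact: (G _ _ _ _ _ _ _ _ EE FF GG (form_coefE X (s, 0) (1, 0))
    (geod_torsionE open_core (classC_le (isT : (2 <= 4)%N) core_class) core_regular
      (1, 0) (core_positive s))).
split.
- exact: (etrans (esym n1) (etrans h3 (curv_ME m rz))).
- exact: (esym (etrans eA t1)).
- exact: (eq_ind _ (fun x => 0 < x) h1 _ (gaussKE rz)).
- have G (H K k1 k2 : R) : k1 = H - Num.sqrt (H ^+ 2 - K) -> k2 = H + Num.sqrt (H ^+ 2 - K) ->
    k1 < k2 -> K < H ^+ 2.
    move=> -> ->; exact: sqrt_gap_gt0.
  exact: (G _ _ _ _ (kappa1E rz) (kappa2E rz) h2).
Qed.

(** The normal is that of [alpha] in a chart of the atlas, composed with [chi]: both are C^4.
    Differentiating the C^4 patch X would only give C^3. *)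
Lemma core_normal_class : classC 4 U (unit_normal X).
Proof.
apply: classC_local => z Uz; pose i := chart_at (chi z).
have dz : dom i (chi z) := dom_chart_at (chi z).
pose Y := alpha \o local_param i.
exists (U `&` chi @^-1` dom i); first by split; [exact: Uz|exact: dz].
have oi : open (U `&` chi @^-1` dom i) := @open_piece _ _ _ _ _ open_core core_continuous i.
have cY : classC 4 (local_coord i @` dom i) (unit_normal Y).
  apply: classC_normal; first exact: cod_open.
    exact: (classC_le (leq_trans (isT : (5 <= 6)%N) hr) (halpha i).1).
  exact: (halpha i).2.
apply: (@classC_congr _ _ 4 _ (unit_normal Y \o (local_coord i \o chi)) _ oi).
  move=> y [Uy dy].
  exact: (patch_unit_normal open_core core_continuous core_coord_class core_pos
    (immersion_le r2) Uy dy).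
apply: (classC_comp oi _ cY).
  by move=> y [_ dy]; exists (chi y).
apply: (classC_sub _ (@chi_class 4 i isT)) => y [[Sy _] dy]; split; [exact: Sy|exact: dy].
Qed.

Lemma classC_axis {W : normedModType R} k (f : R * R -> W) :
  classC k U f -> classC k setT (fun z => f (z.1, 0)).
Proof.
move=> cf; apply: (@classC_comp R W k U setT f (fun z => (z.1, 0)) openT _ cf).
  by move=> z _; exact: core_positive.
exact: (classC_pair openT (classC_proj1 k openT) (classC_cst k setT (0 : R))).
Qed.

(* The torsion is written - <N_s, X_v>: the formula <X_sv, N> would cost one
   derivative more. *)
Lemma core_torsion_class : classC 3 setT (fun z : R * R => A1 z.1).
Proof.
have cN : classC 3 U (pd_u (unit_normal X)) := classC_pd_u core_normal_class.
have cv : classC 3 U (pd_v X) := classC_pd_v core_class.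
have cA := classC_axis (classCN open_core (classC_dot open_core cN cv)).
apply: (classC_congr openT _ cA) => z _.
have [_ e _ _] := weingarten open_core (classC_le (isT : (2 <= 4)%N) core_class) core_regular
  (core_positive z.1).
have [_ f _ _] := core_curvatures z.1.
have G (a b d : R) : a = - b -> b = d -> - a = d by move=> -> <-; rewrite opprK.
exact: (G _ _ _ e f).
Qed.

Local Notation S := (strip v0).

(** In the strip [beta eps] is X + v^3 (eps bump_field), a perturbation of order three. The normal
    is taken on the axis, so the field is smooth on the whole plane. *)
Definition bump_field : R * R -> 'rV[R]_3 :=
  fun z => (A1 z.1 / 6 * delta z.2) *: unit_normal X (z.1, 0).

Lemma classC_bump : classC 3 setT bump_field.
Proof.
have [dd _ _ _] := hdelta.
have cA := core_torsion_class.
have cN : classC 3 setT (fun z : R * R => unit_normal X (z.1, 0)).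
  exact: (classCS (classC_axis (core_normal_class))).
have cd : classC 3 setT (fun z : R * R => delta z.2).
  have h1 n (v : R) : (n < 3)%N -> setT v -> derivable (derive1n n delta) v 1.
    by move=> n3 _; apply: dd; exact: leq_trans n3 (leq_trans _ hr).
  have h2 (v : R) : setT v -> {for v, continuous (derive1n 3 delta)}.
    move=> _; apply: differentiable_continuous; apply/derivable1_diffP.
    by apply: dd; exact: (leq_trans _ hr).
  exact: (@classC_comp1 R 3 setT setT delta snd openT (fun _ _ => Logic.I) h1 h2
    (classC_proj2 3 openT)).
apply: (classCZ openT _ cN); apply: (classCM openT _ cd).
exact: (classCM openT cA (classC_cst 3 setT (6^-1 : R))).
Qed.

Lemma beta_chi eps z : S z ->
  perturb X (fun z => eps *: bump_field z) z = (beta eps \o chi) z.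
Proof.
case: z => s v Sz; have [hb _] := hbeta eps; rewrite /= hb// /perturb /vpow /bump_field /=.
rewrite (core_normal) !scalerA; congr (_ + _ *: _); ring.
Qed.

Lemma classC_eps_bump eps : classC 3 S (fun z => eps *: bump_field z).
Proof.
have o := open_strip.
by apply: (classCZ o (classC_cst 3 S eps)); exact: classC_sub classC_bump.
Qed.

Lemma beta_chi_class eps : classC 3 S (beta eps \o chi).
Proof.
have o := open_strip.
apply: (classC_congr o (beta_chi eps)); apply: (classC_perturb o _ (classC_eps_bump eps)).
exact: (classCS (core_strip_class)).
Qed.

Lemma beta_chi_near eps z : S z ->
  \near z, perturb X (fun z => eps *: bump_field z) z = (beta eps \o chi) z.
Proof.
move=> Sz; have n : nbhs z S by apply: open_nbhs_nbhs; split; [exact: open_strip|].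
by apply: filterS n; exact: beta_chi.
Qed.

Lemma strip_regular z : S z -> regular_at X z.
Proof.
move=> Sz; pose i := chart_at (chi z).
have dz : dom i (chi z) := dom_chart_at (chi z).
have ib : immersion 1 alpha := immersion_le (leq_trans (isT : (1 <= 6)%N) hr).
have hcl j := chi_class j (isT : (2 <= 4)%N).
have o := open_strip.
exact: (patch_regular o (chi_continuous) hcl ib Sz dz (chi_jac_neq0 Sz dz)).
Qed.

Lemma perturb_pd (eps : R) z : S z ->
  let Q := vpow 3 bump_field in let Y := perturb X (fun z => eps *: bump_field z) in
  pd_u Y z = pd_u X z + eps *: pd_u Q z /\ pd_v Y z = pd_v X z + eps *: pd_v Q z.
Proof.
move=> Sz Q Y.
have dX : differentiable X z := classC_differentiable (core_strip_class) Sz.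
have dQ : differentiable Q z.
  exact: (classC_differentiable (classC_vpow 3 openT classC_bump) (Logic.I : setT z)).
have e : Y = (fun z => X z + (eps *: Q) z).
  apply/funext => y; apply: (congr1 (+%R (X y))).
  exact: (etrans (scalerA _ _ _) (etrans (congr1 (fun a => a *: _) (mulrC _ _)) (esym (scalerA _ _ _)))).
have G w : 'D_w Y z = 'D_w X z + eps *: 'D_w Q z.
  apply: (etrans (congr1 (fun f : R * R -> 'rV[R]_3 => 'D_w f z) e)).
  have dX' : derivable X z w by exact: diff_derivable.
  have dQ' : derivable Q z w by exact: diff_derivable.
  apply: (etrans (deriveD dX' (@derivableZ _ _ _ Q eps z w dQ'))).
  exact: (congr1 (+%R ('D_w X z)) (@deriveZ _ _ _ Q eps z w dQ')).
by split; exact: G.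
Qed.

(** The cross product of the partial derivatives is jointly continuous at (z0, 0) and nonzero there;
    the joint neighbourhood is what the compactness argument over z consumes. *)
Lemma near_regular_strip z0 : S z0 -> \forall z \near z0 & eps \near (0 : R),
  S z -> regular_at (perturb X (fun z => eps *: bump_field z)) z.
Proof.
move=> Sz0; pose Q := vpow 3 bump_field.
have cQ : classC 3 setT Q := classC_vpow 3 openT classC_bump.
have cX := core_strip_class.
pose G (D : (R * R -> 'rV[R]_3) -> R * R -> 'rV[R]_3) (p : (R * R) * R) :=
  D X p.1 + p.2 *: D Q p.1.
have cG D : {for z0, continuous (D X)} -> {for z0, continuous (D Q)} ->
    G D p @[p --> (nbhs z0, nbhs (0 : R))] --> D X z0.
  move=> c1 c2; rewrite -[D X z0]addr0 -[X in _ + X](scale0r (D Q z0)).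
  rewrite /G; apply: cvgD; first exact: (cvg_comp _ _ (@cvg_fst _ _ (nbhs z0) (nbhs (0 : R)) _) c1).
  apply: cvgZ; first exact: cvg_snd.
  exact: (cvg_comp _ _ (@cvg_fst _ _ (nbhs z0) (nbhs (0 : R)) _) c2).
have cu := cG (@pd_u R _) (classC_continuous (classC_pd_u cX) Sz0)
  (classC_continuous (classC_pd_u cQ) (Logic.I : setT z0)).
have cv := cG (@pd_v R _) (classC_continuous (classC_pd_v cX) Sz0)
  (classC_continuous (classC_pd_v cQ) (Logic.I : setT z0)).
have cc : cross (G (@pd_u R _) p) (G (@pd_v R _) p) @[p --> (nbhs z0, nbhs (0 : R))] -->
    cross (pd_u X z0) (pd_v X z0).
  exact: (cvg_comp _ _ (cvg_pair cu cv) (@continuous_cross R (pd_u X z0, pd_v X z0))).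
have n := cvgr_neq0 _ cc (strip_regular Sz0).
apply: filterS (n _) => -[z eps] /= h Sz; have [eu ev] := perturb_pd eps Sz.
exact: (eq_ind_r (fun x => x != 0) h (congr2 (@cross R) eu ev)).
Qed.

Lemma near_regular : \forall eps \near (0 : R), forall z, 0 <= z.1 <= L -> S z ->
  regular_at (beta eps \o chi) z.
Proof.
have [_ _ _ [w /andP[w0 wv0] dw]] := hdelta.
(* For |v| <= w' compactness gives a uniform eps; for |v| > w' > w the cutoff vanishes around the
   point, where the deformed patch is X for every eps. *)
pose w' := (w + v0) / 2.
have [w1 w2] : w < w' /\ w' < v0 by rewrite /w'; split; lra.
pose K : set (R * R) := `[0, L]%classic `*` `[- w', w']%classic.
have cK : compact K by apply: compact_setX; exact: segment_compact.
have KS z : K z -> S z.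
  move=> [_ /=]; rewrite in_itv /= -ler_norml => h.
  by rewrite /strip /=; exact: le_lt_trans h w2.
have : \forall eps \near (0 : R), K `<=` (fun z => S z ->
    regular_at (perturb X (fun z => eps *: bump_field z)) z).
  apply: ((compact_near_coveringP K).1 cK R (nbhs (0 : R)) (fun eps z => S z ->
    regular_at (perturb X (fun z => eps *: bump_field z)) z) _) => z Kz.
  exact: near_regular_strip (KS z Kz).
apply: filterS => eps h z z1 Sz.
have reg : regular_at (perturb X (fun z => eps *: bump_field z)) z.
  have [zw|zw] := leP `|z.2| w'.
    by apply: h => //; split; rewrite /= in_itv /= -?ler_norml.
  have n : \near z, X z = perturb X (fun z => eps *: bump_field z) z.
    have o : open (setT `&` [set z : R * R | 0 < `|z.2| - w]).
      apply: open_gt0; first exact: openT.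
      by move=> y _; apply: cvgB; [apply: cvg_norm; exact: cvg_snd|exact: cvg_cst].
    have zo : (setT `&` [set z : R * R | 0 < `|z.2| - w]) z.
      by split=> //=; rewrite subr_gt0 (lt_trans w1).
    apply: filterS (open_nbhs_nbhs (conj o zo)) => y [_ /=]; rewrite subr_gt0 => yw.
    rewrite /perturb /vpow /bump_field dw ?ltW// mulr0 scale0r !scaler0.
    by rewrite addr0.
  exact: (eq_ind _ (fun x => x != 0) (strip_regular Sz) _
    (congr2 (@cross R) (near_eq_pd_u n) (near_eq_pd_v n))).
have n := beta_chi_near eps Sz.
exact: (eq_ind _ (fun x => x != 0) reg _
    (congr2 (@cross R) (near_eq_pd_u n) (near_eq_pd_v n))).
Qed.

Lemma reduce_period z : S z -> exists z', [/\ S z', 0 <= z'.1 <= L, z'.2 = z.2 & chi z' = chi z].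
Proof.
have [_ L0 _ _] := hc.
move=> Sz; have [n hn] := shift_itv z.1 L0.
have S' : S (z.1 + n%:~R * L, z.2) by [].
exists (z.1 + n%:~R * L, z.2); split=> //.
by apply/esym/(chart_inj hchi Sz S'); split=> //; exists n.
Qed.

(** By periodicity one period in s suffices, so the deformation is confined to the image of a
    compact rectangle. In the Hausdorff surface that image is closed, and [beta eps] equals [alpha]
    on its open complement. *)
Lemma beta_off : exists2 w, 0 < w < v0 & forall eps p,
  ~ (chi @` (`[0, L]%classic `*` `[- w, w]%classic)) p -> beta eps p = alpha p.
Proof.
have [_ _ _ [w /andP[w0 wv0] dw]] := hdelta.
exists w; first by rewrite w0.
move=> eps p np; have [b1 b2] := hbeta eps.
have [[z Sz zp]|] := pselect ((chi @` S) p); last exact: b2.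
have [z' [Sz' z'1 z'2 z'p]] := reduce_period Sz.
have zw : w <= `|z'.2|.
  rewrite leNgt; apply/negP => h; apply: np; exists z'; last by rewrite z'p.
  split; rewrite /= in_itv /=; first exact: z'1.
  by rewrite -ler_norml ltW.
rewrite -zp -z'p; move: Sz' zw; case: z' {z'1 z'2 z'p} => s v /= Sz' zw.
by rewrite b1// dw// mulr0 scale0r addr0.
Qed.

(** A point of the chart region is handled through a local inverse of [chi], after a shift by a
    multiple of L into the period where the regularity is given; any other point has a neighbourhood
    on which [beta eps] is [alpha]. *)
Lemma immersion_beta eps :
  (forall z, 0 <= z.1 <= L -> S z -> regular_at (beta eps \o chi) z) ->
  immersion 2 (beta eps).
Proof.
move=> reg; have [w /andP[w0 wv0] off] := beta_off.
pose K := chi @` (`[0, L]%classic `*` `[- w, w]%classic).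
have KS z : (`[0, L]%classic `*` `[- w, w]%classic) z -> S z.
  move=> [_ /=]; rewrite in_itv /= -ler_norml => h.
  by rewrite /strip /=; exact: le_lt_trans h wv0.
have cK : closed K.
  apply: compact_closed; first exact: surf_hausdorff.
  apply: continuous_compact; last by apply: compact_setX; exact: segment_compact.
  by apply: continuous_in_subspaceT => z /set_mem /KS; exact: (chi_continuous).
suff loc i x : (local_coord i @` dom i) x -> exists W, [/\ open W, W x,
    classC 2 W (beta eps \o local_param i) & regular_at (beta eps \o local_param i) x].
  move=> i; split.
    by apply: classC_local => x /loc[W [_ Wx cW _]]; exists W.
  by move=> x /loc[W [_ _ _ rW]].
move=> Cx; have [p dp px] := Cx.
have [Kp|nKp] := pselect ((chi @` S) p).
  have [z0 Sz0 z0p] := Kp.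
  have [z [Sz z1 _ zp]] := reduce_period Sz0.
  have dz : dom i (chi z) by rewrite zp z0p.
  have xz : local_coord i (chi z) = x by rewrite zp z0p.
  have [W [h []]] := chart_local_inverse Sz dz.
  rewrite xz => -[oW Wx _] [ch hx hW dt].
  have e y : W y -> ((beta eps \o chi) \o h) y = (beta eps \o local_param i) y.
    by move=> /hW[_ /= ->].
  have cb := beta_chi_class eps.
  exists W; split; [exact: oW|exact: Wx| |].
    apply: (classC_congr oW e); apply: (classC_comp oW _ (classC_le (isT : (2 <= 3)%N) cb) ch).
    by move=> y /hW[].
  have dh : differentiable h x by exact: classC_differentiable ch Wx.
  have db : differentiable (beta eps \o chi) (h x).
    by rewrite hx; exact: classC_differentiable cb Sz.
  have n : \forall y \near x, ((beta eps \o chi) \o h) y = (beta eps \o local_param i) y.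
    by apply: filterS (open_nbhs_nbhs (conj oW Wx)).
  have G (u v u' v' q : 'rV[R]_3) (a b : R) : u' = u -> v' = v -> cross u' v' = a *: q ->
      a * b = 1 -> q != 0 -> cross u v != 0.
    move=> -> -> -> ab q0; rewrite scaler_eq0 negb_or q0 andbT.
    by apply/eqP => a0; move/eqP: ab; rewrite a0 mul0r eq_sym oner_eq0.
  have rz := reg z z1 Sz; rewrite -hx in rz.
  exact: (G _ _ _ _ _ _ _ (near_eq_pd_u n) (near_eq_pd_v n) (cross_comp dh db) dt rz).
pose W := (local_coord i @` dom i) `&` (local_param i @^-1` (~` K)).
have oW : open W.
  have oC : open (local_coord i @` dom i) by exact: cod_open.
  rewrite openE => y [Cy ny]; apply: filterI; first exact: open_nbhs_nbhs.
  by apply: (param_cont Cy); apply: open_nbhs_nbhs; split=> //; exact: closed_openC.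
have e y : W y -> (alpha \o local_param i) y = (beta eps \o local_param i) y.
  by move=> [_ ny] /=; rewrite off.
have Wx : W x.
  split=> //= -[z /KS Sz]; rewrite -px coordK// => zp; apply: nKp.
  by exists z.
exists W; split; [exact: oW|exact: Wx| |].
  apply: (classC_congr oW e); apply: classC_sub (classC_le (leq_trans _ hr) (halpha i).1).
    by move=> y [].
  by [].
have n : \forall y \near x, (alpha \o local_param i) y = (beta eps \o local_param i) y.
  by apply: filterS (open_nbhs_nbhs (conj oW Wx)).
exact: (eq_ind _ (fun x => x != 0) ((halpha i).2 x Cx) _
    (congr2 (@cross R) (near_eq_pd_u n) (near_eq_pd_v n))).
Qed.

Let oU : open U := open_core.

Definition slope_rate s : R :=
  (pd_u (fun z => m z.1 z.2) (coef_H X (s, 0), coef_K X (s, 0))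
   + 2 * curv_M m X (s, 0) * pd_v (fun z => m z.1 z.2) (coef_H X (s, 0), coef_K X (s, 0))) / 4.

Lemma slope_rate_gt0 s : positive_regular m -> 0 < slope_rate s.
Proof.
have [_ _ K0 HK] := core_curvatures s.
move=> /(_ _ _ K0 HK); rewrite derive1_mean_u derive1_mean_v => h.
exact: (divr_gt0 h (ltr0n R 4)).
Qed.

Let cX := core_class.
Let rX := core_regular.

Lemma axis_continuous (s : R) : {for s, continuous (fun s : R => (s, 0 : R))}.
Proof.
by apply: (cvg_pair (G := nbhs s) (H := nbhs (0 : R))); [exact: cvg_id|exact: cvg_cst].
Qed.

Lemma slope_rate_continuous : continuous slope_rate.
Proof.
move=> s; have Uz := core_positive s.
have [_ _ K0 HK] := core_curvatures s.
have cH : {for (s, 0), continuous (coef_H X)}.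
  exact: (classC_continuous (classC_H oU (classC_le (isT : (2 <= 4)%N) cX) rX) Uz).
have cK : {for (s, 0), continuous (coef_K X)}.
  exact: (classC_continuous (classC_K oU (classC_le (isT : (2 <= 4)%N) cX) rX) Uz).
have cHs : {for s, continuous (fun s => coef_H X (s, 0))} := cvg_comp _ _ (@axis_continuous s) cH.
have cKs : {for s, continuous (fun s => coef_K X (s, 0))} := cvg_comp _ _ (@axis_continuous s) cK.
have cz : {for s, continuous (fun s => (coef_H X (s, 0), coef_K X (s, 0)))}.
  by apply: (cvg_pair (G := nbhs _) (H := nbhs _)); [exact: cHs|exact: cKs].
have ez : elliptic (coef_H X (s, 0), coef_K X (s, 0)) by split; [exact: K0|exact: HK].
have cm := classC_mean hm.
pose mu (z : R * R) := m z.1 z.2.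
have c0 : {for (coef_H X (s, 0), coef_K X (s, 0)), continuous mu} := classC_continuous cm ez.
have cu : {for (coef_H X (s, 0), coef_K X (s, 0)), continuous (pd_u mu)} :=
  classC_continuous (classC_pd_u cm) ez.
have cv : {for (coef_H X (s, 0), coef_K X (s, 0)), continuous (pd_v mu)} :=
  classC_continuous (classC_pd_v cm) ez.
have G (T : topologicalType) (x : T) (a b d : T -> R) : {for x, continuous a} ->
    {for x, continuous b} -> {for x, continuous d} ->
    {for x, continuous (fun x => (a x + 2 * b x * d x) / 4)}.
  move=> ha hb hd; apply: cvgM; last exact: cvg_cst.
  by apply: cvgD; [exact: ha|apply: cvgM; [apply: cvgM; [exact: cvg_cst|exact: hb]|exact: hd]].
have cu' : {for s, continuous (fun s => pd_u mu (coef_H X (s, 0), coef_K X (s, 0)))} :=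
  cvg_comp _ _ cz cu.
have c0' : {for s, continuous (fun s => mu (coef_H X (s, 0), coef_K X (s, 0)))} :=
  cvg_comp _ _ cz c0.
have cv' : {for s, continuous (fun s => pd_v mu (coef_H X (s, 0), coef_K X (s, 0)))} :=
  cvg_comp _ _ cz cv.
exact: (@G R s _ _ _ cu' c0' cv').
Qed.

Lemma core_transverse_at s : transverse m X (s, 0).
Proof.
have [ez fz K0 HK] := core_curvatures s.
have [E1 F0 G1] := core_forms s.
have f0 : 0 < coef_f X (s, 0) := eq_ind_r (fun x => 0 < x) (hA1pos s) fz.
exact: (core_transverse E1 F0 ez f0 K0 HK).
Qed.

Lemma core_slope_continuous : continuous (fun s => pd_v (slope m X) (s, 0)).
Proof.
move=> s; have Uz := core_positive s.
have cs := transverse_slope hm oU (classCS cX) rX.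
have Tz : (U `&` [set z | transverse m X z]) (s, 0) := conj Uz (core_transverse_at s).
exact: (cvg_comp _ _ (@axis_continuous s) (classC_continuous (classC_pd_v cs) Tz)).
Qed.

(** * One member of the family *)

Section Member.
Variable eps : R.
Hypothesis ib : immersion 2 (beta eps).
Local Notation Y := (beta eps \o chi).
Local Notation T := (U `&` [set z | transverse m Y z]).

Lemma member_regular z : S z -> regular_at Y z.
Proof.
move=> Sz; pose i := chart_at (chi z).
have dz : dom i (chi z) := dom_chart_at (chi z).
have ib1 : immersion 1 (beta eps).
  by move=> j; split; [exact: (classCS (ib j).1)|exact: (ib j).2].
have hcl j := chi_class j (isT : (2 <= 4)%N).
have o := open_strip.
exact: (patch_regular o (chi_continuous) hcl ib1 Sz dz (chi_jac_neq0 Sz dz)).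
Qed.

Let US := sub_positive_part.
Let cYS := beta_chi_class eps.
Let cY : classC 3 U Y := classC_sub US cYS.
Let rY z (Uz : U z) : regular_at Y z := member_regular (US Uz).

Lemma member_2jet s : same_2jet X Y (s, 0).
Proof.
have o := open_strip; have Sz := strip_core s.
have cXS := classCS (core_strip_class).
have cP := classC_eps_bump eps.
have [J _] := perturb_jet o cXS cP Sz (erefl : (s, 0 : R).2 = 0).
exact: (same_2jet_trans J (near_eq_2jet (beta_chi_near eps Sz))).
Qed.

Lemma member_core s :
  [/\ coef_E Y (s, 0) = 1, coef_F Y (s, 0) = 0 & coef_G Y (s, 0) = 1] /\
  [/\ coef_e Y (s, 0) = curv_M m Y (s, 0), 0 < coef_f Y (s, 0), 0 < coef_K Y (s, 0) &
      coef_K Y (s, 0) < coef_H Y (s, 0) ^+ 2].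
Proof.
have [ez fz K0 HK] := core_curvatures s.
have [E1 F0 G1] := core_forms s.
have f0 : 0 < coef_f X (s, 0) := eq_ind_r (fun x => 0 < x) (hA1pos s) fz.
exact: (same_2jet_core (member_2jet s) E1 F0 G1 ez f0 K0 HK).
Qed.

Lemma member_transverse s : T (s, 0).
Proof.
split; first exact: (core_positive s).
have [[E1 F0 G1] [ez f0 K0 HK]] := member_core s.
exact: (core_transverse E1 F0 ez f0 K0 HK).
Qed.

Lemma member_slope0 s : slope m Y (s, 0) = 0.
Proof.
have [[E1 F0 G1] [ez f0 K0 HK]] := member_core s.
exact: (core_slope E1 F0 ez).
Qed.

(** The factor 6 from the third derivative of v^3 cancels the 6 of A1 / 6, and A1 = f cancels the f
    in the denominator: the increment depends on s through [slope_rate] alone. *)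
Lemma member_slope_derive s :
  pd_v (slope m Y) (s, 0) = pd_v (slope m X) (s, 0) + eps * slope_rate s.
Proof.
have o := open_strip; have Sz := strip_core s.
have cXS := classCS (core_strip_class).
have cP := classC_eps_bump eps.
have [ez fz K0 HK] := core_curvatures s.
have [E1 F0 G1] := core_forms s.
have f0 : 0 < coef_f X (s, 0) := eq_ind_r (fun x => 0 < x) (hA1pos s) fz.
have nP z (Sz' : S z) := beta_chi_near eps Sz'.
have rP z : S z -> regular_at (perturb X (fun z => eps *: bump_field z)) z.
  move=> Sz'; have [eu ev _ _ _] := near_eq_2jet (nP z Sz').
  exact: (eq_ind_r (fun x => x != 0) (member_regular Sz') (congr2 (@cross R) eu ev)).
have rXS := strip_regular.
have e := perturb_slope_derive hm o cXS cP Sz (erefl : (s, 0 : R).2 = 0) rXS rP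
  E1 F0 G1 ez f0 K0 HK.
have n : \forall z \near (s, 0), slope m
    (perturb X (fun z => eps *: bump_field z)) z = slope m Y z.
  apply: filterS (open_nbhs_nbhs (conj o Sz)) => z Sz'.
  exact: (same_2jet_slope m (near_eq_2jet (nP z Sz'))).
have ed : dot (eps *: bump_field (s, 0)) (unit_normal X (s, 0)) =
    eps * (A1 s / 6).
  have d0 : delta 0 = 1 by have [_ _ d _] := hdelta; exact: (nbhs_singleton d).
  have NN := unit_normal_unit (rXS _ Sz).
  have G (N : 'rV[R]_3) (a d : R) : dot N N = 1 -> d = 1 ->
      dot (eps *: ((a / 6 * d) *: N)) N = eps * (a / 6).
    by move=> hN ->; rewrite !dotZl hN !mulr1.
  exact: (G _ _ _ NN d0).
have G (a b d f t k h : R) : a = b + 6 * d / (4 * f) * k -> d = eps * (t / 6) -> f = t ->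
    0 < t -> h = k / 4 -> a = b + eps * h.
  by move=> -> -> -> t0 ->; field; rewrite gt_eqF.
exact: (G _ _ _ _ _ _ _ (etrans (esym (near_eq_pd_v n)) e) ed fz (hA1pos s) erefl).
Qed.

Lemma member_line (g dg : R -> R * R) (J : set R) : open J ->
  (forall t, J t -> [/\ T (g t), is_derive t 1 g (dg t), {for t, continuous dg} &
     dg t = (1, slope m Y (g t))]) ->
  mean_line Maximal m (beta eps) (chi \o g) J.
Proof.
move=> oJ hg.
apply: (patch_mean_line oU (core_continuous) (core_coord_class)
  core_pos ib oJ (dg := dg)).
  move=> t Jt; have [[Ut _] d1 d2 d3] := hg t Jt; split; [exact: Ut|exact: d1|exact: d2|].
  by rewrite d3; apply/eqP => -[/eqP]; rewrite oner_eq0.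
move=> t Jt; have [[Ut tt] _ _ d3] := hg t Jt.
have := slope_line oU (classCS cY) rY Ut tt.
move=> h; exact: (eq_ind_r (fun w => [/\ 0 < gaussK Y (g t), kappa1 Y (g t) < kappa2 Y (g t),
  normal_curv Y (g t) w = mean_of m Y (g t) & geod_torsion Y (g t) w =
  Num.sqrt ((kappa2 Y (g t) - mean_of m Y (g t)) * (mean_of m Y (g t) - kappa1 Y (g t)))])
  h d3).
Qed.

Lemma member_cycle : mean_cycle Maximal m (beta eps) c L.
Proof.
have [_ L0 _ per] := hc; split; [exact: ib|exact: L0| |exact: per].
rewrite -(chi_core); apply: (member_line openT (dg := cst (1, 0))) => s _.
split; [exact: member_transverse|exact: is_derive_axis|exact: cst_continuous|].
by rewrite member_slope0.
Qed.

Lemma section_axis (eta : R) : 0 < eta -> (forall x, `|x| < eta -> U (0, x)) ->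
  section_to c (fun x => chi (0, x)) eta.
Proof.
move=> eta0 hU.
have dax (x : R) : is_derive x 1 (fun x : R => (0 : R, x)) (0, 1).
  exact: (is_derive_pair (is_derive_cst (0 : R) x 1) (is_derive_id x 1)).
have o : open [set x : R | `|x| < eta].
  have -> : [set x : R | `|x| < eta] = (`]- eta, eta[%classic : set R).
    by apply/seteqP; split=> x /=; rewrite in_itv /= ltr_norml.
  exact: interval_open.
split; [exact: eta0| | |exact: (chart_core hchi)|].
- apply: (@regular_patch_curve R r V U chi (core_continuous) (core_coord_class)
    core_pos (fun x => (0, x)) (cst (0, 1)) _ o) => x hx.
  split; [exact: hU|exact: dax|exact: cst_continuous|].
  by apply/eqP => -[/eqP]; rewrite oner_eq0.
- move=> x y hx hy e.
  by have [/= ->] := (chart_inj hchi (US (hU x hx)) (US (hU y hy))).1 e.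
- move=> i di; have Uz := core_positive 0.
  have di' : dom i (chi (0, 0)) by rewrite (chart_core hchi).
  have [_ d1] := is_derive_coord (core_coord_class) Uz di' (dax 0).
  have [_ d2] := is_derive_coord (core_coord_class) Uz di' (is_derive_axis 0).
  have e : c = chi \o (fun s : R => (s, 0)) := esym (chi_core).
  have d2' : 'D_1 (local_coord i \o c) 0 = pd_u (local_coord i \o chi) (0, 0).
    exact: (etrans (congr1 (fun g : R -> V => 'D_1 (local_coord i \o g) 0) e) d2).
  have G (a b x y : R * R) : a = y -> b = x -> 0 < det2 x y -> det2 a b != 0.
    move=> -> -> h; have -> : det2 y x = - det2 x y by rewrite /det2; ring.
    by rewrite oppr_eq0 gt_eqF.
  exact: (G _ _ _ _ (etrans (derive1E _ _) d1) (etrans (derive1E _ _) d2') (core_pos Uz di')).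
Qed.

(** [return_map] asks a leaf to leave the section in the direction of c. At x = 0 the inner product
    is E = 1, and it is continuous in x. *)
Lemma direction_near : \forall x \near (0 : R),
  0 < dot (1 *: pd_u Y (0, x) + slope m Y (0, x) *: pd_v Y (0, x)) (pd_u Y (0, 0)).
Proof.
have oT := open_transverse_part hm oU cY rY.
have cp := transverse_slope hm oU cY rY.
have T0 := member_transverse 0.
have cu : {for (0, 0), continuous (pd_u Y)} := classC_continuous (classC_pd_u cY) T0.1.
have cv : {for (0, 0), continuous (pd_v Y)} := classC_continuous (classC_pd_v cY) T0.1.
have cs : {for (0, 0), continuous (slope m Y)} := classC_continuous cp T0.
have ca : {for (0 : R), continuous (fun x : R => (0 : R, x))}.
  by apply: (cvg_pair (G := nbhs (0 : R)) (H := nbhs (0 : R))); [exact: cvg_cst|exact: cvg_id].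
have cu' : {for (0 : R), continuous (fun x => pd_u Y (0, x))} := cvg_comp _ _ ca cu.
have cv' : {for (0 : R), continuous (fun x => pd_v Y (0, x))} := cvg_comp _ _ ca cv.
have cs' : {for (0 : R), continuous (fun x => slope m Y (0, x))} := cvg_comp _ _ ca cs.
have E1 : 0 < dot (1 *: pd_u Y (0, 0) + slope m Y (0, 0) *: pd_v Y (0, 0)) (pd_u Y (0, 0)).
  have [[e _ _] _] := member_core 0.
  have G (a b : 'rV[R]_3) (s : R) : dot a a = 1 -> s = 0 -> 0 < dot (1 *: a + s *: b) a.
    by move=> h ->; rewrite scale0r addr0 scale1r h.
  exact: (G _ _ _ e (member_slope0 0)).
have G (a b : R -> 'rV[R]_3) (s : R -> R) (w : 'rV[R]_3) :
    {for (0 : R), continuous a} -> {for (0 : R), continuous b} ->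
    {for (0 : R), continuous s} -> 0 < dot (1 *: a 0 + s 0 *: b 0) w ->
    \forall x \near (0 : R), 0 < dot (1 *: a x + s x *: b x) w.
  move=> ha hb hs h0.
  have h1 : 1 *: a x + s x *: b x @[x --> (0 : R)] --> 1 *: a 0 + s 0 *: b 0.
    apply: cvgD; apply: cvgZ; [exact: cvg_cst|exact: ha|exact: hs|exact: hb].
  have h2 : dot (1 *: a x + s x *: b x) w @[x --> (0 : R)] --> dot (1 *: a 0 + s 0 *: b 0) w.
    exact: (cvg_comp _ _ (cvg_pair h1 (cvg_cst w))
      (@continuous_dot R (1 *: a 0 + s 0 *: b 0, w))).
  exact: (cvgr_gt _ h2).
exact: (G _ _ _ _ cu' cv' cs' E1).
Qed.

Lemma member_velocity (g : R -> R * R) (t : R) w : S (g t) -> is_derive t 1 g w ->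
  derive1 (beta eps \o (chi \o g)) t = w.1 *: pd_u Y (g t) + w.2 *: pd_v Y (g t).
Proof.
move=> Sg [dg gw]; have dg' : differentiable g t by exact/derivable1_diffP.
have dY : differentiable Y (g t) by exact: classC_differentiable cYS Sg.
have e := etrans (derive1E _ _) (@derive_pair R R 'rV[R]_3 Y g t 1 dY dg').
exact: (etrans e (congr1 (fun w : R * R => w.1 *: pd_u Y (g t) + w.2 *: pd_v Y (g t)) gw)).
Qed.

(** The leaves are the graphs t -> (t, v x t), so along them s is the time: the first return to the
    section s = 0 modulo L happens at time L, and the return map is x -> v x L. *)
Lemma member_hyperbolic (Theta : R -> R) :
  (forall s : R, -1 < s -> is_derive s 1 Theta (pd_v (slope m Y) (s, 0))) ->
  Theta L - Theta 0 != 0 -> hyperbolic_mean_cycle Maximal m (beta eps) c L.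
Proof.
move=> dTheta nTheta; split; first exact: member_cycle.
have [_ L0 _ _] := hc.
have oT := open_transverse_part hm oU cY rY.
have cp := transverse_slope hm oU cY rY.
have [v [vL0 hv [dv ev]]] := flow_near_zero oT member_transverse cp member_slope0 L0 dTheta.
have [eta eta0 hU] : exists2 eta : R, 0 < eta & forall x : R, `|x| < eta -> U (0, x).
  have ca : {for (0 : R), continuous (fun x : R => (0 : R, x))}.
    by apply: (cvg_pair (G := nbhs (0 : R)) (H := nbhs (0 : R))); [exact: cvg_cst|exact: cvg_id].
  have n : \forall x \near (0 : R), U (0, x).
    by apply: ca; apply: open_nbhs_nbhs; split; [exact: oU|exact: (member_transverse 0).1].
  have [e /= e0 he] := n; exists e; first exact: e0.
  by move=> x xe; apply: he => /=; rewrite sub0r normrN.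
exists (fun x => chi (0, x)), eta, (v ^~ L); split.
- exact: section_axis.
- split; first exact: vL0.
  apply: filterS2 (hv eta eta0) direction_near => x [vx0 hx] dir.
  have LJ : - 2^-1 < L < L + 2^-1.
    by apply/andP; split; [apply: (lt_trans _ L0); rewrite oppr_lt0 invr_gt0|rewrite ltrDl invr_gt0].
  have zJ : - 2^-1 < (0 : R) < L + 2^-1.
    by apply/andP; split; [rewrite oppr_lt0 invr_gt0|rewrite addr_gt0// invr_gt0].
  split; first by have [] := hx L LJ.
  pose g (t : R) := (t, v x t); pose dg (t : R) : R * R := (1, slope m Y (g t)).
  have dgP (t : R) : - 2^-1 < t < L + 2^-1 -> is_derive t 1 g (dg t).
    move=> /hx[_ _ d]; exact: (is_derive_pair (is_derive_id t 1) d).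
  have g0 : g 0 = (0, x) by rewrite /g vx0.
  (* The solutions were built half a unit of time beyond both ends of [0, L]. *)
  exists (chi \o g), L, 2^-1; split; [exact: L0|by rewrite invr_gt0| | |split].
  + have oJ : open [set t : R | - 2^-1 < t < L + 2^-1].
      have -> : [set t : R | - 2^-1 < t < L + 2^-1] = (`]- 2^-1, L + 2^-1[%classic : set R).
        by apply/seteqP; split=> t /=; rewrite in_itv.
      exact: interval_open.
    apply: (member_line oJ (dg := dg)) => t Jt; have [_ Tt _] := hx t Jt.
    split; [exact: Tt|exact: dgP| |by []].
    have cg : {for t, continuous g}.
      have [dgt _] := dgP t Jt.
      by apply: differentiable_continuous; exact/derivable1_diffP.
    have cs : {for g t, continuous (slope m Y)} := classC_continuous cp Tt.
    have cs' : {for t, continuous (fun t => slope m Y (g t))} := cvg_comp _ _ cg cs.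
    by apply: (cvg_pair (G := nbhs (1 : R)) (H := nbhs _)); [exact: cvg_cst|exact: cs'].
  + have [_ [Tg _] _] := hx 0 zJ.
    have e1 := member_velocity (US Tg) (dgP 0 zJ).
    have e2 := member_velocity (US (member_transverse 0).1) (is_derive_axis 0).
    have e2' : derive1 (beta eps \o c) 0 = 1 *: pd_u Y (0, 0) + 0 *: pd_v Y (0, 0).
      exact: (etrans (congr1 (fun g : R -> V => derive1 (beta eps \o g) 0) (esym (chi_core))) e2).
    have G (a b u w n d : 'rV[R]_3) (s : R) : a = n -> b = 1 *: w + 0 *: d ->
        0 < dot n w -> 0 < dot a b.
      by move=> -> ->; rewrite scale1r scale0r addr0.
    apply: (G _ _ 0 _ _ _ 0 e1 e2').
    exact: (eq_ind_r (fun z => 0 < dot (1 *: pd_u Y z + slope m Y z *: pd_v Y z) (pd_u Y (0, 0)))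
      dir g0).
  + by rewrite /= g0.
  + rewrite /=; have [_ [Tg _] _] := hx L LJ.
    have S1 : S (0, v x L) by have := US Tg.
    apply: (chart_inj hchi (US Tg) S1).2; split; first by [].
    (* 0 = L + (-1) L: the line s = L is identified with s = 0. *)
    by exists (-1); rewrite /= mulN1r subrr.
  (* A meeting with the section forces t to be an integer multiple of L, and none lies strictly
     between 0 and L. *)
  + move=> t y /andP[t0 tL] hy e.
    have Jt : - 2^-1 < t < L + 2^-1.
      move: zJ LJ => /andP[z1 _] /andP[_ l2].
      by apply/andP; split; [exact: lt_trans z1 t0|exact: lt_trans tL l2].
    have [_ [Tg _] _] := hx t Jt.
    have [_ [n /= en]] := (chart_inj hchi (US Tg) (US (hU y hy))).1 e.
    have nL : t = (- n)%:~R * L by rewrite mulrNz mulNr; apply/eqP; rewrite -addr_eq0 -en.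
    move: t0 tL; rewrite nL pmulr_lgt0// ltr0z => n0.
    by rewrite gtr_pMl// ltrz1; move: n0; rewrite gtz0_ge1 leNgt => /negP.
- exact: dv.
- rewrite derive1E ev -(@expR0 R); apply: contra_neq nTheta; exact: expR_inj.
Qed.

End Member.

Lemma near_immersion : \forall eps \near (0 : R), immersion 2 (beta eps).
Proof.
apply: filterS (near_regular) => eps.
exact: (immersion_beta).
Qed.

Lemma near_hyperbolic : positive_regular m ->
  \forall eps \near (0 : R)^', hyperbolic_mean_cycle Maximal m (beta eps) c L.
Proof.
move=> pm; have [_ L0 _ _] := hc.
have n1 : (-1 : R) < 0 by rewrite ltrN10.
have [F [_ F0 dF]] := bounded_primitive n1 core_slope_continuous.
have [G [_ G0 dG]] := bounded_primitive n1 slope_rate_continuous.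
have dG' t : 0 <= t <= L -> is_derive t 1 G (slope_rate t).
  by move=> /andP[t0 _]; apply: dG; exact: lt_le_trans t0.
(* G L - G 0 is [slope_rate] at some t times L, hence positive. *)
have [t _ eG] := mean_value (ltW L0) dG'.
have GL : 0 < G L - G 0 by rewrite eG subr0 mulr_gt0// slope_rate_gt0.
have n2 := near_shift_neq0 (F L - F 0) GL.
suff n3 : \forall eps \near (0 : R), eps != 0 ->
    hyperbolic_mean_cycle Maximal m (beta eps) c L by exact: n3.
apply: filterS2 near_immersion n2 => eps ib ne eps0.
(* Theta = F + eps G: the two primitives are chosen once, so that the exponent of the return map is
   affine in eps. *)
have h1 (s : R) : -1 < s ->
    is_derive s 1 (fun s => F s + eps * G s) (pd_v (slope m (beta eps \o chi)) (s, 0)).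
  move=> s1; have e := member_slope_derive ib s.
  have d := is_deriveD (dF s s1) (is_deriveZ eps (dG s s1)).
  exact: (eq_ind_r (fun x => is_derive s 1 (fun s => F s + eps * G s) x) d e).
apply: (@member_hyperbolic eps ib _ h1).
have -> : F L + eps * G L - (F 0 + eps * G 0) = F L - F 0 + eps * (G L - G 0) by ring.
exact: ne.
Qed.

End CycleChart.

Theorem proposition3 (R : realType) (m : R -> R -> R)
    (hm : mean_curvature_function m)
    (r : nat) (hr : (6 <= r)%N)
    (V : oriented_surface R r) (hV : compact [set: V])
    (alpha : V -> 'rV[R]_3) (halpha : immersion r alpha)
    (c : R -> V) (L : R) (hc : mean_cycle Maximal m alpha c L)
    (harc : forall s, dot (frame_T alpha c s) (frame_T alpha c s) = 1)
    (v0 : R) (chi : R * R -> V) (A : R -> R) (B : R * R -> R)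
    (hchi : cycle_chart m alpha c L v0 chi A B)
    (A1 : R -> R) (hA1 : forall s, A1 s = curve_torsion alpha c s)
    (hA1pos : forall s, 0 < A1 s)
    (delta : R -> R) (hdelta : cutoff r v0 delta)
    (beta : R -> V -> 'rV[R]_3)
    (hbeta : deformation alpha c v0 chi A1 delta beta) :
  (\forall eps \near (0 : R),
     exists F : mean_foliation, mean_cycle F m (beta eps) c L) /\
  (positive_regular m ->
   \forall eps \near (0 : R)^',
     exists F : mean_foliation, hyperbolic_mean_cycle F m (beta eps) c L).
Proof.
split.
  apply: filterS (near_immersion hr halpha hc harc hchi hA1 hdelta hbeta) => eps ib.
  (* The torsion along c is the same for [beta eps] and [alpha], so c stays in the maximal
     foliation. *)
  exists Maximal.
  exact: (member_cycle hr halpha hc harc hchi hA1 hA1pos hdelta hbeta ib).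
move=> pm; have n := near_hyperbolic hm hr halpha hc harc hchi hA1 hA1pos hdelta hbeta pm.
by apply: filterS n => eps h; exists Maximal.
Qed.
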